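(* Let $T>0$, let $\sigma>0$ be a constant, let $a_t,\bar a_t,b_t,\beta_t,m_t,\bar m_t,n_t$ be deterministic real-valued continuous functions of $t\in[0,T]$ with $n_t>0$ for all $t\in[0,T]$, and let $q,\bar q\in\mathbb{R}$ be constants. Then, for any given initial condition $x^{(0)}\in\mathbb{R}$, the forward-backward stochastic differential equation of McKean--Vlasov type $$dx_t=\Bigl[a_tx_t+\bar a_t\mathbb{E}\{x_t\}-\frac{b_t^2}{n_t}y_t+\beta_t\Bigr]dt+\sigma\,dW_t,\qquad x_0=x^{(0)},$$ $$dy_t=-\bigl[a_ty_t+m_t(m_tx_t+\bar m_t\mathbb{E}\{x_t\})\bigr]dt-\bigl[\bar a_t\mathbb{E}\{y_t\}+\bar m_t(m_t+\bar m_t)\mathbb{E}\{x_t\}\bigr]dt+z_t\,dW_t,$$ $$y_T=q\bigl(qx_T+\bar q\,\mathbb{E}\{x_T\}\bigr)+\bar q(q+\bar q)\mathbb{E}\{x_T\},$$ for $t\in[0,T]$, has a unique solution $(x_t,y_t,z_t)_{0\le t\le T}$.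
   Context: $W=(W_t)_{0\le t\le T}$ is a standard one-dimensional Wiener process. A solution of the forward-backward system is a triple $(x_t,y_t,z_t)_{0\le t\le T}$ of real-valued processes, progressively measurable with respect to the (completed) filtration generated by $W$, with $x,y$ continuous and $\mathbb{E}[\sup_{t}|x_t|^2+\sup_t|y_t|^2+\int_0^T|z_t|^2dt]<\infty$, satisfying the equations on $[0,T]$ with the given initial and terminal conditions. *)

(* Defs.v *)
From HB Require Import structures.
From mathcomp Require Import all_boot all_order all_algebra.
From mathcomp Require Import all_classical all_reals all_analysis.

Set Implicit Arguments.
Unset Strict Implicit.
Unset Printing Implicit Defensive.

Import Order.TTheory GRing.Theory Num.Theory.
Import numFieldNormedType.Exports.

Local Open Scope classical_set_scope.
Local Open Scope ring_scope.

(* A process on [0, T] is a function R -> Omega -> R; its values at times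
   outside [0, T] are never constrained. *)

Section wiener.
Context (d : measure_display) (Omega : measurableType d) (R : realType).
Implicit Types (P : probability Omega R) (W X : R -> Omega -> R).

Definition natural_events W (t : R) : set (set Omega) :=
  [set A | exists s (B : set R),
     [/\ s \in `[0, t], measurable B & A = W s @^-1` B]].

(* The null sets are taken in the sigma-algebra of Omega, so that the completed
   filtration stays inside it.  When P is complete, these are all the subsets
   of the P-null sets. *)
Definition completed_events P W (t : R) : set (set Omega) :=
  natural_events W t `|` [set N | measurable N /\ P N = 0%E].

(* N(0, t - s) is normal_prob 0 (Num.sqrt (t - s)), which takes the standard
   deviation. *)
Record wiener_process P (T : R) W : Prop := WienerProcess {
  wiener_measurable : forall t : R, t \in `[0, T] -> measurable_fun setT (W t);
  wiener_start : {ae P, forall w, W 0 w = 0};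
  wiener_continuous :
    {ae P, forall w, {within `[0, T], continuous (fun t => W t w)}};
  wiener_gaussian : forall (s t : R) (B : set R), 0 <= s -> s < t -> t <= T ->
    measurable B ->
    P ((W t \- W s) @^-1` B) = normal_prob 0 (Num.sqrt (t - s)) B;
  wiener_independent : forall (s t : R) (A : set Omega) (B : set R),
    0 <= s -> s < t -> t <= T ->
    <<s natural_events W s >> A -> measurable B ->
    P (A `&` (W t \- W s) @^-1` B) = (P A * P ((W t \- W s)%R @^-1` B))%E
}.

(* Measurability with respect to the sigma-algebra F_t at time t of the
   completed filtration of W. *)
Definition measurable_at P W (t : R) (f : Omega -> R) : Prop :=
  measurable_fun setT (f : g_sigma_algebraType (completed_events P W t) -> R).

Definition progressively_measurable P W (T : R) X : Prop :=
  forall t : R, t \in `[0, T] ->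
    measurable_fun (`[0, t] `*` setT)
      (fun p : R * g_sigma_algebraType (completed_events P W t) => X p.1 p.2).

End wiener.

Section ito.
Context (d : measure_display) (Omega : measurableType d) (R : realType).
Context (P : probability Omega R) (T : R) (W : R -> Omega -> R).
Implicit Types (X mu phi I : R -> Omega -> R).

(* The process \sum_i xi_i 1_{]tau_i, tau_{i+1}]} with 0 = tau_0 < ... <
   tau_n = T, each xi_i being bounded and F_{tau_i}-measurable. *)
Record simple_process := SimpleProcess {
  sp_size : nat;
  sp_time : nat -> R;
  sp_coef : nat -> Omega -> R;
  sp_time0 : sp_time 0%N = 0;
  sp_timeT : sp_time sp_size = T;
  sp_time_lt : forall i, (i < sp_size)%N -> sp_time i < sp_time i.+1;
  sp_coef_measurable : forall i, (i < sp_size)%N ->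
    measurable_at P W (sp_time i) (sp_coef i);
  sp_coef_bounded : forall i, (i < sp_size)%N ->
    exists C : R, forall w, `|sp_coef i w| <= C
}.

Definition sp_value (S : simple_process) (t : R) (w : Omega) : R :=
  \sum_(i < sp_size S)
    sp_coef S i w * \1_(`]sp_time S i, sp_time S i.+1]%classic) t.

Definition sp_integral (S : simple_process) (t : R) (w : Omega) : R :=
  \sum_(i < sp_size S) sp_coef S i w *
    (W (Num.min (sp_time S i.+1) t) w - W (Num.min (sp_time S i) t) w).

(* I is a continuous version of the Ito integral of phi against W, i.e.
   I_t = \int_0^t phi_s dW_s for t in [0, T], defined as the L^2-limit of the
   integrals of simple processes approximating phi in L^2([0, T] x Omega). *)
Record ito_integral phi I : Prop := ItoIntegral {
  ito_integrand_progressive : progressively_measurable P W T phi;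
  ito_integrand_L2 :
    (\int[P]_w \int[lebesgue_measure]_(t in `[0%R, T]) (phi t w ^+ 2)%:E
       < +oo)%E;
  ito_adapted : forall t : R, t \in `[0, T] -> measurable_at P W t (I t);
  ito_continuous :
    {ae P, forall w, {within `[0, T], continuous (fun t => I t w)}};
  ito_limit : exists S : nat -> simple_process,
    ((fun k => \int[P]_w \int[lebesgue_measure]_(t in `[0%R, T])
        ((sp_value (S k) t w - phi t w) ^+ 2)%:E)%E @ \oo --> 0%E) /\
    (forall t : R, t \in `[0, T] ->
      (fun k => \int[P]_w ((sp_integral (S k) t w - I t w) ^+ 2)%:E)%E
        @ \oo --> 0%E)
}.

(* dX_t = mu_t dt + phi_t dW_t on [0, T] *)
Definition stochastic_differential X mu phi : Prop :=
  exists2 I, ito_integral phi I &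
    {ae P, forall w,
       lebesgue_measure.-integrable `[0, T] (fun s => (mu s w)%:E) /\
       forall t : R, t \in `[0, T] ->
         X t w = X 0 w + \int[lebesgue_measure]_(s in `[0%R, t]) mu s w + I t w}.

End ito.

Section mckean_vlasov.
Context (d : measure_display) (Omega : measurableType d) (R : realType).

Local Notation mean P X := (fine 'E_P[X]).

Record mkv_fbsde_solution (P : probability Omega R) (T : R)
    (W : R -> Omega -> R) (sigma : R)
    (a abar b beta m mbar n : R -> R) (q qbar x0 : R)
    (x y z : R -> Omega -> R) : Prop := MkvFbsdeSolution {
  sol_x_progressive : progressively_measurable P W T x;
  sol_y_progressive : progressively_measurable P W T y;
  sol_z_progressive : progressively_measurable P W T z;
  sol_x_continuous : forall w, {within `[0, T], continuous (fun t => x t w)};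
  sol_y_continuous : forall w, {within `[0, T], continuous (fun t => y t w)};
  sol_integrable :
    (\int[P]_w (ereal_sup [set (`|x t w| ^+ 2)%:E | t in `[0%R, T]]
                + ereal_sup [set (`|y t w| ^+ 2)%:E | t in `[0%R, T]]
                + \int[lebesgue_measure]_(t in `[0%R, T]) (`|z t w| ^+ 2)%:E)
       < +oo)%E;
  sol_forward : stochastic_differential P T W x
    (fun t w => a t * x t w + abar t * mean P (x t)
                - b t ^+ 2 / n t * y t w + beta t)
    (fun _ _ => sigma);
  sol_initial : {ae P, forall w, x 0 w = x0};
  sol_backward : stochastic_differential P T W y
    (fun t w =>
       - (a t * y t w + m t * (m t * x t w + mbar t * mean P (x t)))
       - (abar t * mean P (y t) + mbar t * (m t + mbar t) * mean P (x t)))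
    z;
  sol_terminal : {ae P, forall w,
    y T w = q * (q * x T w + qbar * mean P (x T))
            + qbar * (q + qbar) * mean P (x T)}
}.

(* x and y are compared up to indistinguishability, z up to equality
   dt (x) dP-almost everywhere on [0, T] x Omega. *)
Definition same_solution (P : probability Omega R) (T : R)
    (x y z x' y' z' : R -> Omega -> R) : Prop :=
  [/\ {ae P, forall w, forall t : R, t \in `[0, T] -> x t w = x' t w},
      {ae P, forall w, forall t : R, t \in `[0, T] -> y t w = y' t w} &
      {ae (lebesgue_measure \x P)%E, forall p : R * Omega,
         p.1 \in `[0, T] -> z p.1 p.2 = z' p.1 p.2}].

End mckean_vlasov.

(* Main.v *)
Require Import Defs.
From HB Require Import structures.
From mathcomp Require Import all_boot all_order all_algebra.
From mathcomp Require Import all_classical all_reals all_analysis measurable_realfun.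
From mathcomp Require Import ring lra.

Import Order.TTheory GRing.Theory Num.Theory.
Import numFieldNormedType.Exports.

Local Open Scope classical_set_scope.
Local Open Scope ring_scope.

Set Implicit Arguments.
Unset Strict Implicit.
Unset Printing Implicit Defensive.

(* Put c = b^2 / n.  The decoupling field of the system is eta = v / u, where
   u' = a u - c v, v' = - a v - m^2 u, u_T = 1 and v_T = q^2; here u does not
   vanish on [0, T] since (u v)' <= 0 <= u_T v_T.  The expectations of a solution
   obey a system of the same kind, with a + abar, m + mbar and q + qbar in place
   of a, m and q.

   Uniqueness.  Let (X, Y) be the difference of two solutions.  For zeta in
   L^2(F_s), the functions E[zeta X_t] and E[zeta Y_t] of t in [s, T] solve the
   deterministic linear system of (u, v), up to terms in E X and E Y.  Taking
   zeta = 1 and s = 0 gives E X = E Y = 0; then zeta = u_s Y_s - v_s X_s gives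
   Y = eta X.  Hence X solves a linear Volterra equation path by path and is 0,
   so is Y, and the isometry identifies z.

   Existence.  Take x = xbar + xi, y = ybar + eta xi and z = sigma eta, where
   (xbar, ybar) solves the system of the expectations and
   d xi = (a - c eta) xi dt + sigma dW, which is solved path by path.  The
   integrand z being deterministic and C^1, integration by parts turns its Ito
   integral into a limit of Stieltjes sums, dominated by Doob's inequality. *)

(** * Integrals and linear differential equations *)

(** Testing against [zeta] is what eliminates z: the increments of an Ito integral after time s are
    orthogonal to the square-integrable variables known at time s. What remains is a deterministic
    two-point problem on [s, T] for [phi t = E[zeta X_t]] and [psi t = E[zeta Y_t]], whose only
    boundary condition is [psi T = q^2 phi T]. Hence (phi, psi) is the multiple [phi T] of (u, v),
    and [u_s psi s - v_s phi s = 0]; for the chosen [zeta] this number is [E[zeta^2]]. The means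
    come first because they enter these equations as sources. For the means themselves, the unknown
    multiple is killed by the common initial value, as u does not vanish at 0. Global solvability
    rests on signs. The Riccati equation of eta could blow up, whereas the linear system of (u, v)
    has solutions on the whole line; the danger is moved to the zeros of u, which [c >= 0],
    [m^2 >= 0] and [q^2 >= 0] exclude. The mean terms complete squares, which preserves these signs
    for the system of the expectations. *)

Section real_integrable.
Context d (T : measurableType d) (R : realType) (mu : {measure set T -> \bar R}).
Variable D : set T.
Hypothesis mD : measurable D.
Implicit Types f g : T -> R.

Lemma integrable_EFinZl (k : R) f : mu.-integrable D (EFin \o f) ->
  mu.-integrable D (EFin \o (fun x => k * f x)).
Proof.
by move=> /(integrableZl mD k); apply: eq_integrable => // x _ /=; rewrite EFinM.
Qed.

Lemma integrable_EFinD f g : mu.-integrable D (EFin \o f) ->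
  mu.-integrable D (EFin \o g) ->
  mu.-integrable D (EFin \o (fun x => f x + g x)).
Proof.
move=> fi gi; have := integrableD mD fi gi.
by apply: eq_integrable => // x _ /=; rewrite EFinD.
Qed.

Lemma integrable_EFinB f g : mu.-integrable D (EFin \o f) ->
  mu.-integrable D (EFin \o g) ->
  mu.-integrable D (EFin \o (fun x => f x - g x)).
Proof.
move=> fi gi; have := integrableB mD fi gi.
by apply: eq_integrable => // x _ /=; rewrite EFinB.
Qed.

Lemma le_integrable_EFin f g : measurable_fun D f ->
  (forall x, D x -> `|f x| <= g x) ->
  mu.-integrable D (EFin \o g) -> mu.-integrable D (EFin \o f).
Proof.
move=> mf fg; apply: le_integrable => //; first exact/measurable_EFinP.
by move=> x Dx /=; rewrite lee_fin (le_trans (fg x Dx)) // ler_norm.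
Qed.

Lemma EFin_Rintegral f : mu.-integrable D (EFin \o f) ->
  (\int[mu]_(x in D) f x)%:E = (\int[mu]_(x in D) (f x)%:E)%E.
Proof. by move=> fi; rewrite /Rintegral fineK //; exact: integrable_fin_num. Qed.

Lemma integrable_EFin_sum I (s : seq I) (h : I -> T -> R) :
  (forall i, mu.-integrable D (EFin \o h i)) ->
  mu.-integrable D (EFin \o (fun x => \sum_(i <- s) h i x)).
Proof.
move=> hi; have := integrable_sum mD s (P := xpredT) (fun i _ => hi i).
by apply: eq_integrable => // x _ /=; rewrite sumEFin.
Qed.

Lemma Rintegral_sum I (s : seq I) (h : I -> T -> R) :
  (forall i, mu.-integrable D (EFin \o h i)) ->
  \int[mu]_(x in D) (\sum_(i <- s) h i x) = \sum_(i <- s) \int[mu]_(x in D) h i x.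
Proof.
move=> hi; elim: s => [|i s IHs].
  by rewrite big_nil; under eq_Rintegral do rewrite big_nil;
    rewrite Rintegral_cst // mul0r.
rewrite big_cons -IHs -RintegralD //; last exact: integrable_EFin_sum.
by apply: eq_Rintegral => x _; rewrite big_cons.
Qed.

End real_integrable.

(* Unlike [ge0_le_integral], this holds for nonmeasurable functions too, the
   integral of a nonnegative function being a supremum over simple functions. *)
Lemma ge0_le_integral_nonmeasurable d (T : measurableType d) (R : realType)
    (mu : {measure set T -> \bar R}) (D : set T) (f g : T -> \bar R) :
  (forall x, D x -> 0 <= f x)%E -> (forall x, D x -> f x <= g x)%E ->
  (\int[mu]_(x in D) f x <= \int[mu]_(x in D) g x)%E.
Proof.
move=> f0 fg; have g0 x : D x -> (0 <= g x)%E by move=> Dx; exact: le_trans (f0 x Dx) (fg x Dx).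
rewrite !ge0_integralE //; apply: le_ereal_sup => _ [h hf <-]; exists h => // x.
by apply: (le_trans (hf x)); rewrite /patch; case: ifPn => // /[!inE]; exact: fg.
Qed.

Section calculus.
Context {R : realType}.
Implicit Types (f F : R -> R) (s t r : R).
Notation mu := (@lebesgue_measure R).

Lemma eq_ler (x y : R) : x = y -> x <= y.
Proof. by move=> ->. Qed.

Lemma continuous_integrable_itv f s t :
  continuous f -> mu.-integrable `[s, t] (EFin \o f).
Proof.
move=> cf; apply: continuous_compact_integrable; first exact: segment_compact.
exact: continuous_subspaceT.
Qed.

Lemma Rintegral_itv_split f s r t : mu.-integrable `[s, t] (EFin \o f) ->
  s <= r -> r <= t ->
  \int[mu]_(x in `[s, t]) f x =
  \int[mu]_(x in `[s, r]) f x + \int[mu]_(x in `[r, t]) f x.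
Proof.
move=> fi sr rt.
have := @Rintegral_itvB R f (BLeft s) (BRight t) r fi.
rewrite !bnd_simp => /(_ sr rt); rewrite Rintegral_itv_obnd_cbnd; last first.
  by apply: integrableS fi => //; apply: subset_itvr; rewrite bnd_simp.
by move=> <-; rewrite addrC subrK.
Qed.

Lemma is_derive_continuous f F : (forall x : R, is_derive x 1 F (f x)) ->
  continuous F.
Proof.
by move=> dF x; apply/differentiable_continuous/derivable1_diffP/ex_derive.
Qed.

Lemma Rintegral_is_derive f F s t : continuous f ->
  (forall x : R, is_derive x 1 F (f x)) -> s <= t ->
  \int[mu]_(x in `[s, t]) f x = F t - F s.
Proof.
move=> cf dF; rewrite le_eqVlt => /predU1P[->|st].
  by rewrite set_itv1 Rintegral_set1 subrr.
have cF := is_derive_continuous dF.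
rewrite /Rintegral (@continuous_FTC2 _ f F) => //.
- exact: continuous_subspaceT.
- split=> [x _||]; first exact: ex_derive.
    by apply: cvg_at_right_filter; exact: cF.
  by apply: cvg_at_left_filter; exact: cF.
- by move=> x _; rewrite derive1E derive_val.
Qed.

(** The signed integral from [t0] to [t]: one of the two intervals is empty or a point, so that one
    formula covers both orders of the endpoints. *)
Definition primitive (t0 : R) f (t : R) : R :=
  \int[mu]_(x in `[t0, t]) f x - \int[mu]_(x in `[t, t0]) f x.

(** Anchoring both integrals at a point [A] on the left turns the two-sided primitive into a
    one-sided one minus a constant, to which the fundamental theorem of calculus applies. *)
Lemma primitiveE t0 f t : continuous f -> forall A, A <= t0 -> A <= t ->
  primitive t0 f t = \int[mu]_(x in `[A, t]) f x - \int[mu]_(x in `[A, t0]) f x.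
Proof.
move=> cf A At0 At; rewrite /primitive.
have [t0t|tt0] := leP t0 t.
  rewrite (@Rintegral_itv_split f A t0 t) //; last exact: continuous_integrable_itv.
  rewrite addrAC subrr add0r; move: t0t; rewrite le_eqVlt => /predU1P[->|t0t].
    by rewrite set_itv1 Rintegral_set1 subr0.
  have -> : [set` `[t, t0]] = set0 by rewrite set_itv_ge // bnd_simp -ltNge.
  by rewrite Rintegral_set0 subr0.
rewrite (@Rintegral_itv_split f A t t0) //; last 2 first.
  exact: continuous_integrable_itv.
  exact: ltW.
rewrite opprD addrA subrr.
have -> : [set` `[t0, t]] = set0 by rewrite set_itv_ge // bnd_simp -ltNge.
by rewrite Rintegral_set0.
Qed.

Lemma primitive0 t0 f : primitive t0 f t0 = 0.
Proof. by rewrite /primitive set_itv1 Rintegral_set1 subrr. Qed.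

Lemma is_derive_primitive t0 f : continuous f ->
  forall t, is_derive t 1 (primitive t0 f) (f t).
Proof.
move=> cf t; pose A : R := Num.min t t0 - 1.
have At : A < t by rewrite /A ltrBlDr ltr_pwDr // ge_min lexx.
have At0 : A < t0 by rewrite /A ltrBlDr ltr_pwDr // ge_min lexx orbT.
have tt1 : t < t + 1 by rewrite ltrDl.
have /= [dF F'] := continuous_FTC1_closed tt1
  (continuous_integrable_itv A (t + 1) cf) At (cf t).
have d1 : is_derive t 1 (fun y => \int[mu]_(x in `[A, y]) f x -
    \int[mu]_(x in `[A, t0]) f x) (f t).
  rewrite -[f t]subr0; apply: is_deriveB.
  by apply: (DeriveDef dF); rewrite -derive1E; exact: F'.
apply: near_eq_is_derive d1; near=> y; apply/esym/primitiveE => //; first exact: ltW.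
by apply: ltW; near: y; exact: lt_nbhsr.
Unshelve. all: by end_near. Qed.

Lemma exists_half_pow (C e : R) : 0 < e -> exists k, C / 2 ^+ k < e.
Proof.
move=> e0.
have : C * 2^-1 ^+ k @[k --> \oo] --> C * 0.
  apply: cvgM; first exact: cvg_cst.
  by apply: cvg_expr; rewrite ger0_norm ?invf_lt1 ?ltr1n ?invr_ge0.
rewrite mulr0 => /cvgrPdist_lt/(_ _ e0) [N _ /(_ N (leqnn N))] /=.
rewrite sub0r normrN exprVn => h; exists N.
exact: le_lt_trans (ler_norm _) h.
Qed.

(** The common end of the Picard and Gronwall arguments, where an error is halved at each of k
    steps. *)
Lemma le0_half_pow (C x : R) : (forall k, x <= C / 2 ^+ k) -> x <= 0.
Proof.
move=> h; rewrite leNgt; apply/negP => /(exists_half_pow C)[k].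
by rewrite ltNge h.
Qed.

Lemma is_derive_expR_affine (k t0 r : R) :
  is_derive r 1 (fun x => expR (k * (x - t0))) (k * expR (k * (r - t0))).
Proof.
have d : is_derive r 1 (fun x : R => k * (x - t0)) k.
  have := @is_deriveZ _ _ _ (fun x : R => x - t0) k r 1 1.
  by rewrite /GRing.scale /= mulr1; apply; rewrite -[X in is_derive _ _ _ X]subr0;
    apply: is_deriveB.
have := @is_derive1_comp R expR (fun x => k * (x - t0)) r _ _
  (is_derive_expR _) d.
by rewrite mulrC.
Qed.

Lemma continuous_expR_affine (k t0 : R) :
  continuous (fun x => expR (k * (x - t0))).
Proof. exact: is_derive_continuous (is_derive_expR_affine k t0). Qed.

Lemma Rintegral_expR (k t0 s t : R) : k != 0 -> s <= t ->
  \int[mu]_(x in `[s, t]) expR (k * (x - t0)) =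
  (expR (k * (t - t0)) - expR (k * (s - t0))) / k.
Proof.
move=> k0 st.
have d (x : R) : is_derive x 1 (fun x => k^-1 * expR (k * (x - t0)))
    (expR (k * (x - t0))).
  have /(@is_deriveZ _ _ _ _ k^-1 x 1 _) := is_derive_expR_affine k t0 x.
  by rewrite /GRing.scale /= mulKf.
have -> := Rintegral_is_derive (continuous_expR_affine (k := k) (t0 := t0)) d st.
by rewrite -mulrBr mulrC.
Qed.

(** Integrating the weight [expR (K |r - t0|)] away from [t0], on either side, gains a factor
    [1 / K]. A large rate thus makes integration a contraction on the whole line. *)
Lemma primitive_exp_bound t0 f M K : continuous f -> 0 < K -> 0 <= M ->
  (forall r, `|f r| <= M * expR (K * `|r - t0|)) ->
  forall t, `|primitive t0 f t| <= M / K * expR (K * `|t - t0|).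
Proof.
move=> cf K0 M0 fM t.
have fi a b : mu.-integrable `[a, b] (EFin \o f).
  exact: continuous_integrable_itv.
have nfi a b : mu.-integrable `[a, b] (EFin \o (fun x => `|f x|)).
  by apply: continuous_integrable_itv => x; apply: cvg_norm; exact: cf.
have ei (k c a b : R) :
    mu.-integrable `[a, b] (EFin \o (fun x => c * expR (k * (x - t0)))).
  apply: continuous_integrable_itv => x; apply: cvgM; first exact: cvg_cst.
  exact: continuous_expR_affine.
have ei1 (k a b : R) :
    mu.-integrable `[a, b] (EFin \o (fun x => expR (k * (x - t0)))).
  exact/continuous_integrable_itv/continuous_expR_affine.
have MK : 0 <= M / K by rewrite divr_ge0 // ltW.
rewrite /primitive; have [t0t|tt0] := leP t0 t.
  have -> : \int[mu]_(x in `[t, t0]) f x = 0.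
    move: t0t; rewrite le_eqVlt => /predU1P[->|t0t].
      by rewrite set_itv1 Rintegral_set1.
    have -> : [set` `[t, t0]] = set0 by rewrite set_itv_ge // bnd_simp -ltNge.
    by rewrite Rintegral_set0.
  rewrite subr0 (le_trans (le_normr_Rintegral _ _)) //.
  rewrite (@le_trans _ _ (\int[mu]_(x in `[t0, t]) (M * expR (K * (x - t0))))) //.
    apply: le_Rintegral => // x; rewrite /= in_itv /= => /andP[t0x _].
    by rewrite (le_trans (fM x)) // ger0_norm // subr_ge0.
  rewrite RintegralZl // Rintegral_expR ?gt_eqF // mulrA mulrAC ler_wpM2l //.
  by rewrite ger0_norm ?subr_ge0 // gerBl expR_ge0.
have -> : [set` `[t0, t]] = set0 by rewrite set_itv_ge // bnd_simp -ltNge.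
rewrite Rintegral_set0 sub0r normrN (le_trans (le_normr_Rintegral _ _)) //.
rewrite (@le_trans _ _ (\int[mu]_(x in `[t, t0]) (M * expR (- K * (x - t0))))) //.
  apply: le_Rintegral => // x; rewrite /= in_itv /= => /andP[_ xt0].
  rewrite (le_trans (fM x)) // ler0_norm ?subr_le0 //.
  by rewrite mulrN mulNr.
rewrite RintegralZl // Rintegral_expR ?oppr_eq0 ?gt_eqF //; last exact: ltW.
rewrite subrr mulr0 expR0 invrN mulrN -mulNr opprB mulrA mulrAC ler_wpM2l //.
by rewrite ltr0_norm ?subr_lt0 // mulrN mulNr gerBl.
Qed.

(** With [h k = 2 C / 2^k], the tail of the geometric series, the intervals [u k - h k, u k + h k]
    are nested, and the supremum of their left ends lies in all of them. This yields the limit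
    together with its rate. *)
Lemma half_pow_limit (u : nat -> R) (C : R) : 0 <= C ->
  (forall k, `|u k.+1 - u k| <= C / 2 ^+ k) ->
  exists l, forall k, `|l - u k| <= C * 2 / 2 ^+ k.
Proof.
move=> C0 hu; pose h k := C * 2 / 2 ^+ k.
have hS k : h k = C / 2 ^+ k + h k.+1.
  by rewrite /h exprS; field; rewrite expf_neq0 // pnatr_eq0.
pose a k := u k - h k; pose b k := u k + h k.
have ndS k : a k <= a k.+1 /\ b k.+1 <= b k.
  by move: (hu k); rewrite ler_norml /a /b (hS k) => /andP[]; lra.
have nda : {homo a : m n / (m <= n)%N >-> m <= n}.
  by apply: homo_leq => [//|y x z|k]; [exact: le_trans|exact: (ndS k).1].
have nib : {homo b : m n / (m <= n)%N >-> n <= m}.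
  apply: homo_leq => [//|y x z xy yz|k]; last exact: (ndS k).2.
  exact: le_trans yz xy.
have ab m n : a m <= b n.
  apply: (@le_trans _ _ (a (maxn m n))); first exact/nda/leq_maxl.
  apply: (@le_trans _ _ (b (maxn m n))); last exact/nib/leq_maxr.
  have : 0 <= h (maxn m n) by rewrite /h divr_ge0 // ?exprn_ge0 // mulr_ge0.
  by rewrite /a /b; lra.
exists (sup (range a)) => k.
have : a k <= sup (range a).
  apply: sup_upper_bound; last by exists k.
  by split; [exists (a 0%N), 0%N|exists (b 0%N) => _ [m _ <-]].
have : sup (range a) <= b k.
  by apply: ge_sup; [exists (a 0%N), 0%N|move=> _ [m _ <-]].
by rewrite ler_norml /a /b /h; lra.
Qed.

Lemma continuous_sum_ord n (F : 'I_n -> R -> R) :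
  (forall i, continuous (F i)) -> continuous (fun x => \sum_(i < n) F i x).
Proof.
move=> cF; apply: (continuous_big (op := +%R)) => [xy|i _]; last exact: cF.
exact: add_continuous.
Qed.

(** * Global solutions of linear systems by Picard iteration *)

Section linear_system.
Variables (n : nat) (c : 'I_n -> 'I_n -> R -> R) (g : 'I_n -> R -> R).
Variables (K t0 : R) (w0 : 'I_n -> R).
Hypothesis cc : forall i j, continuous (c i j).
Hypothesis cg : forall i, continuous (g i).
Hypothesis cK : forall i j r, `|c i j r| <= K.
Hypothesis gK : forall i r, `|g i r| <= K.

Let rhs (w : 'I_n -> R -> R) i r := \sum_(j < n) c i j r * w j r + g i r.
Let step w i t := w0 i + primitive t0 (rhs w i) t.
Let U k := iter k step (fun i _ => w0 i).

Let rhs_continuous w i : (forall j, continuous (w j)) -> continuous (rhs w i).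
Proof.
move=> cw x; apply: cvgD; last exact: cg.
by apply: continuous_sum_ord => j y; apply: cvgM; [exact: cc|exact: cw].
Qed.

Let step_continuous w : (forall j, continuous (w j)) ->
  forall i, continuous (step w i).
Proof.
move=> cw i x; apply: cvgD; first exact: cvg_cst.
have := is_derive_primitive t0 (@rhs_continuous w i cw).
by move=> /is_derive_continuous; exact.
Qed.

Let U_continuous k i : continuous (U k i).
Proof.
elim: k i => [|k IHk] i; first by move=> x; exact: cvg_cst.
exact: step_continuous.
Qed.

(** The right-hand side has Lipschitz constant [n |K|], which is at most [L / 2]; the added 1 keeps
    [L] positive when [n] or [K] is 0. *)
Let L : R := n%:R * `|K| * 2 + 1.

Let L_gt0 : 0 < L.
Proof. by rewrite /L ltr_wpDl // !mulr_ge0. Qed.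

Let e t := expR (L * `|t - t0|).

(* Picard iteration is a half-contraction for the norm sup |w| / e. *)
Let step_contract (w w' : 'I_n -> R -> R) (M : R) : (forall j, continuous (w j)) ->
  (forall j, continuous (w' j)) -> 0 <= M ->
  (forall i t, `|w i t - w' i t| <= M * e t) ->
  forall i t, `|step w i t - step w' i t| <= M / 2 * e t.
Proof.
move=> cw cw' M0 ww' i t.
pose h r := rhs w i r - rhs w' i r.
have ch : continuous h by move=> x; apply: cvgB; exact: rhs_continuous.
have -> : step w i t - step w' i t = primitive t0 h t.
  rewrite /step opprD addrACA subrr add0r /primitive /h.
  by rewrite !RintegralB ?continuous_integrable_itv //;
    [lra|exact: rhs_continuous..].
have hM r : `|h r| <= n%:R * `|K| * M * e r.
  rewrite /h /rhs opprD addrACA subrr addr0 -sumrB.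
  rewrite (le_trans (ler_norm_sum _ _ _)) //.
  rewrite (@le_trans _ _ (\sum_(j < n) `|K| * (M * e r))) //.
    apply: ler_sum => j _; rewrite -mulrBr normrM ler_pM //.
    exact: le_trans (cK i j r) (ler_norm _).
  by apply: eq_ler; rewrite sumr_const card_ord -mulr_natl; ring.
have M'0 : 0 <= n%:R * `|K| * M by rewrite !mulr_ge0.
apply: (le_trans (primitive_exp_bound ch L_gt0 M'0 hM t)).
rewrite ler_wpM2r ?expR_ge0 // ler_pdivrMr // /L; nra.
Qed.

Lemma linear_system_exists : exists w : 'I_n -> R -> R,
  (forall i, w i t0 = w0 i) /\
  forall i (t : R), is_derive t 1 (w i) (\sum_(j < n) c i j t * w j t + g i t).
Proof.
(* [A] bounds every [|w0 j|], so that [U 1 - U 0], a primitive of a function bounded by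
   [n |K| A + |K|], is at most [M e]. Each further iteration halves this bound. *)
pose A : R := \sum_(j < n) `|w0 j|.
pose M : R := (n%:R * `|K| * A + `|K|) / L.
have A0 : 0 <= A by apply: sumr_ge0.
have M0 : 0 <= M by rewrite /M divr_ge0 ?(ltW L_gt0) // addr_ge0 // !mulr_ge0.
have U1 i t : `|U 1 i t - U 0 i t| <= M * e t.
  rewrite /U /= /step addrAC subrr add0r.
  apply: (primitive_exp_bound _ L_gt0).
  - by apply: rhs_continuous => j x; exact: cvg_cst.
  - by rewrite addr_ge0 // !mulr_ge0.
  move=> r; rewrite -[leLHS]mulr1 ler_pM //; last first.
    by rewrite -expR0 ler_expR mulr_ge0 // ltW.
  rewrite (le_trans (ler_normD _ _)) // lerD //; last first.
    exact: le_trans (gK i r) (ler_norm _).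
  rewrite (le_trans (ler_norm_sum _ _ _)) //.
  rewrite (@le_trans _ _ (\sum_(j < n) `|K| * A)) //.
    apply: ler_sum => j _; rewrite normrM ler_pM //.
      exact: le_trans (cK i j r) (ler_norm _).
    by rewrite /A (bigD1 j) //= lerDl sumr_ge0.
  by apply: eq_ler; rewrite sumr_const card_ord -mulr_natl; ring.
have US k i t : `|U k.+1 i t - U k i t| <= M / 2 ^+ k * e t.
  elim: k i t => [|k IHk] i t; first by rewrite expr0 divr1.
  have := step_contract (@U_continuous k.+1) (@U_continuous k) _ IHk i t.
  rewrite exprS invfM [_^-1 * _]mulrC mulrA; apply.
  by rewrite divr_ge0 ?exprn_ge0.
have lim i t : exists l, forall k, `|l - U k i t| <= M * e t * 2 / 2 ^+ k.
  apply: half_pow_limit; first by rewrite mulr_ge0 ?expR_ge0.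
  by move=> k; rewrite mulrAC.
pose w i t := projT1 (cid (lim i t)).
have wU i t k : `|w i t - U k i t| <= M * e t * 2 / 2 ^+ k.
  by rewrite /w; case: cid.
have ce : continuous e.
  move=> x; apply: (cvg_comp _ expR); last exact: continuous_expR.
  apply: cvgM; first exact: cvg_cst.
  by apply: cvg_norm; apply: cvgB; [exact: cvg_id|exact: cvg_cst].
(* The bound [wU] grows with [e], but [e y < e t + 1] for y near t, which makes the convergence
   uniform there: an [eps / 3] argument. *)
have cw i : continuous (w i).
  move=> t; apply/cvgrPdist_lt => eps eps0.
  have [k hk] := exists_half_pow (M * (e t + 1) * 2) (e := eps / 3) ltac:(lra).
  have near_small y : e y < e t + 1 -> `|w i y - U k i y| < eps / 3.
    move=> ey; apply: (le_lt_trans (wU i y k)); apply: le_lt_trans hk.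
    rewrite ler_wpM2r ?invr_ge0 ?exprn_ge0 // ler_wpM2r // ler_wpM2l //.
    exact: ltW.
  have /cvgrPdist_lt/(_ _ ltr01) := ce t.
  have /cvgrPdist_lt/(_ (eps / 3) ltac:(lra)) := @U_continuous k i t.
  apply: filterS2 => y h1 h2.
  have := near_small t ltac:(lra).
  have := near_small y.
  move: h2; rewrite ltr_norml => /andP[h2 _] /(_ ltac:(lra)).
  move: h1; rewrite !ltr_norml => /andP[? ?] /andP[? ?] /andP[? ?].
  by apply/andP; split; lra.
(* Both sides are within a multiple of [2^-k] of [U k.+1]: the left one by convergence, the right
   one by contraction. *)
have fix_w i t : w i t = step w i t.
  apply/eqP; rewrite -subr_eq0 -normr_le0.
  apply: (@le0_half_pow (M * e t * 2)) => k.
  have := wU i t k.+1.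
  have Mk0 : 0 <= M * 2 / 2 ^+ k
    by apply: divr_ge0; [exact: mulr_ge0|exact: exprn_ge0].
  have hwU j s : `|w j s - U k j s| <= M * 2 / 2 ^+ k * e s.
    apply: (le_trans (wU j s k)); rewrite le_eqVlt; apply/orP; left; apply/eqP; ring.
  have := step_contract cw (@U_continuous k) Mk0 hwU i t.
  rewrite -[step (U k) i t]/(U k.+1 i t) distrC => h1 h2.
  rewrite -(subrKA (U k.+1 i t)); apply: (le_trans (ler_normD _ _)).
  rewrite addrC; apply: (le_trans (lerD h1 h2)).
  rewrite exprS invfM le_eqVlt; apply/orP; left; apply/eqP.
  by field; rewrite expf_neq0 // pnatr_eq0.
exists w; split=> [i|i t]; first by rewrite fix_w /step primitive0 addr0.
have -> : w i = (fun t => w0 i + primitive t0 (rhs w i) t).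
  by apply/funext => s; exact: fix_w.
rewrite -[X in is_derive _ _ _ X]add0r; apply: is_deriveD.
exact/is_derive_primitive/rhs_continuous.
Qed.

End linear_system.

(* [J t] is the part of [D] before or after [t], and [e] a weight for which the
   Volterra operator f |-> K \int_(J t) f halves the norm sup |f| / e. *)
Lemma gronwall (D : set R) (J : R -> set R) (f e : R -> R) (K M : R) :
  measurable D -> (mu D < +oo)%E -> measurable_fun D f -> 0 <= K ->
  (forall t, D t -> measurable (J t) /\ J t `<=` D) ->
  (forall t, D t -> 0 <= f t <= M) -> (forall t, D t -> 1 <= e t) ->
  mu.-integrable D (EFin \o e) ->
  (forall t, D t -> 2 * K * \int[mu]_(x in J t) e x <= e t) ->
  (forall t, D t -> f t <= K * \int[mu]_(x in J t) f x) ->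
  forall t, D t -> f t = 0.
Proof.
move=> mD Dfin mf K0 hJ fM e1 ei he hf.
have fi : mu.-integrable D (EFin \o f).
  apply: measurable_bounded_integrable => //.
  exists M; split; first exact: num_real.
  move=> x Mx t Dt; have /andP[f0 fMt] := fM t Dt.
  by rewrite /= ger0_norm // (le_trans fMt) // ltW.
have fe k t : D t -> f t <= M / 2 ^+ k * e t.
  elim: k t => [|k IHk] t Dt.
    have /andP[f0 fMt] := fM t Dt.
    by rewrite expr0 divr1 (le_trans fMt) // ler_peMr ?e1 // (le_trans f0).
  have [mJ JD] := hJ t Dt.
  have /andP[f0 fMt] := fM t Dt.
  have M0 : 0 <= M / 2 ^+ k by rewrite divr_ge0 ?exprn_ge0 // (le_trans f0).
  have eJ : mu.-integrable (J t) (EFin \o e) by exact: integrableS ei.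
  have le1 : \int[mu]_(x in J t) f x <= M / 2 ^+ k * \int[mu]_(x in J t) e x.
    rewrite -RintegralZl //; apply: le_Rintegral => //.
    - exact: integrableS fi.
    - exact: integrable_EFinZl.
    - by move=> x /JD; exact: IHk.
  apply: (le_trans (hf t Dt)); apply: (le_trans (ler_wpM2l K0 le1)).
  have -> : M / 2 ^+ k.+1 * e t = M / 2 ^+ k * (e t / 2).
    by rewrite exprS; field; rewrite expf_neq0 // pnatr_eq0.
  by rewrite mulrCA ler_wpM2l // ler_pdivlMr // mulrC mulrA he.
move=> t Dt; apply/eqP; rewrite eq_le; have /andP[-> _] := fM t Dt.
rewrite andbT; apply: (@le0_half_pow (M * e t)) => k.
by rewrite mulrAC fe.
Qed.

Let lebesgue_itv_lty (s t : R) : (mu `[s, t] < +oo)%E.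
Proof. by rewrite lebesgue_measure_itv; case: ifP => _; rewrite ltry. Qed.

(** The weight is 1 at s and grows at the rate [L > 2 K], so that its integral over [s, t] is
    [(e t - 1) / L], below [e t / L]. The backward version is its mirror image, with weight 1 at
    T. *)
Lemma gronwall_forward (f : R -> R) (K M s T : R) : 0 <= K ->
  measurable_fun `[s, T] f ->
  (forall t, t \in `[s, T] -> 0 <= f t <= M) ->
  (forall t, t \in `[s, T] -> f t <= K * \int[mu]_(x in `[s, t]) f x) ->
  forall t, t \in `[s, T] -> f t = 0.
Proof.
move=> K0 mf fM hf t; pose L := 2 * K + 1.
have L0 : 0 < L by rewrite /L; lra.
apply: (@gronwall `[s, T] (fun t => `[s, t]%classic) f
  (fun x => expR (L * (x - s))) K M) => //.
- move=> r /=; rewrite in_itv /= => /andP[sr rT]; split=> //.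
  by apply: subset_itvl; rewrite bnd_simp.
- move=> r /=; rewrite in_itv /= => /andP[sr rT].
  by rewrite -expR0 ler_expR mulr_ge0 ?(ltW L0) // subr_ge0.
- exact/continuous_integrable_itv/continuous_expR_affine.
- move=> r /=; rewrite in_itv /= => /andP[sr rT].
  rewrite Rintegral_expR ?gt_eqF // subrr mulr0 expR0 mulrA ler_pdivrMr //.
  have := expR_gt0 (L * (r - s)); rewrite /L; nra.
Qed.

Lemma gronwall_backward (f : R -> R) (K M s T : R) : 0 <= K ->
  measurable_fun `[s, T] f ->
  (forall t, t \in `[s, T] -> 0 <= f t <= M) ->
  (forall t, t \in `[s, T] -> f t <= K * \int[mu]_(x in `[t, T]) f x) ->
  forall t, t \in `[s, T] -> f t = 0.
Proof.
move=> K0 mf fM hf t; pose L := 2 * K + 1.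
have L0 : 0 < L by rewrite /L; lra.
apply: (@gronwall `[s, T] (fun t => `[t, T]%classic) f
  (fun x => expR (- L * (x - T))) K M) => //.
- move=> r /=; rewrite in_itv /= => /andP[sr rT]; split=> //.
  by apply: subset_itvr; rewrite bnd_simp.
- move=> r /=; rewrite in_itv /= => /andP[sr rT].
  by rewrite -expR0 ler_expR mulNr -mulrN opprB mulr_ge0 ?(ltW L0) // subr_ge0.
- exact/continuous_integrable_itv/continuous_expR_affine.
- move=> r /=; rewrite in_itv /= => /andP[sr rT].
  rewrite Rintegral_expR ?oppr_eq0 ?gt_eqF // subrr mulr0 expR0.
  rewrite invrN mulrN -mulNr opprB mulrA ler_pdivrMr //.
  have := expR_gt0 (- L * (r - T)); rewrite /L; nra.
Qed.

(* [f \o clamp T] extends to the line a function continuous on [0, T]. *)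
Definition clamp (T t : R) : R := Num.max 0 (Num.min T t).

Lemma clamp_itv (T t : R) : 0 <= T -> clamp T t \in `[0, T].
Proof.
move=> T0; rewrite in_itv /= /clamp le_max lexx /=.
by rewrite ge_max T0 ge_min lexx.
Qed.

Lemma clamp_id (T t : R) : t \in `[0, T] -> clamp T t = t.
Proof.
by rewrite in_itv /= /clamp => /andP[t0 tT]; rewrite (min_idPr tT) (max_idPr t0).
Qed.

Lemma continuous_clamp (T : R) : continuous (clamp T).
Proof.
move=> x; apply: continuous_max; first exact: cvg_cst.
by apply: continuous_min; [exact: cvg_cst|exact: cvg_id].
Qed.

Lemma continuous_comp_clamp (T : R) f : 0 <= T ->
  {within `[0, T], continuous f} -> continuous (f \o clamp T).
Proof.
move=> T0 /subspace_continuousP cf x.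
have fT : f z @[z --> within `[0, T] (nbhs (clamp T x))] --> f (clamp T x).
  exact/cf/clamp_itv.
apply: (@cvg_comp _ _ _ (clamp T) f _ _ _ _ fT) => Q hQ.
have : \forall y \near x, `[0, T]%classic (clamp T y) -> Q (clamp T y).
  exact: (@continuous_clamp T x _ hQ).
by apply: filterS => y; apply; exact: clamp_itv.
Qed.

Lemma bounded_comp_clamp (T : R) f : 0 <= T -> {within `[0, T], continuous f} ->
  exists K, forall t, `|f (clamp T t)| <= K.
Proof.
move=> T0 cf.
have cnf : {within `[0, T], continuous (fun x => `|f x|)}.
  by move=> x; apply: cvg_norm; exact: cf.
have [c _ hc] := EVT_max T0 cnf.
by exists `|f c| => t; apply: hc; exact: clamp_itv.
Qed.

Lemma linear_system2_exists (c11 c12 c21 c22 g1 g2 : R -> R) (K t0 w1 w2 : R) :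
  continuous c11 -> continuous c12 -> continuous c21 -> continuous c22 ->
  continuous g1 -> continuous g2 ->
  (forall t, [/\ `|c11 t| <= K, `|c12 t| <= K, `|c21 t| <= K & `|c22 t| <= K]) ->
  (forall t, `|g1 t| <= K /\ `|g2 t| <= K) ->
  exists u v : R -> R, [/\ u t0 = w1, v t0 = w2,
    forall t : R, is_derive t 1 u (c11 t * u t + c12 t * v t + g1 t) &
    forall t : R, is_derive t 1 v (c21 t * u t + c22 t * v t + g2 t)].
Proof.
move=> k11 k12 k21 k22 cg1 cg2 cK gK.
pose c (i j : 'I_2) := if i == 0 then if j == 0 then c11 else c12
                       else if j == 0 then c21 else c22.
pose g (i : 'I_2) := if i == 0 then g1 else g2.
have cc i j : continuous (c i j) by rewrite /c; case: ifP; case: ifP.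
have cg i : continuous (g i) by rewrite /g; case: ifP.
have ccK i j t : `|c i j t| <= K.
  by rewrite /c; have [] := cK t; case: ifP; case: ifP.
have cgK i t : `|g i t| <= K by rewrite /g; have [] := gK t; case: ifP.
have [w [w_t0 dw]] := @linear_system_exists 2 c g K t0
  (fun i => if i == 0 then w1 else w2) cc cg ccK cgK.
have sum2 i t : \sum_(j < 2) c i j t * w j t = c i 0 t * w 0 t + c i 1 t * w 1 t.
  rewrite !big_ord_recl big_ord0 addr0.
  by have -> : lift ord0 ord0 = 1 :> 'I_2 by exact/val_inj.
exists (w 0), (w 1); split; rewrite ?w_t0 //.
- by move=> t; have := dw 0 t; rewrite sum2.
- by move=> t; have := dw 1 t; rewrite sum2.
Qed.

(* [u v] is nonincreasing and nonnegative at T, so that a zero t0 of [u] forces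
   u v = 0 on [t0, T]; then c v = 0 there, hence u' = al u and u T = 0. *)
Lemma riccati_system_exists (al c k : R -> R) (K Q T : R) : 0 <= Q ->
  continuous al -> continuous c -> continuous k ->
  (forall t, [/\ `|al t| <= K, `|c t| <= K & `|k t| <= K]) ->
  (forall t, 0 <= c t) -> (forall t, 0 <= k t) ->
  exists u v : R -> R, [/\ u T = 1 /\ v T = Q,
    forall t : R, is_derive t 1 u (al t * u t - c t * v t),
    forall t : R, is_derive t 1 v (- (al t * v t) - k t * u t) &
    forall t, t <= T -> u t != 0].
Proof.
move=> Q0 cal cc ck bK c0 k0.
have cN (f : R -> R) : continuous f -> continuous (fun x => - f x).
  by move=> cf x; apply: cvgN; exact: cf.
have cst0 : continuous (fun _ : R => 0 : R) by move=> x; exact: cvg_cst.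
have [||u [v [uT vT du dv]]] := @linear_system2_exists al (fun x => - c x)
    (fun x => - k x) (fun x => - al x) (fun _ => 0) (fun _ => 0) K T 1 Q
    cal (cN _ cc) (cN _ ck) (cN _ cal) cst0 cst0.
- by move=> t; rewrite !normrN; have [] := bK t.
- by move=> t; rewrite normr0; have [/(le_trans (normr_ge0 _))] := bK t.
have {}du (t : R) : is_derive t 1 u (al t * u t - c t * v t).
  by have := du t; rewrite addr0 mulNr.
have {}dv (t : R) : is_derive t 1 v (- (al t * v t) - k t * u t).
  by have := dv t; rewrite addr0 !mulNr addrC.
exists u, v; split=> // t0 t0T; apply/eqP => ut0.
have t0_lt_T : t0 < T.
  by rewrite lt_neqAle t0T andbT; apply/eqP => e; move: uT (oner_neq0 R);
    rewrite -e ut0 => <-; rewrite eqxx.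
pose w x := u x * v x.
have dw (x : R) : is_derive x 1 w (- (c x * v x ^+ 2 + k x * u x ^+ 2)).
  have /= := @is_deriveM _ _ u v x 1 _ _ (du x) (dv x).
  rewrite /GRing.scale /=; set z := (X in is_derive _ _ _ X) => dz.
  suff -> : - (c x * v x ^+ 2 + k x * u x ^+ 2) = z by [].
  by rewrite /z; ring.
have cw : continuous w := is_derive_continuous dw.
have w_noninc x y : x <= y -> w y <= w x.
  move=> xy; apply: (@ler0_derive1_nincr R w x y) => //.
  - move=> z _; rewrite derive1E derive_val oppr_le0.
    by rewrite addr_ge0 // mulr_ge0 ?sqr_ge0.
  - exact: continuous_subspaceT.
have w0 x : t0 <= x -> x <= T -> w x = 0.
  move=> t0x xT; apply/eqP; rewrite eq_le.
  have := w_noninc _ _ t0x; rewrite {2}/w ut0 mul0r => -> /=.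
  by rewrite (le_trans _ (w_noninc _ _ xT)) // /w uT vT mul1r.
(* The derivative of [w] is 0 as [w] is locally 0, and it is also minus the sum of the nonnegative
   terms [c v^2] and [k u^2]; so [c v^2 = 0]. *)
have cv0 x : x \in `]t0, T[ -> c x * v x = 0.
  rewrite in_itv /= => /andP[t0x xT].
  have d0 : is_derive x 1 w 0.
    have d00 : is_derive x (1 : R) (cst (0 : R)) (0 : R) by exact: is_derive_cst.
    apply: near_eq_is_derive d00; near=> y; rewrite w0 //; apply: ltW; near: y;
      [exact: lt_nbhsr|exact: lt_nbhsl].
  have := @derive_val _ _ _ _ _ _ _ (dw x).
  rewrite (@derive_val _ _ _ _ _ _ _ d0) => /esym/eqP.
  rewrite oppr_eq0 paddr_eq0; [|by apply: mulr_ge0; rewrite ?sqr_ge0..].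
  move=> /andP[+ _].
  by rewrite mulf_eq0 sqrf_eq0 -mulf_eq0 => /eqP.
(* Integrating factor for [u' = al u]: the function [u expR (- A)] is constant on [t0, T], null at
   [t0] and positive at [T], a contradiction. *)
pose A := primitive t0 al.
have dA (x : R) : is_derive x 1 A (al x) by exact: is_derive_primitive.
have dE (x : R) : is_derive x 1 (fun y => expR (- A y)) (expR (- A x) * - al x).
  apply: (@is_derive1_comp _ expR (fun y => - A y)); exact: is_deriveN.
pose h x := u x * expR (- A x).
have dh (x : R) : x \in `]t0, T[ -> is_derive x 1 h 0.
  move=> xt; have /= := @is_deriveM _ _ u (fun y => expR (- A y)) x 1 _ _ (du x) (dE x).
  rewrite /GRing.scale /=; set z := (X in is_derive _ _ _ X) => dz.
  suff -> : 0 = z by [].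
  by rewrite /z (cv0 _ xt); ring.
have ch : continuous h.
  move=> x; apply: cvgM; first exact: (is_derive_continuous du).
  exact: (is_derive_continuous dE).
have [x _] := MVT t0_lt_T dh (continuous_subspaceT ch).
rewrite mul0r /h uT ut0 mul0r subr0 mul1r => /eqP.
by rewrite gt_eqF // expR_gt0.
Unshelve. all: by end_near. Qed.

End calculus.

(** * Square-integrable functions and Gaussian moments *)

Section square_integrable.
Context d (T : measurableType d) (R : realType) (P : probability T R).
Implicit Types f g : T -> R.

Definition square_integrable f :=
  measurable_fun setT f /\ P.-integrable setT (EFin \o (fun x => f x ^+ 2)).

Lemma square_integrable_cst (r : R) : square_integrable (cst r).
Proof.
split; first exact: measurable_cst.
exact: (finite_measure_integrable_cst P (r ^+ 2) measurableT).
Qed.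

Lemma square_integrableM f g : square_integrable f -> square_integrable g ->
  P.-integrable setT (EFin \o (fun x => f x * g x)).
Proof.
move=> [mf fi] [mg gi]; have := integrable_EFinD measurableT fi gi.
apply: le_integrable_EFin => //; first exact: measurable_funM.
move=> x _; rewrite normrM -(real_normK (num_real (f x))).
rewrite -(real_normK (num_real (g x))).
have := sqr_ge0 (`|f x| - `|g x|); have := normr_ge0 (f x).
have := normr_ge0 (g x); nra.
Qed.

Lemma square_integrable1 f : square_integrable f ->
  P.-integrable setT (EFin \o f).
Proof.
move=> fi; have := square_integrableM fi (square_integrable_cst 1).
by apply: eq_integrable => // x _; rewrite /= mulr1.
Qed.

Lemma square_integrableZ (k : R) f : square_integrable f ->
  square_integrable (fun x => k * f x).
Proof.
move=> [mf fi]; split; first exact: measurable_funM.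
have := integrable_EFinZl measurableT (k ^+ 2) fi.
by apply: eq_integrable => // x _; rewrite /= exprMn.
Qed.

Lemma square_integrableD f g : square_integrable f -> square_integrable g ->
  square_integrable (fun x => f x + g x).
Proof.
move=> fi gi; have fgi := square_integrableM fi gi.
move: fi gi => [mf fi] [mg gi]; split; first exact: measurable_funD.
have := integrable_EFinD measurableT (integrable_EFinD measurableT fi gi)
  (integrable_EFinZl measurableT 2 fgi).
by apply: eq_integrable => // x _ /=; congr (_%:E); ring.
Qed.

Lemma square_integrableB f g : square_integrable f -> square_integrable g ->
  square_integrable (fun x => f x - g x).
Proof.
move=> fi /(square_integrableZ (-1)) gi.
have := square_integrableD fi gi.
by under eq_fun do rewrite mulN1r.
Qed.

Lemma square_integrable_sum I (s : seq I) (h : I -> T -> R) :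
  (forall i, square_integrable (h i)) ->
  square_integrable (fun x => \sum_(i <- s) h i x).
Proof.
move=> hi; elim: s => [|i s IHs].
  by under eq_fun do rewrite big_nil; exact: square_integrable_cst.
by under eq_fun do rewrite big_cons; exact: square_integrableD.
Qed.

Lemma square_integrable_bounded (C : R) f g : measurable_fun setT f ->
  (forall x, `|f x| <= C) -> square_integrable g ->
  square_integrable (fun x => f x * g x).
Proof.
move=> mf fC [mg gi]; split; first exact: measurable_funM.
have := integrable_EFinZl measurableT (C ^+ 2) gi.
apply: le_integrable_EFin => //.
  by apply: measurable_funX; exact: measurable_funM.
move=> x _; rewrite normrX normrM exprMn real_normK ?num_real //.
rewrite [leRHS](_ : _ = C ^+ 2 * `|g x| ^+ 2); last by rewrite real_normK ?num_real.
by rewrite real_normK ?num_real // ler_wpM2r ?sqr_ge0 // -real_normK ?num_real //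
  lerXn2r ?nnegrE // (le_trans _ (fC x)).
Qed.

Lemma square_integrable_le f g : measurable_fun setT f ->
  (forall x, `|f x| <= g x) -> square_integrable g -> square_integrable f.
Proof.
move=> mf fg [mg gi]; split=> //; apply: le_integrable_EFin gi => //.
  exact: measurable_funX.
by move=> x _; rewrite normrX lerXn2r ?nnegrE ?fg // (le_trans _ (fg x)).
Qed.

(* Cauchy-Schwarz in the weak form 2|fg| <= e f^2 + g^2/e. *)
Lemma Rintegral_mul_bound f g (e : R) : 0 < e ->
  square_integrable f -> square_integrable g ->
  `|\int[P]_x (f x * g x)| <=
  e * \int[P]_x (f x ^+ 2) + e^-1 * \int[P]_x (g x ^+ 2).
Proof.
move=> e0 fi gi; have fgi := square_integrableM fi gi.
move: fi gi => [mf fi] [mg gi].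
have ii := integrable_EFinD measurableT (integrable_EFinZl measurableT e fi)
  (integrable_EFinZl measurableT e^-1 gi).
rewrite -!RintegralZl // -RintegralD //; last 2 first.
- exact: integrable_EFinZl.
- exact: integrable_EFinZl.
apply: (le_trans (le_normr_Rintegral _ fgi)) => //; apply: le_Rintegral => //.
  exact: (integrable_norm fgi).
move=> x _; rewrite normrM.
have -> : f x ^+ 2 = `|f x| ^+ 2 by rewrite real_normK ?num_real.
have -> : g x ^+ 2 = `|g x| ^+ 2 by rewrite real_normK ?num_real.
have ie : 0 < e^-1 by rewrite invr_gt0.
have ee : e * e^-1 = 1 by rewrite divff ?gt_eqF.
have f0 := normr_ge0 (f x); have g0 := normr_ge0 (g x).
have h1 : 0 <= e * (`|f x| - e^-1 * `|g x|) ^+ 2.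
  by rewrite mulr_ge0 ?sqr_ge0 // ltW.
have h2 : e * (`|f x| - e^-1 * `|g x|) ^+ 2 =
    e * `|f x| ^+ 2 - 2 * (e * e^-1) * (`|f x| * `|g x|) +
    (e * e^-1) * e^-1 * `|g x| ^+ 2 by ring.
rewrite h2 ee in h1; have := mulr_ge0 f0 g0; nra.
Qed.

End square_integrable.

Section gaussian_moments.
Context {R : realType}.
Notation mu := (@lebesgue_measure R).
Local Open Scope ereal_scope.

(** The change of variables involves the Radon-Nikodym derivative. It agrees almost everywhere with
    the density, because both have the integral [normal_prob 0 s A] over every measurable set
    [A]. *)
Lemma ge0_integral_normal_prob (s : R) (f : R -> \bar R) :
  measurable_fun setT f -> (forall x, 0 <= f x) ->
  \int[normal_prob 0 s]_x f x = \int[mu]_x (f x * (normal_pdf 0 s x)%:E).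
Proof.
move=> mf f0; have dom := normal_prob_dominates 0%R s.
rewrite -(Radon_Nikodym_SigmaFinite.change_of_variables dom) //.
have mpdf : measurable_fun setT (fun x => (normal_pdf 0 s x)%:E).
  apply/measurable_EFinP. exact: measurable_normal_pdf.
have mRN := measurable_int mu (Radon_Nikodym_SigmaFinite.f_integrable dom).
apply: ae_eq_integral => //; [exact: emeasurable_funM..|].
apply: ae_eqe_mul2l; apply: integral_ae_eq => //.
  exact: Radon_Nikodym_SigmaFinite.f_integrable.
by move=> A _ mA; rewrite -Radon_Nikodym_SigmaFinite.f_integral.
Qed.

Lemma ge0_integral_oppr (g : R -> \bar R) : measurable_fun setT g ->
  (forall x, 0 <= g x) -> \int[mu]_x g (- x)%R = \int[mu]_x g x.
Proof.
move=> mg g0.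
have mN : measurable_fun setT (-%R : measurableTypeR R -> measurableTypeR R).
  exact: oppr_measurable.
transitivity (\int[pushforward mu (-%R : measurableTypeR R -> measurableTypeR R)]_x g x).
  by rewrite (ge0_integral_pushforward mN) //.
by apply: eq_measure_integral => A mA _; exact: lebesgue_measureN.
Qed.

(** The alternative sets aside the degenerate deviation, outside the range of [normal_pdfE]. *)
Lemma normal_pdfN (s x : R) : normal_pdf 0 s (- x) = normal_pdf 0 s x :> R \/ s = 0%R.
Proof.
have [->|s0] := eqVneq s 0%R; [by right|left].
by rewrite normal_pdfE // /normal_fun !subr0 sqrrN.
Qed.

Lemma is_derive_normal_pdf (s x : R) : s != 0%R ->
  is_derive x 1%R (normal_pdf 0 s) (- x / s ^+ 2 * normal_pdf 0 s x)%R.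
Proof.
move=> s0; rewrite normal_pdfE //.
have -> : normal_fun 0 s = (fun y : R => expR (- (s ^+ 2 *+ 2)^-1 * y ^+ 2))%R.
  by apply/funext => y; rewrite /normal_fun subr0 mulrC mulrN mulNr.
set c : R := (- (s ^+ 2 *+ 2)^-1)%R.
have d1 : is_derive x (1 : R)%R (fun y : R => c * y ^+ 2)%R (c * (2 * x))%R.
  have dX : is_derive x (1 : R)%R (fun y : R => y ^+ 2)%R (2 * x)%R.
    have idx : is_derive x (1 : R)%R (id : R -> R) (1 : R)%R by exact: is_derive_id.
    have := @is_deriveM _ _ id id x 1%R _ _ idx idx.
    by rewrite /GRing.scale /= mulr1 mulr_natl mulr2n.
  exact: (@is_deriveZ _ _ _ (fun y : R => y ^+ 2)%R c x 1%R).
have d2 := @is_derive1_comp R expR (fun y : R => c * y ^+ 2)%R x _ _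
  (is_derive_expR _) d1.
have := @is_deriveZ _ _ _ _ (normal_peak s) x 1%R _ d2.
rewrite /GRing.scale /= /c => d3.
set z := (X in is_derive _ _ _ X) in d3.
suff -> : (- x / s ^+ 2 * (normal_peak s *
  expR (- (s ^+ 2 *+ 2)^-1 * x ^+ 2)))%R = z by exact: d3.
by rewrite /z -mulr_natr; field.
Qed.

(** From [1 + r <= expR r] at [r = x^2 / (2 s^2)], the product is at most a constant divided by
    x. *)
Lemma cvg_mul_normal_pdf (s : R) : (0 < s)%R ->
  (x * normal_pdf 0 s x)%R @[x --> +oo%R] --> 0%R.
Proof.
move=> s0; pose K : R := (normal_peak s * (s ^+ 2 *+ 2))%R.
have s20 : (0 < s ^+ 2 *+ 2)%R by rewrite mulrn_wgt0 // exprn_gt0.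
have pk : (0 < normal_peak s)%R by rewrite normal_peak_gt0 // gt_eqF.
have c0 : (K * x^-1)%R @[x --> +oo%R] --> (K * 0)%R.
  apply: cvgM; first exact: cvg_cst.
  apply/gtr0_cvgV0; last exact: cvg_id.
  by near=> x; near: x; exact: nbhs_pinfty_gt.
rewrite mulr0 in c0; apply: (squeeze_cvgr _ (cvg_cst _) c0).
near=> x.
have x0 : (0 < x)%R by near: x; exact: nbhs_pinfty_gt.
rewrite mulr_ge0 ?(ltW x0) ?normal_pdf_ge0 //=.
rewrite normal_pdfE ?gt_eqF // /normal_fun subr0 mulNr expRN.
have := expR_ge1Dx (x ^+ 2 / (s ^+ 2 *+ 2)); set E := expR _ => hE.
have {hE} : (x ^+ 2 / (s ^+ 2 *+ 2) <= E)%R by rewrite (le_trans _ hE) // lerDr.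
rewrite ler_pdivrMr // => hE.
have {hE} : (x / E <= (s ^+ 2 *+ 2) / x)%R.
  by rewrite ler_pdivrMr ?expR_gt0 // mulrAC ler_pdivlMr // -expr2 mulrC.
by rewrite -(ler_pM2l pk) /K [(x * (_ / E))%R]mulrCA -[(_ * _ / x)%R]mulrA.
Unshelve. all: by end_near. Qed.

(* With p the density, (x^2 - s^2) p is the derivative of - s^2 x p, and it has a
   constant sign on [0, s] and on [s, +oo[. *)
Lemma normal_variance (s : R) : (0 < s)%R ->
  \int[normal_prob 0 s]_x (x ^+ 2)%:E = (s ^+ 2)%:E.
Proof.
move=> s0; have s1 : s != 0%R by rewrite gt_eqF.
pose p := normal_pdf 0 s; pose q x := (x ^+ 2 * p x)%R.
have p0 x : (0 <= p x)%R by exact: normal_pdf_ge0.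
have q0 x : (0 <= q x)%R by rewrite mulr_ge0 ?sqr_ge0.
have cp : continuous p by exact: continuous_normal_pdf.
have cX : continuous (fun x : R => x ^+ 2)%R by move=> x; exact: exprn_continuous.
have cq : continuous q by move=> x; apply: cvgM; [exact: cX|exact: cp].
have mc (f : R -> R) D : continuous f -> measurable_fun D (EFin \o f).
  move=> cf; apply/measurable_EFinP; apply: measurable_funTS.
  exact: continuous_measurable_fun.
have pN x : p (- x)%R = p x.
  by have [//|s00] := normal_pdfN s x; rewrite s00 eqxx in s1.
(* [K = - F s] is the boundary term at s, where [x^2 - s^2] changes sign. It cancels when the
   integrals over [0, s] and [s, +oo[ are added; [a2] and [b1] are arranged so that only nonnegative
   functions are integrated. *)
pose K : R := (s ^+ 3 * p s)%R.
pose F x := (- (s ^+ 2) * (x * p x))%R.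
have dF (x : R) : is_derive x (1 : R)%R F ((x ^+ 2 - s ^+ 2) * p x)%R.
  have idx : is_derive x (1 : R)%R (id : R -> R) (1 : R)%R by exact: is_derive_id.
  have d1 := @is_deriveM _ _ id p x 1%R _ _ idx (is_derive_normal_pdf x s1).
  have := @is_deriveZ _ _ _ _ (- (s ^+ 2))%R x 1%R _ d1.
  rewrite /GRing.scale /= => d2.
  set z := (X in is_derive _ _ _ X) in d2.
  suff -> : ((x ^+ 2 - s ^+ 2) * p x)%R = z by exact: d2.
  by rewrite /z /p; field.
have cD : continuous (fun x : R => (x ^+ 2 - s ^+ 2) * p x)%R.
  by move=> x; apply: cvgM; [apply: cvgB; [exact: cX|exact: cvg_cst]|exact: cp].
have a2 : \int[mu]_(x in `[s, +oo[) (q x)%:E =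
    K%:E + (s ^+ 2)%:E * \int[mu]_(x in `[s, +oo[) (p x)%:E.
  have <- : \int[mu]_(x in `[s, +oo[) ((x ^+ 2 - s ^+ 2) * p x)%:E = K%:E.
    rewrite (@ge0_continuous_FTC2y _ _ F s 0%R) //.
    - by rewrite -EFinB /F /K; congr (_%:E); ring.
    - by move=> x sx; rewrite mulr_ge0 // subr_ge0 lerXn2r ?nnegrE // ltW // (lt_le_trans s0).
    - exact: continuous_subspaceT.
    - rewrite -(mulr0 (- s ^+ 2)%R); apply: cvgM; first exact: cvg_cst.
      exact: cvg_mul_normal_pdf.
    - by apply: cvg_at_right_filter; exact: (is_derive_continuous dF).
    - by move=> x _; rewrite derive1E derive_val.
  rewrite -ge0_integralZl_EFin ?sqr_ge0 //; [|by move=> x _; rewrite lee_fin|exact: mc].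
  rewrite -ge0_integralD //.
  - by apply: eq_integral => x _; rewrite -EFinM -EFinD /q; congr (_%:E); ring.
  - move=> x; rewrite /= in_itv /= andbT => sx.
    by rewrite lee_fin mulr_ge0 // subr_ge0 lerXn2r ?nnegrE // ltW // (lt_le_trans s0).
  - exact: mc.
  - by move=> x _; rewrite -EFinM lee_fin mulr_ge0 ?sqr_ge0.
  - by apply: emeasurable_funM => //; exact: mc.
have b1 : (s ^+ 2)%:E * \int[mu]_(x in `[0%R, s[) (p x)%:E =
    \int[mu]_(x in `[0%R, s[) (q x)%:E + K%:E.
  rewrite !integral_itv_bndo_bndc; [|exact: mc..].
  have <- : \int[mu]_(x in `[0%R, s]) (- ((x ^+ 2 - s ^+ 2) * p x))%:E = K%:E.
    have cDN : continuous (fun x : R => - ((x ^+ 2 - s ^+ 2) * p x))%R.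
      by move=> x; apply: cvgN; exact: cD.
    have dFN (x : R) : is_derive x (1 : R)%R (fun y => - F y)%R
      (- ((x ^+ 2 - s ^+ 2) * p x))%R by exact: is_deriveN.
    rewrite -EFin_Rintegral //; last exact: continuous_integrable_itv.
    by rewrite (Rintegral_is_derive cDN dFN (ltW s0)) /F /K; congr (_%:E); ring.
  rewrite -ge0_integralZl_EFin ?sqr_ge0 //; [|by move=> x _; rewrite lee_fin|exact: mc].
  rewrite -ge0_integralD //.
  - by apply: eq_integral => x _; rewrite -EFinM -EFinD /q; congr (_%:E); ring.
  - by move=> x _; rewrite lee_fin.
  - exact: mc.
  - move=> x; rewrite /= in_itv /= => /andP[x0 xs].
    by rewrite lee_fin -mulNr opprB mulr_ge0 // subr_ge0 lerXn2r ?nnegrE // (le_trans x0).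
  - by apply: mc => x; apply: cvgN; exact: cD.
have split (f : R -> R) : continuous f -> (forall x, 0 <= f x)%R ->
    \int[mu]_(x in `[0%R, +oo[) (f x)%:E =
    \int[mu]_(x in `[0%R, s[) (f x)%:E + \int[mu]_(x in `[s, +oo[) (f x)%:E.
  move=> cf f0; rewrite -ge0_integral_setU //.
  - by rewrite -itv_bndbnd_setU // bnd_simp ltW.
  - exact: mc.
  - by move=> x _; rewrite lee_fin.
  - apply/disj_setPS => x [/=]; rewrite !in_itv /= => /andP[_ xs] /andP[].
    by rewrite leNgt xs.
rewrite ge0_integral_normal_prob; last 2 first.
- by apply: mc.
- by move=> x; rewrite lee_fin sqr_ge0.
under eq_integral do rewrite -EFinM.
have set0y : [set x : R | (0 <= x)%R] = `[0%R, +oo[%classic.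
  by apply/seteqP; split=> x /=; rewrite in_itv /= andbT.
rewrite (@ge0_symfun_integralT _ q) //; last first.
  by move=> x; rewrite /q /= pN sqrrN.
rewrite set0y split // a2 addeA -b1 -ge0_muleDr ?integral_ge0 //; last 2 first.
- by move=> x _; rewrite lee_fin.
- by move=> x _; rewrite lee_fin.
rewrite -split // muleCA -set0y -(@ge0_symfun_integralT _ p) //; last first.
  by move=> x /=; rewrite pN.
by rewrite integral_normal_pdf mule1.
Qed.

Lemma normal_square_integrable (s : R) : (0 < s)%R ->
  square_integrable (normal_prob 0 s) id.
Proof.
move=> s0; split; first exact: measurable_id.
apply/integrableP; split.
  apply/measurable_EFinP; apply: continuous_measurable_fun => x.
  exact: exprn_continuous.
under eq_integral do rewrite gee0_abs ?lee_fin ?sqr_ge0 //.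
by rewrite normal_variance // ltry.
Qed.

(** The reflection [x |-> - x] preserves the density and exchanges the positive and negative parts
    of the identity, whose integrals therefore coincide. *)
Lemma normal_mean (s : R) : (0 < s)%R -> (\int[normal_prob 0 s]_x x = 0)%R.
Proof.
move=> s0; have s1 : s != 0%R by rewrite gt_eqF.
have pN x : normal_pdf 0 s (- x)%R = normal_pdf 0 s x.
  by have [//|s00] := normal_pdfN s x; rewrite s00 eqxx in s1.
have mpdf : measurable_fun setT (fun x : R => (normal_pdf 0 s x)%:E).
  by apply/measurable_EFinP; exact: measurable_normal_pdf.
rewrite /Rintegral integralE.
suff -> : \int[normal_prob 0 s]_x (fun x : R => x%:E)^\+ x =
          \int[normal_prob 0 s]_x (fun x : R => x%:E)^\- x.
  rewrite subee //; apply: integral_fune_fin_num => //.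
  by apply: integrable_funeneg => //; exact: (square_integrable1 (normal_square_integrable s0)).
have mid : measurable_fun setT (fun x : R => x%:E) by exact/measurable_EFinP.
rewrite !ge0_integral_normal_prob //; last 2 first.
- exact: measurable_funeneg.
- exact: measurable_funepos.
rewrite -ge0_integral_oppr; last 2 first.
- by apply: emeasurable_funM => //; exact: measurable_funepos.
- by move=> x; rewrite mule_ge0 // lee_fin normal_pdf_ge0.
by apply: eq_integral => x _; rewrite pN funeposE funenegE.
Qed.

End gaussian_moments.

(** * Increments of the Wiener process *)

Section independence.
Context d (T : measurableType d) (R : realType) (P : probability T R).

Lemma probability_ae_eq (A B : set T) : measurable A -> measurable B ->
  {ae P, forall w, A w <-> B w} -> P A = P B.
Proof.
move=> mA mB AB.
rewrite -[A]setIT -[B]setIT -!integral_indic //.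
apply: ae_eq_integral => //.
- by apply/measurable_EFinP; exact: measurable_indic.
- by apply/measurable_EFinP; exact: measurable_indic.
apply: filterS AB => w AB _; rewrite !indicE; congr (_%:R%:E).
by congr nat_of_bool; apply/idP/idP; rewrite !inE => /AB.
Qed.

Definition independent (X Y : T -> R) := forall A B : set R,
  measurable A -> measurable B ->
  P (X @^-1` A `&` Y @^-1` B) = (P (X @^-1` A) * P (Y @^-1` B))%E.

(** Independence on rectangles identifies the law [J] of the pair with the product of the two laws,
    by uniqueness of the product measure; what remains is Fubini's theorem for [(x, y) |-> x y]. *)
Lemma independent_mean (X Y : T -> R) :
  P.-integrable setT (EFin \o X) -> P.-integrable setT (EFin \o Y) ->
  independent X Y ->
  P.-integrable setT (EFin \o (fun w => X w * Y w)) /\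
  \int[P]_w (X w * Y w) = \int[P]_w X w * \int[P]_w Y w.
Proof.
move=> iX iY XY.
have mX : measurable_fun setT X by apply/measurable_EFinP/(measurable_int P).
have mY : measurable_fun setT Y by apply/measurable_EFinP/(measurable_int P).
pose X' : {mfun T >-> R} := mfun_Sub (mem_set mX).
pose Y' : {mfun T >-> R} := mfun_Sub (mem_set mY).
pose PX : probability _ R := distribution P X'.
pose PY : probability _ R := distribution P Y'.
have mXY : measurable_fun setT (fun w => (X w, Y w)).
  exact: measurable_fun_pair.
pose XY' : {mfun T >-> (R * R)%type} := mfun_Sub (mem_set mXY).
pose J : probability _ R := distribution P XY'.
have JE (h : R * R -> \bar R) :
    (\int[J]_z h z = \int[PX \x PY]_z h z)%E.
  apply: eq_measure_integral => A mA _; apply/esym/product_measure_unique => //.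
have mM : measurable_fun setT (fun z : R * R => (z.1 * z.2)%:E).
  by apply/measurable_EFinP; apply: measurable_funM.
have mMa : measurable_fun setT (fun z : R * R => `|(z.1 * z.2)%:E|%E).
  exact: measurableT_comp mM.
have iX' : PX.-integrable setT (fun x : R => x%:E).
  apply/integrableP; split; first exact/measurable_EFinP.
  rewrite (@ge0_integral_distribution _ _ _ _ _ P X') //; last first.
    by apply: measurableT_comp => //; exact/measurable_EFinP.
  by have /integrableP[] := iX.
have iY' : PY.-integrable setT (fun x : R => x%:E).
  apply/integrableP; split; first exact/measurable_EFinP.
  rewrite (@ge0_integral_distribution _ _ _ _ _ P Y') //; last first.
    by apply: measurableT_comp => //; exact/measurable_EFinP.
  by have /integrableP[] := iY.
have iD : (PX \x PY)%E.-integrable setT (fun z : R * R => (z.1 * z.2)%:E).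
  apply/(@integrable12ltyP _ _ _ _ _ PX PY _ mM) => /=.
  under eq_integral => x _.
    under eq_integral => y _ do rewrite normrM EFinM.
    rewrite ge0_integralZl //; last first.
      by apply: measurableT_comp => //; exact/measurable_EFinP.
    over.
  rewrite ge0_integralZr //; [|by apply: measurableT_comp => //; exact/measurable_EFinP
    |exact: integral_ge0].
  have /integrableP[_ hX] := iX'; have /integrableP[_ hY] := iY'.
  by rewrite lte_mul_pinfty // ?integral_ge0 // ge0_fin_numE // integral_ge0.
have iXY : P.-integrable setT (EFin \o (fun w => X w * Y w)).
  apply/integrableP; split; first by apply/measurable_EFinP/measurable_funM.
  have := @ge0_integral_distribution _ _ _ _ _ P XY' _ mMa (fun z => abse_ge0 _).
  rewrite /= => <-; rewrite JE.
  by have /integrableP[] := iD.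
split => //.
apply: EFin_inj; rewrite EFinM !EFin_Rintegral //.
have := @integral_distribution _ _ _ _ _ P XY' _ mM iXY.
rewrite /= => <-; rewrite JE -(integral12_prod_meas1 iD) /fubini_F /=.
have <- := @integral_distribution _ _ _ _ _ P X' (fun x => x%:E) _ iX; last first.
  exact/measurable_EFinP.
have <- := @integral_distribution _ _ _ _ _ P Y' (fun x => x%:E) _ iY; last first.
  exact/measurable_EFinP.
have finY := integrable_fin_num measurableT iY'.
rewrite -(fineK finY) -integralZr //.
by apply: eq_integral => x _; rewrite (fineK finY) -integralZl.
Qed.

End independence.
Section filtration.
Context d (Omega : measurableType d) (R : realType).
Context (P : probability Omega R) (T : R) (W : R -> Omega -> R).
Hypothesis hW : wiener_process P T W.
Implicit Types (s t : R) (f g zeta : Omega -> R).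

Let F t : set (set Omega) := <<s completed_events P W t >>.

Lemma completed_events_measurable t : t <= T -> F t `<=` measurable.
Proof.
move=> tT; apply: smallest_sub; first exact: sigma_algebra_measurable.
move=> A [[s [B [st mB ->]]]|[]//].
have mW : measurable_fun setT (W s).
  apply: (wiener_measurable hW); move: st; rewrite !in_itv /= => /andP[-> st].
  exact: le_trans st tT.
by rewrite -[X in measurable X]setTI; exact: mW.
Qed.

Lemma completed_events_le s t : s <= t -> F s `<=` F t.
Proof.
move=> st; apply: sub_sigma_algebra2 => A [[r [B [rs mB ->]]]|hN]; last by right.
left; exists r, B; split=> //; move: rs; rewrite !in_itv /= => /andP[-> rs].
exact: le_trans rs st.
Qed.

Lemma measurable_atP t f : measurable_at P W t f <->
  forall B : set R, measurable B -> F t (f @^-1` B).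
Proof.
split=> [mf B mB|mf _ B mB].
  by have := mf measurableT B mB; rewrite setTI.
by rewrite setTI; exact: mf.
Qed.

Lemma measurable_at_measurable t f : t <= T -> measurable_at P W t f ->
  measurable_fun setT f.
Proof.
move=> tT /measurable_atP mf _ B mB; rewrite setTI.
by apply: (completed_events_measurable tT); exact: mf.
Qed.

Lemma measurable_at_le s t f : s <= t -> measurable_at P W s f ->
  measurable_at P W t f.
Proof.
move=> st /measurable_atP mf; apply/measurable_atP => B mB.
by apply: (completed_events_le st); exact: mf.
Qed.

Lemma measurable_at_wiener s t : s \in `[0, t] -> measurable_at P W t (W s).
Proof.
move=> st; apply/measurable_atP => B mB; apply: sub_sigma_algebra; left.
by exists s, B.
Qed.

(** The exceptional set [N] and all its measurable subsets are generators of [F t]. The preimage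
    under [g] agrees with that under [f] off [N], and inside [N] it is such a subset. *)
Lemma measurable_at_ae_eq t f g : t <= T -> measurable_fun setT g ->
  measurable_at P W t f -> {ae P, forall w, f w = g w} -> measurable_at P W t g.
Proof.
move=> tT mg /measurable_atP mf [N [mN N0 fgN]]; apply/measurable_atP => B mB.
have FN A : measurable A -> A `<=` N -> F t A.
  move=> mA AN; apply: sub_sigma_algebra; right; split=> //.
  by apply/eqP; rewrite eq_le measure_ge0 andbT -N0 le_measure ?inE.
have fgE w : ~ N w -> f w = g w.
  by move=> Nw; apply: contrapT => h; apply: Nw; exact: fgN.
have mgB : measurable (g @^-1` B) by rewrite -[X in measurable X]setTI; exact: mg.
have -> : g @^-1` B = (f @^-1` B `&` ~` N) `|` (g @^-1` B `&` N).
  apply/seteqP; split=> w /=.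
    move=> gB; have [Nw|Nw] := pselect (N w); [by right|left; split=> //].
    by rewrite fgE.
  move=> [[fB Nw]|[]//].
  by rewrite -fgE.
pose G := g_sigma_algebraType (completed_events P W t).
have mF (A : set Omega) : F t A <-> measurable (A : set G) by [].
apply/mF; apply: measurableU; first apply: measurableI.
- by apply/mF; exact: mf.
- by apply: measurableC; apply/mF; exact: FN.
- by apply/mF; apply: FN; [exact: measurableI|move=> w []].
Qed.

(* Every event of the completed filtration agrees almost everywhere with an
   event of the natural one. *)
Lemma completed_events_natural s A : F s A ->
  exists2 B, <<s natural_events W s >> B & {ae P, forall w, A w <-> B w}.
Proof.
pose C := [set A | exists2 B, <<s natural_events W s >> B &
  {ae P, forall w, A w <-> B w}].
suff : F s `<=` C by apply.
apply: smallest_sub.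
  split.
  - by exists set0; [exact: sigma_algebra0|exact: aeW].
  - move=> X [B sB XB]; exists (~` B); first exact: sigma_algebraC.
    by apply: filterS XB => w h; rewrite setTD /setC /= h.
  - move=> X hX; pose B i := projT1 (cid2 (hX i)).
    have sB i : <<s natural_events W s >> (B i) by rewrite /B; case: cid2.
    have XB i : {ae P, forall w, X i w <-> B i w} by rewrite /B; case: cid2.
    exists (\bigcup_i B i); first exact: sigma_algebra_bigcup.
    have := ae_foralln XB; apply: filterS => w h.
    by split=> -[i _] Aw; exists i => //; apply/h.
move=> X [hX|[mX X0]].
  by exists X; [exact: sub_sigma_algebra|exact: aeW].
exists set0; first exact: sigma_algebra0.
exists X; split=> // w /= h; apply: contrapT => Xw.
by apply: h; split.
Qed.

Lemma measurable_increment s t : 0 <= s -> s <= t -> t <= T ->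
  measurable_fun setT (fun w => W t w - W s w).
Proof.
move=> s0 st tT; apply: measurable_funB.
  by apply: (wiener_measurable hW); rewrite in_itv /= tT andbT (le_trans s0).
by apply: (wiener_measurable hW); rewrite in_itv /= s0 (le_trans st).
Qed.

(** [wiener_independent] concerns the natural filtration. Replacing the event [zeta @^-1] A by an
    almost equal event of that filtration carries independence over to the completed one. *)
Lemma independent_increment s t zeta : 0 <= s -> s < t -> t <= T ->
  measurable_at P W s zeta -> independent P zeta (fun w => W t w - W s w).
Proof.
move=> s0 st tT /measurable_atP mz A B mA mB.
have sT : s <= T by rewrite (le_trans (ltW st)).
have [C sC AC] := completed_events_natural (mz A mA).
have mzA := completed_events_measurable sT (mz A mA).
have mC : measurable C.
  apply: (completed_events_measurable sT).
  by apply: sub_sigma_algebra2 sC => D; left.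
have mD : measurable ((fun w => W t w - W s w) @^-1` B).
  rewrite -[X in measurable X]setTI.
  exact: (measurable_increment s0 (ltW st) tT).
rewrite (probability_ae_eq mzA mC AC).
rewrite -(wiener_independent hW s0 st tT sC mB).
apply: probability_ae_eq; [exact: measurableI|exact: measurableI|].
by apply: filterS AC => w h; split=> -[? ?]; split=> //; exact/h.
Qed.

Lemma integral_increment s t (f : R -> \bar R) : 0 <= s -> s < t -> t <= T ->
  measurable_fun setT f -> (forall x, (0 <= f x)%E) ->
  (\int[P]_w f (W t w - W s w)%R =
   \int[normal_prob 0 (Num.sqrt (t - s))]_x f x)%E.
Proof.
move=> s0 st tT mf f0.
have mD := measurable_increment s0 (ltW st) tT.
have := @ge0_integral_pushforward _ _ Omega (measurableTypeR R) R _ mD P setT f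
  measurableT mf.
rewrite preimage_setT => <- //.
by apply: eq_measure_integral => A mA _; exact: (wiener_gaussian hW).
Qed.

(** The case [s = t] is split off here and below, the law of an increment being prescribed for
    [s < t]. *)
Lemma increment_square_integrable s t : 0 <= s -> s <= t -> t <= T ->
  square_integrable P (fun w => W t w - W s w).
Proof.
move=> s0; rewrite le_eqVlt => /predU1P[->|st] tT.
  under eq_fun do rewrite subrr; exact: square_integrable_cst.
split; first exact: (measurable_increment s0 (ltW st) tT).
apply/integrableP; split.
  apply/measurable_EFinP/measurable_funX.
  exact: (measurable_increment s0 (ltW st) tT).
under eq_integral do rewrite gee0_abs ?lee_fin ?sqr_ge0 //.
rewrite (integral_increment (f := fun x => (x ^+ 2)%:E)) //; last 2 first.
- by apply/measurable_EFinP/measurable_funX.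
- by move=> x; rewrite lee_fin sqr_ge0.
by rewrite normal_variance ?sqrtr_gt0 ?subr_gt0 // ltry.
Qed.

Lemma increment_variance s t : 0 <= s -> s <= t -> t <= T ->
  \int[P]_w ((W t w - W s w) ^+ 2) = t - s.
Proof.
move=> s0; rewrite le_eqVlt => /predU1P[->|st] tT.
  rewrite subrr; under eq_Rintegral do rewrite subrr expr0n /=.
  by rewrite Rintegral_cst // mul0r.
rewrite /Rintegral (integral_increment (f := fun x => (x ^+ 2)%:E)) //; last 2 first.
- by apply/measurable_EFinP/measurable_funX.
- by move=> x; rewrite lee_fin sqr_ge0.
rewrite normal_variance ?sqrtr_gt0 ?subr_gt0 //= sqr_sqrtr // subr_ge0.
exact: ltW.
Qed.

Lemma increment_mean s t : 0 <= s -> s <= t -> t <= T ->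
  \int[P]_w (W t w - W s w) = 0.
Proof.
move=> s0; rewrite le_eqVlt => /predU1P[->|st] tT.
  under eq_Rintegral do rewrite subrr.
  by rewrite Rintegral_cst // mul0r.
have sd : 0 < Num.sqrt (t - s) by rewrite sqrtr_gt0 subr_gt0.
rewrite -(normal_mean sd) /Rintegral; congr fine.
have mD := measurable_increment s0 (ltW st) tT.
have mid : measurable_fun setT (fun x : R => x%:E) by exact/measurable_EFinP.
have iD := square_integrable1 (increment_square_integrable s0 (ltW st) tT).
have := @integral_pushforward _ _ Omega (measurableTypeR R) R _ mD P setT _ mid iD
  measurableT.
rewrite preimage_setT => <-.
by apply: eq_measure_integral => A mA _; exact: (wiener_gaussian hW).
Qed.

Lemma integral_mul_increment s t zeta : 0 <= s -> s <= t -> t <= T ->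
  measurable_at P W s zeta -> P.-integrable setT (EFin \o zeta) ->
  P.-integrable setT (EFin \o (fun w => zeta w * (W t w - W s w))) /\
  \int[P]_w (zeta w * (W t w - W s w)) = 0.
Proof.
move=> s0; rewrite le_eqVlt => /predU1P[->|st] tT mz iz.
  split.
    apply: eq_integrable (integrable0 P setT) => // w _ /=.
    by rewrite subrr mulr0.
  under eq_Rintegral do rewrite subrr mulr0.
  by rewrite Rintegral_cst // mul0r.
have iD := square_integrable1 (increment_square_integrable s0 (ltW st) tT).
have [? ->] := independent_mean iz iD (independent_increment s0 st tT mz).
by rewrite increment_mean ?mulr0 // ltW.
Qed.

Lemma integral_mul_increment_sqr s t zeta : 0 <= s -> s <= t -> t <= T ->
  measurable_at P W s zeta -> P.-integrable setT (EFin \o zeta) ->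
  P.-integrable setT (EFin \o (fun w => zeta w * (W t w - W s w) ^+ 2)) /\
  \int[P]_w (zeta w * (W t w - W s w) ^+ 2) = \int[P]_w zeta w * (t - s).
Proof.
move=> s0; rewrite le_eqVlt => /predU1P[->|st] tT mz iz.
  split.
    apply: eq_integrable (integrable0 P setT) => // w _ /=.
    by rewrite subrr expr0n mulr0.
  under eq_Rintegral do rewrite subrr expr0n mulr0.
  by rewrite Rintegral_cst // subrr mul0r mulr0.
have iD := (increment_square_integrable s0 (ltW st) tT).2.
have ind : independent P zeta (fun w => (W t w - W s w) ^+ 2).
  move=> A B mA mB.
  have msq : measurable ((fun x : R => x ^+ 2) @^-1` B).
    rewrite -[X in measurable X]setTI.
    by apply: (measurable_funX 2 (@measurable_id _ _ setT)).
  exact: (independent_increment s0 st tT mz mA msq).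
have [? ->] := independent_mean iz iD ind.
by rewrite increment_variance // ltW.
Qed.

End filtration.

(** * The isometry for simple processes *)

Section elementary_isometry.
Context d (Omega : measurableType d) (R : realType).
Context (P : probability Omega R) (T : R) (W : R -> Omega -> R).
Hypothesis hW : wiener_process P T W.
Implicit Types (s t : R).

(** For nonempty intervals, the length of the intersection of ]a, b] and ]c, e]. *)
Definition overlap (a b c e : R) : R :=
  Num.max 0 (Num.min b e - Num.max a c).

Let bounded_sqint (xi : Omega -> R) t : t <= T -> measurable_at P W t xi ->
  (exists C : R, forall w, `|xi w| <= C) -> square_integrable P xi.
Proof.
move=> tT mxi [C hC].
have := square_integrable_bounded (measurable_at_measurable hW tT mxi) hC
  (square_integrable_cst P 1).
by under eq_fun do rewrite /= mulr1.
Qed.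

Let inc_sqint (xi : Omega -> R) (r a b : R) : r <= T -> 0 <= a -> a <= b -> b <= T ->
  measurable_at P W r xi -> (exists C : R, forall w, `|xi w| <= C) ->
  square_integrable P (fun w => xi w * (W b w - W a w)).
Proof.
move=> rT a0 ab bT mxi [C hC].
apply: (square_integrable_bounded (C := C)) => //.
  exact: (measurable_at_measurable hW rT mxi).
exact: (increment_square_integrable hW).
Qed.

Let measurable_at_inc (r a b : R) : 0 <= a -> a <= b -> b <= r ->
  measurable_at P W r (fun w => W b w - W a w).
Proof.
move=> a0 ab br; apply: measurable_funB.
  by apply: measurable_at_wiener; rewrite in_itv /= (le_trans a0).
by apply: measurable_at_wiener; rewrite in_itv /= a0 (le_trans ab).
Qed.

(** If [b <= c], everything but the increment over ]c, e] is known at time c, and that increment has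
    mean 0. Otherwise let p and q be the minimum and the maximum of b and e: whichever is larger,
    [(W b - W c) (W e - W c) = (W p - W c) (W q - W c)]. Cutting at c and p, the only term with a
    nonzero mean is the one in [(W p - W c)^2]. *)
Let isometry_pair_le (xi eta : Omega -> R) (a b c e : R) :
  0 <= a -> a <= b -> b <= T -> 0 <= c -> c <= e -> e <= T -> a <= c ->
  measurable_at P W a xi -> (exists C : R, forall w, `|xi w| <= C) ->
  measurable_at P W c eta -> (exists C : R, forall w, `|eta w| <= C) ->
  \int[P]_w (xi w * (W b w - W a w) * (eta w * (W e w - W c w))) =
  overlap a b c e * \int[P]_w (xi w * eta w).
Proof.
move=> a0 ab bT c0 ce eT ac mxi bxi meta beta.
have aT := le_trans ab bT; have cT := le_trans ce eT.
have mxi_c := measurable_at_le ac mxi.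
have [C hC] := bxi; have [C' hC'] := beta.
have mxe : measurable_at P W c (fun w => xi w * eta w) by exact: measurable_funM.
have bxe : exists C : R, forall w, `|xi w * eta w| <= C.
  by exists (C * C') => w; rewrite normrM ler_pM.
have ixe := square_integrable1 (bounded_sqint cT mxe bxe).
have [bc|cb] := leP b c.
  have -> : overlap a b c e = 0.
    rewrite /overlap (max_idPr ac) (max_idPl _) // subr_le0 ge_min bc //.
  rewrite mul0r.
  have mz : measurable_at P W c (fun w => xi w * eta w * (W b w - W a w)).
    by apply: measurable_funM => //; exact: measurable_at_inc.
  have iz := square_integrable1 (inc_sqint cT a0 ab bT mxe bxe).
  have [_ <-] := integral_mul_increment hW c0 ce eT mz iz.
  by apply: eq_Rintegral => w _; ring.
pose p := Num.min b e; pose q := Num.max b e.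
have cp : c <= p by rewrite le_min (ltW cb).
have pq : p <= q by rewrite le_max ge_min lexx.
have qT : q <= T by rewrite ge_max bT.
have pT := le_trans pq qT; have p0 := le_trans c0 cp.
have -> : overlap a b c e = p - c.
  by rewrite /overlap (max_idPr ac) (max_idPr _) // subr_ge0.
pose z1 w := xi w * eta w * (W c w - W a w).
have mz1 : measurable_at P W c z1.
  by apply: measurable_funM => //; exact: measurable_at_inc.
have iz1 := square_integrable1 (inc_sqint cT a0 ac cT mxe bxe).
have [i1 e1] := integral_mul_increment hW c0 ce eT mz1 iz1.
have [i2 e2] := integral_mul_increment_sqr hW c0 cp pT mxe ixe.
pose z3 w := xi w * eta w * (W p w - W c w).
have mz3 : measurable_at P W p z3.
  apply: measurable_funM; last exact: measurable_at_inc.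
  exact: measurable_at_le mxe.
have iz3 := square_integrable1 (inc_sqint cT c0 cp pT mxe bxe).
have [i3 e3] := integral_mul_increment hW p0 pq qT mz3 iz3.
transitivity (\int[P]_w (z1 w * (W e w - W c w) +
    (xi w * eta w * (W p w - W c w) ^+ 2 + z3 w * (W q w - W p w)))).
  apply: eq_Rintegral => w _; rewrite /z1 /z3.
  have : (W b w - W c w) * (W e w - W c w) =
      (W p w - W c w) * (W q w - W c w).
    by rewrite /p /q; case: (leP b e) => _ //; rewrite mulrC.
  move=> h.
  transitivity (xi w * eta w * (W c w - W a w) * (W e w - W c w) +
    xi w * eta w * ((W b w - W c w) * (W e w - W c w))); first by ring.
  by rewrite h; ring.
rewrite RintegralD //; last exact: integrable_EFinD.
by rewrite RintegralD // e1 e2 e3 add0r addr0 mulrC.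
Qed.

Lemma isometry_pair (xi eta : Omega -> R) (a b c e : R) :
  0 <= a -> a <= b -> b <= T -> 0 <= c -> c <= e -> e <= T ->
  measurable_at P W a xi -> (exists C : R, forall w, `|xi w| <= C) ->
  measurable_at P W c eta -> (exists C : R, forall w, `|eta w| <= C) ->
  \int[P]_w (xi w * (W b w - W a w) * (eta w * (W e w - W c w))) =
  overlap a b c e * \int[P]_w (xi w * eta w).
Proof.
move=> a0 ab bT c0 ce eT mxi bxi meta beta.
have [ac|/ltW ca] := leP a c; first exact: isometry_pair_le.
have -> : overlap a b c e = overlap c e a b.
  by rewrite /overlap [Num.min b e]minC [Num.max a c]maxC.
under eq_Rintegral do rewrite mulrC.
by rewrite isometry_pair_le //; congr (_ * _); apply: eq_Rintegral => w _; rewrite mulrC.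
Qed.

Variables (I : finType) (xi : I -> Omega -> R) (a b : I -> R).
Hypothesis a0 : forall i, 0 <= a i.
Hypothesis ab : forall i, a i <= b i.
Hypothesis bT : forall i, b i <= T.
Hypothesis mxi : forall i, measurable_at P W (a i) (xi i).
Hypothesis bxi : forall i, exists C : R, forall w, `|xi i w| <= C.

Let aT i : a i <= T. Proof. exact: le_trans (ab i) (bT i). Qed.

Lemma elementary_square_integrable :
  square_integrable P (fun w => \sum_i xi i w * (W (b i) w - W (a i) w)).
Proof.
by apply: square_integrable_sum => i; exact: (inc_sqint (aT i)).
Qed.

Let indic_overlap i j : \int[lebesgue_measure]_(t in `[0, T])
    (\1_(`]a i, b i]%classic) t * \1_(`]a j, b j]%classic) t) =
  overlap (a i) (b i) (a j) (b j).
Proof.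
under eq_Rintegral => t _ do rewrite -[_ * _]/((\1_ _ \* \1_ _) t) -indicI.
rewrite /Rintegral integral_indic //; last exact: measurableI.
have -> : `]a i, b i]%classic `&` `]a j, b j]%classic `&` `[0, T]%classic =
    `]Num.max (a i) (a j), Num.min (b i) (b j)]%classic.
  apply/seteqP; split=> t /=; rewrite !in_itv /= gt_max le_min.
    by move=> [[/andP[-> ->] /andP[-> ->]] _].
  move=> /andP[/andP[h1 h2] /andP[h3 h4]]; rewrite h1 h2 h3 h4; split=> //.
  by rewrite (ltW (le_lt_trans (a0 i) h1)) (le_trans h3 (bT i)).
rewrite [X in fine X](lebesgue_measure_itv
  (`]Num.max (a i) (a j), Num.min (b i) (b j)] : interval R)).
rewrite /= lte_fin /overlap.
case: (ltP (Num.max (a i) (a j)) (Num.min (b i) (b j))) => h /=.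
  by apply/esym/max_idPr; rewrite subr_ge0 ltW.
by apply/esym/max_idPl; rewrite subr_le0.
Qed.

Let indic_integrable i j : lebesgue_measure.-integrable `[0, T]
  (EFin \o (fun t => \1_(`]a i, b i]%classic) t * \1_(`]a j, b j]%classic) t : R)).
Proof.
apply: measurable_bounded_integrable => //.
- by rewrite /= lebesgue_measure_itv; case: ifP => _; rewrite ltry.
- by apply: measurable_funM; exact: measurable_indic.
exists 1; split; first exact: num_real.
move=> x x1 t _ /=; apply: le_trans (ltW x1).
by rewrite !indicE; case: (_ \in _); case: (_ \in _); rewrite /= ?mulr0 ?mul0r ?mulr1 ?normr0 ?normr1.
Qed.

Let quad (w : Omega) : R :=
  \sum_i \sum_j overlap (a i) (b i) (a j) (b j) * (xi i w * xi j w).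

Let inner_integral w :
  (\int[lebesgue_measure]_(t in `[0%R, T])
    ((\sum_i xi i w * \1_(`]a i, b i]%classic) t) ^+ 2)%:E)%E = (quad w)%:E.
Proof.
have ii i j : lebesgue_measure.-integrable `[0, T] (EFin \o (fun t => xi i w * xi j w *
    (\1_(`]a i, b i]%classic) t * \1_(`]a j, b j]%classic) t))).
  exact: integrable_EFinZl.
transitivity (\int[lebesgue_measure]_(t in `[0%R, T])
    (\sum_i \sum_j xi i w * xi j w *
    (\1_(`]a i, b i]%classic) t * \1_(`]a j, b j]%classic) t))%:E)%E.
  apply: eq_integral => t _; congr (_%:E); rewrite expr2 mulr_suml.
  by apply: eq_bigr => i _; rewrite mulr_sumr; apply: eq_bigr => j _; ring.
rewrite -EFin_Rintegral //; last first.
  by apply: integrable_EFin_sum => // i; exact: integrable_EFin_sum.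
rewrite Rintegral_sum //; last by move=> i; exact: integrable_EFin_sum.
congr (_%:E); apply: eq_bigr => i _; rewrite Rintegral_sum //.
by apply: eq_bigr => j _; rewrite RintegralZl // indic_overlap mulrC.
Qed.

Let xi_sqint i : square_integrable P (xi i).
Proof. exact: (bounded_sqint (aT i)). Qed.

(** The intervals of the family may overlap, which [overlap] takes into account. Two simple
    processes over different partitions can thus be handled as one family, in place of a common
    refinement. *)
Lemma elementary_isometry :
  (\int[P]_w \int[lebesgue_measure]_(t in `[0%R, T])
    ((\sum_i xi i w * \1_(`]a i, b i]%classic) t) ^+ 2)%:E =
  \int[P]_w ((\sum_i xi i w * (W (b i) w - W (a i) w)) ^+ 2)%:E)%E.
Proof.
under eq_integral do rewrite inner_integral.
have iq i j : P.-integrable setT (EFin \o (fun w =>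
    overlap (a i) (b i) (a j) (b j) * (xi i w * xi j w))).
  by apply: integrable_EFinZl => //; exact: square_integrableM.
have ip i j : P.-integrable setT (EFin \o (fun w => xi i w * (W (b i) w - W (a i) w) *
    (xi j w * (W (b j) w - W (a j) w)))).
  apply: square_integrableM; first exact: (inc_sqint (aT i)).
  exact: (inc_sqint (aT j)).
rewrite -EFin_Rintegral //; last first.
  by apply: integrable_EFin_sum => // i; exact: integrable_EFin_sum.
rewrite -EFin_Rintegral //; last exact: elementary_square_integrable.2.
congr (_%:E); rewrite Rintegral_sum //; last first.
  by move=> i; exact: integrable_EFin_sum.
transitivity (\int[P]_w \sum_i \sum_j (xi i w * (W (b i) w - W (a i) w) *
    (xi j w * (W (b j) w - W (a j) w)))); last first.
  apply: eq_Rintegral => w _; rewrite expr2 mulr_suml.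
  by apply: eq_bigr => i _; rewrite mulr_sumr.
rewrite Rintegral_sum //; last by move=> i; exact: integrable_EFin_sum.
apply: eq_bigr => i _; rewrite !Rintegral_sum //; apply: eq_bigr => j _.
by rewrite isometry_pair // RintegralZl //; exact: square_integrableM.
Qed.

End elementary_isometry.

Section simple_process.
Context d (Omega : measurableType d) (R : realType).
Context (P : probability Omega R) (T : R) (W : R -> Omega -> R).
Hypothesis hW : wiener_process P T W.
Hypothesis T0 : 0 <= T.
Implicit Types (s t : R) (S : simple_process P T W).

Lemma sp_time_le S i j : (i <= j)%N -> (j <= sp_size S)%N ->
  sp_time S i <= sp_time S j.
Proof.
elim: j => [|j IHj]; first by rewrite leqn0 => /eqP ->.
rewrite leq_eqVlt => /predU1P[->//|]; rewrite ltnS => ij jS.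
apply: (le_trans (IHj ij (ltnW jS))); apply: ltW.
exact: sp_time_lt.
Qed.

Lemma sp_time_ge0 S i : (i <= sp_size S)%N -> 0 <= sp_time S i.
Proof. by move=> iS; rewrite -(sp_time0 S); exact: sp_time_le. Qed.

Lemma sp_time_leT S i : (i <= sp_size S)%N -> sp_time S i <= T.
Proof. by move=> iS; rewrite -[leRHS](sp_timeT S); exact: sp_time_le. Qed.

(* Up to time [t], the integral is that of the coefficients [xi] over the
   intervals ]lo, hi]. *)
Let xi S t (i : 'I_(sp_size S)) w :=
  if sp_time S i <= t then sp_coef S i w else 0.
Let lo S t (i : 'I_(sp_size S)) := Num.min (sp_time S i) t.
Let hi S t (i : 'I_(sp_size S)) := Num.min (sp_time S i.+1) t.

Let lo_ge0 S t i : 0 <= t -> 0 <= lo (S := S) t i.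
Proof. by move=> t0; rewrite le_min t0 andbT sp_time_ge0 // ltnW. Qed.

Let lo_hi S t i : lo (S := S) t i <= hi t i.
Proof.
by rewrite /lo /hi le_min !ge_min lexx !orbT andbT sp_time_le // ltnW.
Qed.

Let hi_leT S t i : hi (S := S) t i <= T.
Proof. by rewrite ge_min sp_time_leT. Qed.

Let mxi S t i : measurable_at P W (lo (S := S) t i) (xi t i).
Proof.
rewrite /xi /lo; case: leP => h; first exact: sp_coef_measurable.
exact: measurable_cst.
Qed.

Let bxi S t i : exists C : R, forall w, `|xi (S := S) t i w| <= C.
Proof.
rewrite /xi; case: leP => h; first exact: sp_coef_bounded.
by exists 0 => w; rewrite normr0.
Qed.

Lemma sp_integralE S t w : sp_integral S t w =
  \sum_i xi t i w * (W (hi (S := S) t i) w - W (lo t i) w).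
Proof.
apply: eq_bigr => i _; rewrite /xi /hi /lo.
case: leP => // /ltW h; rewrite mul0r min_r; last first.
  by rewrite (le_trans h) // sp_time_le // ltnW.
by rewrite subrr mulr0.
Qed.

Lemma sp_integral_square_integrable S t : t \in `[0, T] ->
  square_integrable P (sp_integral S t).
Proof.
rewrite in_itv /= => /andP[t0 tT].
have -> : sp_integral S t = fun w => \sum_i xi t i w *
  (W (hi (S := S) t i) w - W (lo t i) w) by apply/funext => w; exact: sp_integralE.
by apply: (elementary_square_integrable hW) => i; rewrite ?lo_ge0.
Qed.

Lemma sp_valueE S t r w : sp_value S r w * \1_(`[0, t]%classic) r =
  if 0 <= r then
    \sum_i xi t i w * \1_(`]lo (S := S) t i, hi (S := S) t i]%classic) r else 0.
Proof.
rewrite indicE mem_setE in_itv /=; case: leP => r0 /=; last by rewrite mulr0.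
rewrite /sp_value mulr_suml; apply: eq_bigr => i _.
rewrite /xi /lo /hi !indicE !mem_setE !in_itv /= le_min gt_min.
case: (leP (sp_time S i) t) => it; case: (leP r t) => rt /=;
  rewrite ?mulr1 ?mulr0 ?andbF ?mul0r ?orbF ?andbT //=.
- by rewrite mulr0.
- by rewrite (le_gtF (ltW (le_lt_trans rt it))) /= mulr0.
Qed.

(** Cut off at time t, the difference of the two processes is a single elementary family, indexed by
    the disjoint union of their indices, with opposite coefficients on the second half. *)
Lemma sp_isometry S S' t : t \in `[0, T] ->
  (\int[P]_w \int[lebesgue_measure]_(r in `[0%R, T])
     (((sp_value S r w - sp_value S' r w) * \1_(`[0%R, t]%classic) r) ^+ 2)%:E =
   \int[P]_w ((sp_integral S t w - sp_integral S' t w) ^+ 2)%:E)%E.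
Proof.
rewrite in_itv /= => /andP[t0 tT].
pose I : finType := ('I_(sp_size S) + 'I_(sp_size S'))%type.
pose X (i : I) w := match i with inl i => xi t i w | inr i => - xi t i w end.
pose A (i : I) := match i with inl i => lo t i | inr i => lo t i end.
pose B (i : I) := match i with inl i => hi t i | inr i => hi t i end.
have A0 i : 0 <= A i by case: i => i; exact: lo_ge0.
have AB i : A i <= B i by case: i => i; exact: lo_hi.
have BT i : B i <= T by case: i => i; exact: hi_leT.
have mX i : measurable_at P W (A i) (X i).
  by case: i => i; [exact: mxi|apply: measurableT_comp => //; exact: mxi].
have bX i : exists C : R, forall w, `|X i w| <= C.
  case: i => i; first exact: bxi.
  by have [C hC] := bxi t i; exists C => w; rewrite normrN.
have := elementary_isometry hW A0 AB BT mX bX.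
under eq_integral => w _.
  under eq_integral => r rT.
    have r0 : 0 <= r by move: rT; rewrite inE /= in_itv /= => /andP[].
    rewrite big_sumType /=; under [X in _ + X]eq_bigr do rewrite mulNr.
    rewrite sumrN.
    have := sp_valueE S t r w; rewrite r0 => <-.
    have := sp_valueE S' t r w; rewrite r0 => <-.
    rewrite -mulrBl; over.
  over.
move=> ->; apply: eq_integral => w _; rewrite !sp_integralE.
by rewrite big_sumType /=; under [X in _ + X]eq_bigr do rewrite mulNr; rewrite sumrN.
Qed.

(** Clipping the partition to [s, t] writes the increment as a sum over cells. In each term [zeta]
    and the coefficient are known at the left end of the clipped cell, so that the increment of [W]
    over the cell gives it mean 0. *)
Lemma sp_integral_orthogonal S s t zeta : 0 <= s -> s <= t -> t <= T ->
  measurable_at P W s zeta -> square_integrable P zeta ->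
  \int[P]_w (zeta w * (sp_integral S t w - sp_integral S s w)) = 0.
Proof.
move=> s0 st tT mz zi.
pose clip r := Num.max s (Num.min r t).
pose c (i : 'I_(sp_size S)) w := zeta w * xi t i w.
have clip_le r r' : r <= r' -> clip r <= clip r'.
  move=> rr'; rewrite /clip ge_max !le_max lexx /=.
  by apply/orP; right; rewrite le_min !ge_min rr' lexx orbT.
have clip_ge r : s <= clip r by rewrite le_max lexx.
have clip_leT r : clip r <= T by rewrite ge_max (le_trans st) // ge_min tT orbT.
have clipE (r : R) w : W (Num.min r t) w - W (Num.min r s) w = W (clip r) w - W s w.
  rewrite /clip; case: (leP r s) => rs.
    by rewrite (min_l (le_trans rs st)) (max_l rs) !subrr.
  by rewrite (max_r _) // le_min (ltW rs) st.
have zc i : P.-integrable setT (EFin \o (fun w => c i w * (W (clip (sp_time S i.+1)) w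
      - W (clip (sp_time S i)) w))) /\
    \int[P]_w (c i w * (W (clip (sp_time S i.+1)) w - W (clip (sp_time S i)) w)) = 0.
  apply: (integral_mul_increment hW) => //.
  - exact: le_trans s0 (clip_ge _).
  - by apply: clip_le; rewrite sp_time_le // ltnW.
  - apply: measurable_funM.
      exact: measurable_at_le mz.
    rewrite /xi; case: leP => h; last exact: measurable_cst.
    apply: (@measurable_at_le _ _ _ _ _ (sp_time S i)).
      by rewrite le_max le_min lexx h orbT.
    exact: sp_coef_measurable.
  - apply: square_integrableM => //.
    have [C hC] := bxi t i.
    have loT : lo t i <= T by exact: le_trans (lo_hi _ _) (hi_leT _ _).
    have := square_integrable_bounded (measurable_at_measurable hW loT (@mxi S t i))
      hC (square_integrable_cst P 1).
    by under eq_fun do rewrite /= mulr1.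
transitivity (\int[P]_w \sum_i (c i w * (W (clip (sp_time S i.+1)) w
      - W (clip (sp_time S i)) w))).
  apply: eq_Rintegral => w _; rewrite /sp_integral -sumrB mulr_sumr.
  apply: eq_bigr => i _; rewrite -mulrBr /c /xi.
  have <- : W (Num.min (sp_time S i.+1) t) w - W (Num.min (sp_time S i.+1) s) w
    - (W (Num.min (sp_time S i) t) w - W (Num.min (sp_time S i) s) w) =
    W (clip (sp_time S i.+1)) w - W (clip (sp_time S i)) w.
    by rewrite !clipE; ring.
  case: (leP (sp_time S i) t) => h; first by ring.
  have h' : t <= sp_time S i.+1.
    by rewrite (le_trans (ltW h)) // sp_time_le // ltnW.
  rewrite (min_r h') (min_r (le_trans st (ltW h))).
  by rewrite (min_r (le_trans st h')); ring.
rewrite Rintegral_sum //; last by move=> i; exact: (zc i).1.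
by rewrite big1 // => i _; exact: (zc i).2.
Qed.

End simple_process.

(** * Ito integrals *)

Section fine_integral.
Context d (T : measurableType d) (R : realType) (mu : {measure set T -> \bar R}).
Variables (D : set T) (F : T -> \bar R).
Hypothesis mD : measurable D.
Hypothesis iF : mu.-integrable D F.

Let mF : measurable_fun D (EFin \o (fine \o F)).
Proof.
apply/measurable_EFinP; apply: measurableT_comp => //.
exact: (measurable_int mu).
Qed.

Let ae_fineE : ae_eq mu D F (EFin \o (fine \o F)).
Proof.
have := integrable_ae mD iF; apply: filterS => x /= h Dx.
by rewrite fineK // h.
Qed.

(** An integrable function is finite almost everywhere, so that [fine] modifies it on a null set
    only. *)
Lemma integrable_fine : mu.-integrable D (EFin \o (fine \o F)).
Proof.
apply/integrableP; split; first exact: mF.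
have /integrableP[mFF hF] := iF.
suff <- : (\int[mu]_(x in D) `|F x| =
  \int[mu]_(x in D) `|(EFin \o (fine \o F)) x|)%E by [].
apply: ae_eq_integral => //.
- exact: measurableT_comp.
- exact: measurableT_comp mF.
- by apply: filterS ae_fineE => x h Dx; rewrite [in LHS]h.
Qed.

Lemma Rintegral_fine :
  \int[mu]_(x in D) fine (F x) = fine (\int[mu]_(x in D) F x)%E.
Proof.
congr fine; apply/esym/ae_eq_integral => //.
exact: (measurable_int mu).
Qed.

End fine_integral.

(** * Tonelli and Fubini over a subset of the first factor *)

Section fubini_on_set.
Context d1 d2 (T1 : measurableType d1) (T2 : measurableType d2) (R : realType).
Variables (m1 : {sigma_finite_measure set T1 -> \bar R}).
Variables (m2 : {sigma_finite_measure set T2 -> \bar R}).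
Variable D : set T1.
Hypothesis mD : measurable D.
Local Open Scope ereal_scope.

Let mDT : measurable (D `*` [set: T2]).
Proof. exact: measurableX. Qed.

Let patchE (g : T1 * T2 -> \bar R) x y :
  (g \_ (D `*` setT)) (x, y) = ((fun x => g (x, y)) \_ D) x.
Proof. by rewrite /patch in_setX in_setT andbT. Qed.

Lemma measurable_slice1 (f : T1 -> T2 -> R) y :
  measurable_fun (D `*` setT) (fun z : T1 * T2 => f z.1 z.2) ->
  measurable_fun D (f ^~ y).
Proof.
move=> mf; have m2y : measurable_fun D (pair^~ y : T1 -> T1 * T2).
  exact/measurable_funTS/pair2_measurable.
apply: (measurable_comp mDT _ mf m2y).
by move=> _ [x Dx <-].
Qed.

Lemma measurable_slice2 (f : T1 -> T2 -> R) x : D x ->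
  measurable_fun (D `*` setT) (fun z : T1 * T2 => f z.1 z.2) ->
  measurable_fun setT (f x).
Proof.
move=> Dx mf.
have m1x : measurable_fun setT (pair x : T2 -> T1 * T2) by exact: pair1_measurable.
apply: (measurable_comp mDT _ mf m1x).
by move=> _ [y _ <-].
Qed.

Section tonelli.
Variable g : T1 * T2 -> \bar R.
Hypothesis mg : measurable_fun (D `*` setT) g.
Hypothesis g0 : forall z, 0 <= g z.

(** Processes are measurable on [0, T] x Omega only; extension by 0 brings them under the theorems
    for the full product. *)
Let g' := g \_ (D `*` setT).

Let mg' : measurable_fun setT g'.
Proof. exact/(measurable_restrictT _ mDT). Qed.

Let g'0 z : 0 <= g' z.
Proof. by rewrite /g' /patch; case: ifP. Qed.

Let g'_x y : \int[m1]_x g' (x, y) = \int[m1]_(x in D) g (x, y).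
Proof. by rewrite [RHS]integral_mkcond; apply: eq_integral => x _; rewrite -patchE. Qed.

Lemma tonelli_measurable : measurable_fun setT (fun y => \int[m1]_(x in D) g (x, y)).
Proof.
have := measurable_fun_fubini_tonelli_G (m1 := m1) g' mg' g'0.
by apply: eq_measurable_fun => y _; rewrite /fubini_G g'_x.
Qed.

Lemma tonelli_on : \int[m2]_y \int[m1]_(x in D) g (x, y) =
  \int[m1]_(x in D) \int[m2]_y g (x, y).
Proof.
transitivity (\int[m2]_y \int[m1]_x g' (x, y)).
  by apply: eq_integral => y _; rewrite g'_x.
rewrite -(fubini_tonelli (m1 := m1) (m2 := m2) g' mg' g'0) [RHS]integral_mkcond.
apply: eq_integral => x _; rewrite /patch; case: ifPn => xD.
  by apply: eq_integral => y _; rewrite /g' /patch in_setX xD in_setT.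
apply: integral0_eq => y _.
by rewrite /g' /patch in_setX (negbTE xD).
Qed.

End tonelli.

Section fubini.
Variable f : T1 -> T2 -> R.
Hypothesis mf : measurable_fun (D `*` setT) (fun z : T1 * T2 => f z.1 z.2).
Hypothesis fi : \int[m2]_y \int[m1]_(x in D) `|f x y|%:E < +oo.

Let f' := (fun z => (f z.1 z.2)%:E) \_ (D `*` setT).

Let mf' : measurable_fun setT f'.
Proof. by apply/(measurable_restrictT _ mDT)/measurable_EFinP. Qed.

Let f'_x y : \int[m1]_x `|f' (x, y)| = \int[m1]_(x in D) `|f x y|%:E.
Proof.
rewrite [RHS]integral_mkcond; apply: eq_integral => x _.
by rewrite /f' patchE /patch; case: ifP => //; rewrite abse0.
Qed.

Let if' : (m1 \x m2).-integrable setT f'.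
Proof.
apply/(@integrable21ltyP _ _ _ _ _ m1 m2 _ mf').
by under eq_integral do rewrite f'_x.
Qed.

Let FE x : x \in D -> \int[m2]_y f' (x, y) = \int[m2]_y (f x y)%:E.
Proof.
by move=> xD; apply: eq_integral => y _; rewrite /f' /patch in_setX xD in_setT.
Qed.

Let F0 x : x \notin D -> \int[m2]_y f' (x, y) = 0.
Proof.
by move=> xD; apply: integral0_eq => y _; rewrite /f' /patch in_setX (negbTE xD).
Qed.

Let GE y : \int[m1]_x f' (x, y) = \int[m1]_(x in D) (f x y)%:E.
Proof. by rewrite [RHS]integral_mkcond; apply: eq_integral => x _; exact: patchE. Qed.

Let iG : m2.-integrable setT (fun y => \int[m1]_(x in D) (f x y)%:E).
Proof.
have mG : measurable_fun setT (fun y => \int[m1]_(x in D) (f x y)%:E).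
  have := measurable_fubini_G if'.
  by apply: eq_measurable_fun => y _; rewrite /fubini_G GE.
have mnf : measurable_fun (D `*` setT) (fun z : T1 * T2 => `|f z.1 z.2|%:E).
  by apply/measurable_EFinP; exact: measurableT_comp.
apply/integrableP; split=> //; apply: le_lt_trans fi; apply: ge0_le_integral => //.
- exact: measurableT_comp.
- by apply: (tonelli_measurable mnf) => z; rewrite lee_fin.
- move=> y _; apply: (le_abse_integral m1 mD (f := fun x => (f x y)%:E)).
  by apply/measurable_EFinP; exact: measurable_slice1.
Qed.

Let iF : m1.-integrable D (fun x => \int[m2]_y (f x y)%:E).
Proof.
have := integrableS measurableT mD (@subsetT _ D) (integrable_fubini_F if').
by apply: eq_integrable => // x xD; rewrite /fubini_F FE.
Qed.

Lemma fubini_integrable_l :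
  m2.-integrable setT (EFin \o (fun y => \int[m1]_(x in D) f x y)%R).
Proof. exact: integrable_fine. Qed.

Lemma fubini_integrable_r :
  m1.-integrable D (EFin \o (fun x => \int[m2]_y f x y)%R).
Proof. exact: integrable_fine. Qed.

Lemma fubini_on : (\int[m2]_y \int[m1]_(x in D) f x y =
  \int[m1]_(x in D) \int[m2]_y f x y)%R.
Proof.
rewrite [LHS](Rintegral_fine measurableT iG) [RHS](Rintegral_fine mD iF).
congr fine; transitivity (\int[m2]_y \int[m1]_x f' (x, y)).
  by apply: eq_integral => y _; rewrite GE.
rewrite -(Fubini if') [RHS]integral_mkcond; apply: eq_integral => x _.
by rewrite /patch; case: ifPn => xD; [exact: FE|exact: F0].
Qed.

End fubini.

End fubini_on_set.

(** * Mean squares of random variables and of processes *)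

Section mean_square.
Context d (Omega : measurableType d) (R : realType).
Context (P : probability Omega R) (T : R).
Implicit Types (f g h : R -> Omega -> R) (X Y Z : Omega -> R).
Local Open Scope ereal_scope.

(** Kept in the extended reals, since bounds on it serve to prove square integrability. *)
Definition mean_sqr X := \int[P]_w ((X w) ^+ 2)%:E.

Lemma ge0_cvg0_lt (u : nat -> \bar R) : u @ \oo --> 0 ->
  forall e : R, (0 < e)%R -> exists N, forall k, (N <= k)%N -> u k < e%:E.
Proof.
move=> /fine_cvgP [[N1 _ fin] /cvgrPdist_lt cv] e e0.
have [N2 _ h] := cv _ e0; exists (maxn N1 N2) => k; rewrite geq_max => /andP[k1 k2].
rewrite -(fineK (fin k k1)) lte_fin; apply: le_lt_trans (h k k2).
by rewrite /= sub0r normrN ler_norm.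
Qed.

Lemma le0_forall_gt (x : \bar R) (C : R) : 0 <= x ->
  (forall e : R, (0 < e)%R -> x <= (C * e)%:E) -> x = 0.
Proof.
move=> x0 h; have C0 : (0 <= C)%R.
  by have := le_trans x0 (h 1%R ltr01); rewrite lee_fin mulr1.
apply/eqP; rewrite eq_le x0 andbT; apply/lee_addgt0Pr => e e0; rewrite add0e.
have e1 : (0 < e / (C + 1))%R by rewrite divr_gt0 // ltr_wpDl.
apply: (le_trans (h _ e1)); rewrite lee_fin mulrCA ger_pMr //.
by rewrite ler_pdivrMr ?mul1r ?lerDl // ltr_wpDl.
Qed.

Lemma mean_sqr_ge0 X : 0 <= mean_sqr X.
Proof. by apply: integral_ge0 => w _; rewrite lee_fin sqr_ge0. Qed.

Lemma ge0_integral_sqrD d' (U : measurableType d') (m : {measure set U -> \bar R})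
    (D : set U) (F G : U -> R) : measurable D ->
  measurable_fun D F -> measurable_fun D G ->
  \int[m]_(x in D) ((F x + G x) ^+ 2)%:E <=
  2%:E * \int[m]_(x in D) (F x ^+ 2)%:E + 2%:E * \int[m]_(x in D) (G x ^+ 2)%:E.
Proof.
move=> mD mF mG.
have m2 (H : U -> R) : measurable_fun D H -> measurable_fun D (fun x => (H x ^+ 2)%:E).
  by move=> mH; apply/measurable_EFinP; exact: measurable_funX.
have p2 (H : U -> R) x : 0 <= (H x ^+ 2)%:E by rewrite lee_fin sqr_ge0.
rewrite -!ge0_integralZl //; [|exact: m2|exact: m2].
rewrite -ge0_integralD //; last 4 first.
- by move=> x _; rewrite mule_ge0.
- by apply: emeasurable_funM => //; exact: m2.
- by move=> x _; rewrite mule_ge0.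
- by apply: emeasurable_funM => //; exact: m2.
apply: ge0_le_integral_nonmeasurable => x _; first exact: (p2 (fun x => F x + G x)%R).
by rewrite -!EFinM -EFinD lee_fin; have := sqr_ge0 (F x - G x)%R; nra.
Qed.

Lemma mean_sqrD X Y : measurable_fun setT X -> measurable_fun setT Y ->
  mean_sqr (fun w => X w + Y w)%R <= 2%:E * mean_sqr X + 2%:E * mean_sqr Y.
Proof. by move=> mX mY; exact: ge0_integral_sqrD. Qed.

Lemma mean_sqrD_le X Y (a b : R) : measurable_fun setT X -> measurable_fun setT Y ->
  mean_sqr X <= a%:E -> mean_sqr Y <= b%:E ->
  mean_sqr (fun w => X w + Y w)%R <= (2 * a + 2 * b)%:E.
Proof.
move=> mX mY Xa Yb; apply: (le_trans (mean_sqrD mX mY)).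
rewrite [leRHS](_ : _ = 2%:E * a%:E + 2%:E * b%:E) //.
by apply: leeD; apply: lee_wpmul2l.
Qed.

Lemma mean_sqr_eq0 X : measurable_fun setT X -> mean_sqr X = 0 ->
  {ae P, forall w, X w = 0%R}.
Proof.
move=> mX X0.
have mX2 : measurable_fun setT (fun w => (X w ^+ 2)%:E).
  by apply/measurable_EFinP; exact: measurable_funX.
have : \int[P]_w `|(X w ^+ 2)%:E| = 0.
  by rewrite -[RHS]X0; apply: eq_integral => w _; rewrite gee0_abs // lee_fin sqr_ge0.
move/(ae_eq_integral_abs P measurableT mX2); apply: filterS => w /(_ Logic.I) /=.
by case=> /eqP; rewrite sqrf_eq0 => /eqP.
Qed.

Lemma square_integrable_mean_sqr X : measurable_fun setT X -> mean_sqr X < +oo ->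
  square_integrable P X.
Proof.
move=> mX hX; split=> //; apply/integrableP; split.
  by apply/measurable_EFinP; exact: measurable_funX.
by under eq_integral do rewrite gee0_abs ?lee_fin ?sqr_ge0 //.
Qed.

Lemma EFin_mean_sqr X : square_integrable P X ->
  (\int[P]_w (X w ^+ 2))%R%:E = mean_sqr X.
Proof. by move=> [mX iX]; rewrite EFin_Rintegral. Qed.

Definition path_mean_sqr f :=
  \int[P]_w \int[lebesgue_measure]_(t in `[0%R, T]) ((f t w) ^+ 2)%:E.

Definition jointly_measurable f :=
  measurable_fun (`[0%R, T] `*` setT) (fun p : R * Omega => f p.1 p.2).

Lemma path_mean_sqr_ge0 f : 0 <= path_mean_sqr f.
Proof. by apply: integral_ge0 => w _; apply: integral_ge0 => t _; rewrite lee_fin sqr_ge0. Qed.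

Let mX (D : set R) (mD : measurable D) (f : R -> Omega -> R) :
  measurable_fun (D `*` setT) (fun p : R * Omega => f p.1 p.2) ->
  measurable_fun (D `*` setT) (fun p : R * Omega => ((f p.1 p.2) ^+ 2)%:E).
Proof. by move=> mf; apply/measurable_EFinP; exact: measurable_funX. Qed.

Lemma measurable_path_sqr f : jointly_measurable f ->
  measurable_fun setT
    (fun w => \int[lebesgue_measure]_(t in `[0%R, T]) ((f t w) ^+ 2)%:E).
Proof.
move=> mf; have mD : measurable (`[0%R, T]%classic : set R) by [].
apply: (@tonelli_measurable _ _ _ _ R lebesgue_measure _ mD
  (fun p : R * Omega => ((f p.1 p.2) ^+ 2)%:E)); first exact: mX.
by move=> z; rewrite lee_fin sqr_ge0.
Qed.

Lemma path_mean_sqrD f g : jointly_measurable f -> jointly_measurable g ->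
  path_mean_sqr (fun t w => f t w + g t w)%R <=
  2%:E * path_mean_sqr f + 2%:E * path_mean_sqr g.
Proof.
move=> mf mg; have mD : measurable (`[0%R, T]%classic : set R) by [].
have i0 (h : R -> Omega -> R) w : 0 <= \int[lebesgue_measure]_(t in `[0%R, T]) ((h t w) ^+ 2)%:E.
  by apply: integral_ge0 => t _; rewrite lee_fin sqr_ge0.
rewrite /path_mean_sqr -!ge0_integralZl //; [|exact: measurable_path_sqr..].
rewrite -ge0_integralD //; last 4 first.
- by move=> x _; rewrite mule_ge0.
- by apply: emeasurable_funM => //; exact: measurable_path_sqr.
- by move=> x _; rewrite mule_ge0.
- by apply: emeasurable_funM => //; exact: measurable_path_sqr.
apply: ge0_le_integral_nonmeasurable => w _; first exact: (i0 (fun t w => f t w + g t w)%R).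
by apply: ge0_integral_sqrD => //; exact: measurable_slice1.
Qed.

Lemma path_mean_sqrD_le f g (a b : R) :
  jointly_measurable f -> jointly_measurable g ->
  path_mean_sqr f <= a%:E -> path_mean_sqr g <= b%:E ->
  path_mean_sqr (fun t w => f t w + g t w)%R <= (2 * a + 2 * b)%:E.
Proof.
move=> mf mg fa gb; apply: (le_trans (path_mean_sqrD mf mg)).
rewrite [leRHS](_ : _ = 2%:E * a%:E + 2%:E * b%:E) //.
by apply: leeD; apply: lee_wpmul2l.
Qed.

Lemma path_mean_sqrN f g : path_mean_sqr (fun t w => f t w - g t w)%R =
  path_mean_sqr (fun t w => g t w - f t w)%R.
Proof.
by apply: eq_integral => w _; apply: eq_integral => t _; rewrite -sqrrN opprB.
Qed.

Lemma mean_sqrN X Y : mean_sqr (fun w => X w - Y w)%R =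
  mean_sqr (fun w => Y w - X w)%R.
Proof. by apply: eq_integral => w _; rewrite -sqrrN opprB. Qed.

Lemma path_mean_sqr_eq0 f g : jointly_measurable f -> jointly_measurable g ->
  path_mean_sqr (fun t w => f t w - g t w)%R = 0 ->
  {ae (lebesgue_measure \x P), forall p : R * Omega,
    p.1 \in `[0%R, T] -> f p.1 p.2 = g p.1 p.2}.
Proof.
move=> mf mg.
have mD : measurable (`[0%R, T]%classic : set R) by [].
have mDT : measurable ((`[0%R, T]%classic : set R) `*` [set: Omega]) by exact: measurableX.
pose F := (fun p : R * Omega => ((f p.1 p.2 - g p.1 p.2) ^+ 2)%:E) \_ (`[0%R, T] `*` setT).
have mF : measurable_fun setT F.
  apply/(measurable_restrictT _ mDT).
  apply: (mX mD (f := fun t w => f t w - g t w)%R); exact: measurable_funB.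
have F0 p : 0 <= F p.
  by rewrite /F /patch; case: ifP => // _; rewrite lee_fin sqr_ge0.
move=> h.
have : \int[lebesgue_measure \x P]_p `|F p| = 0.
  under eq_integral do rewrite gee0_abs //.
  rewrite fubini_tonelli2 // -[RHS]h; apply: eq_integral => w _.
  rewrite /fubini_G [RHS]integral_mkcond; apply: eq_integral => t _.
  by rewrite /F /patch in_setX in_setT andbT.
have /= := ae_eq_integral_abs (lebesgue_measure \x P) measurableT mF.
move=> -> ; apply: filterS => p /(_ Logic.I) /= Fp pT.
move: Fp; rewrite /F /patch in_setX in_setT andbT mem_setE pT.
by case=> /eqP; rewrite sqrf_eq0 subr_eq0 => /eqP.
Qed.

End mean_square.

(** * Orthogonality and uniqueness for Ito integrals *)

Section ito_integral_properties.
Context d (Omega : measurableType d) (R : realType).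
Context (P : probability Omega R) (T : R) (W : R -> Omega -> R).
Hypothesis hW : wiener_process P T W.
Hypothesis T0 : 0 <= T.
Implicit Types (s t : R) (phi psi I J : R -> Omega -> R).

Lemma progressively_measurable_joint phi :
  progressively_measurable P W T phi -> jointly_measurable T phi.
Proof.
move=> /(_ T); rewrite in_itv /= T0 lexx => /(_ isT) mphi.
pose G := g_sigma_algebraType (completed_events P W T).
have mid : measurable_fun setT (fun p : R * Omega => (p.1, p.2) : R * G).
  apply: measurable_fun_pair; first exact: measurable_fst.
  move=> _ B mB; rewrite setTI.
  have mB' : measurable (B : set Omega).
    exact: (completed_events_measurable hW (lexx T)).
  by rewrite -[X in measurable X]setTI; exact: measurable_snd.
have mDT : measurable ((`[0, T]%classic : set R) `*` [set: G]) by exact: measurableX.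
apply: (measurable_comp mDT _ mphi (measurable_funTS mid)).
by move=> _ [[t w] /= [tT _] <-].
Qed.

Lemma progressively_measurable_at phi t : t \in `[0, T] ->
  progressively_measurable P W T phi -> measurable_at P W t (phi t).
Proof.
move=> tT /(_ t tT) mphi.
have mD : measurable (`[0, t]%classic : set R) by [].
apply: (measurable_slice2 mD _ mphi); move: tT; rewrite /= !in_itv /= => /andP[-> _].
by rewrite lexx.
Qed.

Lemma measurable_indic_fst (A : set R) : measurable A ->
  measurable_fun setT (fun p : R * Omega => \1_A p.1 : R).
Proof.
move=> mA; have mi : measurable_fun setT (\1_A : R -> R) by exact: measurable_indic.
exact: (measurableT_comp mi measurable_fst).
Qed.

Lemma sp_value_joint (S : simple_process P T W) : jointly_measurable T (sp_value S).
Proof.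
rewrite /jointly_measurable /sp_value; apply: measurable_funTS.
apply: measurable_sum => i.
apply: measurable_funM.
  apply: (measurableT_comp (f := sp_coef S i)); last exact: measurable_snd.
  apply: (measurable_at_measurable hW _ (sp_coef_measurable (ltn_ord i))).
  by rewrite sp_time_leT // ltnW.
exact: measurable_indic_fst.
Qed.

Let mdiff f g : jointly_measurable (Omega := Omega) T f -> jointly_measurable T g ->
  jointly_measurable T (fun t w => f t w - g t w).
Proof. by move=> mf mg; exact: measurable_funB. Qed.

Lemma sp_path_mean_sqr (S S' : simple_process P T W) t : t \in `[0, T] ->
  (mean_sqr P (fun w => sp_integral S t w - sp_integral S' t w)%R <=
   path_mean_sqr P T (fun r w => sp_value S r w - sp_value S' r w)%R)%E.
Proof.
move=> tT; rewrite /mean_sqr; have <- := sp_isometry hW S S' tT.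
apply: ge0_le_integral_nonmeasurable => w _.
  by apply: integral_ge0 => r _; rewrite lee_fin sqr_ge0.
apply: ge0_le_integral_nonmeasurable => r _; first by rewrite lee_fin sqr_ge0.
by rewrite lee_fin exprMn ler_piMr ?sqr_ge0.
Qed.

Lemma sp_path_mean_sqrT (S S' : simple_process P T W) :
  (path_mean_sqr P T (fun r w => sp_value S r w - sp_value S' r w)%R =
   mean_sqr P (fun w => sp_integral S T w - sp_integral S' T w)%R)%E.
Proof.
have TT : T \in `[0, T] by rewrite in_itv /= T0 lexx.
rewrite /mean_sqr; have <- := sp_isometry hW S S' TT.
apply: eq_integral => w _; apply: eq_integral => r rT.
by rewrite indicE rT mulr1.
Qed.

Section one_integral.
Variables (phi I : R -> Omega -> R).
Hypothesis hI : ito_integral P T W phi I.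

Let mphi : jointly_measurable T phi.
Proof. exact: progressively_measurable_joint (ito_integrand_progressive hI). Qed.

Let mI t : t \in `[0, T] -> measurable_fun setT (I t).
Proof.
move=> tT; apply: (measurable_at_measurable hW _ (ito_adapted hI tT)).
by move: tT; rewrite in_itv /= => /andP[].
Qed.

Let mS (S : simple_process P T W) t : t \in `[0, T] ->
  measurable_fun setT (sp_integral S t).
Proof. by move=> tT; have [] := sp_integral_square_integrable hW S tT. Qed.

(** One simple process serves both times, as [ito_limit] provides a single sequence for all times.
    The increment from s to t is then close to that of one simple integral. *)
Lemma ito_approximation (e : R) s t : 0 < e -> s \in `[0, T] -> t \in `[0, T] ->
  exists S : simple_process P T W,
  [/\ (path_mean_sqr P T (fun r w => sp_value S r w - phi r w)%R < e%:E)%E,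
      (mean_sqr P (fun w => sp_integral S s w - I s w)%R < e%:E)%E &
      (mean_sqr P (fun w => sp_integral S t w - I t w)%R < e%:E)%E].
Proof.
move=> e0 sT tT; have [S [cphi cI]] := ito_limit hI.
have [N1 h1] := ge0_cvg0_lt cphi e0.
have [N2 h2] := ge0_cvg0_lt (cI s sT) e0.
have [N3 h3] := ge0_cvg0_lt (cI t tT) e0.
exists (S (maxn N1 (maxn N2 N3))); split.
- by apply: h1; rewrite leq_maxl.
- by apply: h2; rewrite (leq_trans _ (leq_maxr _ _)) // leq_maxl.
- by apply: h3; rewrite (leq_trans _ (leq_maxr _ _)) // leq_maxr.
Qed.

Lemma ito_square_integrable t : t \in `[0, T] -> square_integrable P (I t).
Proof.
move=> tT; have [S [_ _ hS]] := ito_approximation ltr01 tT tT.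
have SI := sp_integral_square_integrable hW S tT.
have SmI : square_integrable P (fun w => sp_integral S t w - I t w).
  apply: square_integrable_mean_sqr.
    by apply: measurable_funB; [exact: mS|exact: mI].
  by rewrite (lt_trans hS) // ltry.
have := square_integrableB SI SmI.
by under eq_fun do rewrite subKr.
Qed.

Lemma ito_increment_orthogonal s t zeta : 0 <= s -> s <= t -> t <= T ->
  measurable_at P W s zeta -> square_integrable P zeta ->
  \int[P]_w (zeta w * (I t w - I s w)) = 0.
Proof.
move=> s0 st tT mz zi.
have sT : s \in `[0, T] by rewrite in_itv /= s0 (le_trans st).
have tT' : t \in `[0, T] by rewrite in_itv /= tT (le_trans s0).
apply/eqP; rewrite -normr_le0; apply/ler_addgt0Pr => e e0; rewrite add0r.
(* The errors at s and at t, estimated by the weak Cauchy-Schwarz inequality with weight [dl] and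
   tolerance [dl^2], sum to at most [2 (dl E[zeta^2] + dl) = dl C = e]. *)
pose C := 2 * \int[P]_w (zeta w ^+ 2) + 2.
have C0 : 0 < C.
  by rewrite ltr_wpDl // mulr_ge0 // Rintegral_ge0 // => w _; exact: sqr_ge0.
pose dl := e / C; have dl0 : 0 < dl by rewrite divr_gt0.
have dl20 : 0 < dl ^+ 2 by rewrite exprn_gt0.
have [S [_ hs ht]] := ito_approximation dl20 sT tT'.
have D r : r \in `[0, T] -> square_integrable P (fun w => sp_integral S r w - I r w).
  move=> rT; apply: square_integrableB; last exact: ito_square_integrable.
  exact: sp_integral_square_integrable.
have bnd r : r \in `[0, T] -> (mean_sqr P (fun w => sp_integral S r w - I r w)%R
      < (dl ^+ 2)%:E)%E ->
    `|\int[P]_w (zeta w * (sp_integral S r w - I r w))| <=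
    dl * \int[P]_w (zeta w ^+ 2) + dl.
  move=> rT hr; apply: (le_trans (Rintegral_mul_bound dl0 zi (D r rT))).
  rewrite lerD2l -[leRHS](mulKf (x := dl)) ?gt_eqF // ler_pM2l ?invr_gt0 //.
  by rewrite -expr2 -lee_fin (EFin_mean_sqr (D r rT)) ltW.
have -> : \int[P]_w (zeta w * (I t w - I s w)) =
    \int[P]_w (zeta w * (sp_integral S s w - I s w)) -
    \int[P]_w (zeta w * (sp_integral S t w - I t w)).
  have i1 := square_integrableM zi (D s sT).
  have i2 := square_integrableM zi (D t tT').
  have i3 : P.-integrable setT (EFin \o
      (fun w => zeta w * (sp_integral S t w - sp_integral S s w))).
    apply: square_integrableM => //.
    by apply: square_integrableB; exact: sp_integral_square_integrable.
  transitivity (\int[P]_w (zeta w * (sp_integral S t w - sp_integral S s w) +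
      (zeta w * (sp_integral S s w - I s w) - zeta w * (sp_integral S t w - I t w)))).
    by apply: eq_Rintegral => w _; ring.
  rewrite RintegralD //; last exact: integrable_EFinB.
  by rewrite RintegralB // (sp_integral_orthogonal hW S s0 st tT mz zi) add0r.
rewrite (le_trans (ler_normB _ _)) // (le_trans (lerD (bnd s sT hs) (bnd t tT' ht))) //.
have -> : e = dl * C by rewrite /dl divfK // gt_eqF.
by rewrite /C; lra.
Qed.

End one_integral.

Let mS (S : simple_process P T W) t : t \in `[0, T] ->
  measurable_fun setT (sp_integral S t).
Proof. by move=> tT; have [] := sp_integral_square_integrable hW S tT. Qed.

Lemma ito_integral_unique phi I J : ito_integral P T W phi I ->
  ito_integral P T W phi J -> forall t, t \in `[0, T] ->
  {ae P, forall w, I t w = J t w}.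
Proof.
move=> hI hJ t tT.
have mphi := progressively_measurable_joint (ito_integrand_progressive hI).
have [mI _] := ito_square_integrable hI tT.
have [mJ _] := ito_square_integrable hJ tT.
have mIJ : measurable_fun setT (fun w => I t w - J t w) by exact: measurable_funB.
suff : mean_sqr P (fun w => I t w - J t w) = 0%E.
  move/(mean_sqr_eq0 mIJ); apply: filterS => w /eqP.
  by rewrite subr_eq0 => /eqP.
(* The distance from [I t] to [J t] is measured through the integrals of [S] and [S'], using
   [(A + B)^2 <= 2 A^2 + 2 B^2] each time: [2 e + 2 e] between [S] and [S'], then 10 e from [S] to
   [J], then 22 e. *)
apply: (le0_forall_gt (C := 22)); first exact: mean_sqr_ge0.
move=> e e0.
have [S [S1 _ S2]] := ito_approximation hI e0 tT tT.
have [S' [S1' _ S2']] := ito_approximation hJ e0 tT tT.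
have mv := sp_value_joint S; have mv' := sp_value_joint S'.
have h1 : (mean_sqr P (fun w => sp_integral S t w - sp_integral S' t w)%R <=
    (2 * e + 2 * e)%:E)%E.
  apply: (le_trans (sp_path_mean_sqr S S' tT)).
  have := path_mean_sqrD_le (P := P) (mdiff mv mphi) (mdiff mphi mv') (ltW S1).
  rewrite path_mean_sqrN => /(_ _ (ltW S1')).
  by under [X in path_mean_sqr _ _ X]eq_fun do under eq_fun do rewrite subrKA.
have h2 := mean_sqrD_le (measurable_funB (mS S tT) (mS S' tT))
  (measurable_funB (mS S' tT) mJ) h1 (ltW S2').
have S2N : (mean_sqr P (fun w => I t w - sp_integral S t w)%R <= e%:E)%E.
  by rewrite mean_sqrN ltW.
have h3 := mean_sqrD_le (measurable_funB mI (mS S tT)) (measurable_funD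
  (measurable_funB (mS S tT) (mS S' tT)) (measurable_funB (mS S' tT) mJ)) S2N h2.
have -> : 22 * e = 2 * e + 2 * (2 * (2 * e + 2 * e) + 2 * e) by ring.
apply: le_trans h3; rewrite le_eqVlt; apply/orP; left; apply/eqP.
by congr mean_sqr; apply/funext => w /=; ring.
Qed.

(** At time T the isometry is an equality with the full path norm, so it can be read backwards:
    integrals that are close at T have close integrands. The constant 22 arises as in
    [ito_integral_unique], with the roles of integrals and integrands exchanged. *)
Lemma ito_integrand_unique phi psi I J : ito_integral P T W phi I ->
  ito_integral P T W psi J -> {ae P, forall w, I T w = J T w} ->
  {ae (lebesgue_measure \x P)%E, forall p : R * Omega,
    p.1 \in `[0, T] -> phi p.1 p.2 = psi p.1 p.2}.
Proof.
move=> hI hJ IJ.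
have TT : T \in `[0, T] by rewrite in_itv /= T0 lexx.
have mphi := progressively_measurable_joint (ito_integrand_progressive hI).
have mpsi := progressively_measurable_joint (ito_integrand_progressive hJ).
have [mI _] := ito_square_integrable hI TT.
have [mJ _] := ito_square_integrable hJ TT.
apply: path_mean_sqr_eq0 => //.
apply: (le0_forall_gt (C := 22)); first exact: path_mean_sqr_ge0.
move=> e e0.
have [S [S1 _ S2]] := ito_approximation hI e0 TT TT.
have [S' [S1' _ S2']] := ito_approximation hJ e0 TT TT.
have mv := sp_value_joint S; have mv' := sp_value_joint S'.
have S2N : (mean_sqr P (fun w => I T w - sp_integral S' T w)%R <= e%:E)%E.
  rewrite mean_sqrN; apply: le_trans (ltW S2'); rewrite le_eqVlt; apply/orP; left.
  apply/eqP; apply: ae_eq_integral => //.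
  - by apply/measurable_EFinP/measurable_funX/measurable_funB; [exact: mS|].
  - by apply/measurable_EFinP/measurable_funX/measurable_funB; [exact: mS|].
  - by apply: filterS IJ => w -> _.
have h1 : (path_mean_sqr P T (fun r w => sp_value S r w - sp_value S' r w)%R <=
    (2 * e + 2 * e)%:E)%E.
  rewrite sp_path_mean_sqrT.
  have := mean_sqrD_le (measurable_funB (mS S TT) mI)
    (measurable_funB mI (mS S' TT)) (ltW S2) S2N.
  by under [X in mean_sqr _ X]eq_fun do rewrite /= subrKA.
have h2 := path_mean_sqrD_le (mdiff mv mv') (mdiff mv' mpsi) h1 (ltW S1').
have S1N : (path_mean_sqr P T (fun r w => phi r w - sp_value S r w)%R <= e%:E)%E.
  by rewrite path_mean_sqrN ltW.
have h3 := path_mean_sqrD_le (mdiff mphi mv) (measurable_funD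
  (mdiff mv mv') (mdiff mv' mpsi)) S1N h2.
have -> : 22 * e = 2 * e + 2 * (2 * (2 * e + 2 * e) + 2 * e) by ring.
apply: le_trans h3; rewrite le_eqVlt; apply/orP; left; apply/eqP.
by congr path_mean_sqr; apply/funext => r; apply/funext => w /=; ring.
Qed.

End ito_integral_properties.

(** * Linear systems tested against square-integrable variables *)

Section bounded_coefficients.
Context {R : realType} (T : R).
Hypothesis T0 : 0 <= T.
Notation mu := (@lebesgue_measure R).
Implicit Types (al c k f g p q : R -> R).

(** The class in which the functions [t |-> E[zeta X_t]] are shown to lie, and for which the
    Gronwall lemmas are stated. *)
Definition bounded_measurable f :=
  measurable_fun `[0, T] f /\ exists K, forall t, t \in `[0, T] -> `|f t| <= K.

Lemma bounded_measurableD f g : bounded_measurable f -> bounded_measurable g ->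
  bounded_measurable (fun t => f t + g t).
Proof.
move=> [mf [K hK]] [mg [L hL]]; split; first exact: measurable_funD.
by exists (K + L) => t tT; rewrite (le_trans (ler_normD _ _)) // lerD // ?hK ?hL.
Qed.

Lemma bounded_measurableM f g : bounded_measurable f -> bounded_measurable g ->
  bounded_measurable (fun t => f t * g t).
Proof.
move=> [mf [K hK]] [mg [L hL]]; split; first exact: measurable_funM.
by exists (K * L) => t tT; rewrite normrM ler_pM // ?hK ?hL.
Qed.

Lemma bounded_measurableN f : bounded_measurable f ->
  bounded_measurable (fun t => - f t).
Proof.
move=> [mf [K hK]]; split; first exact: measurableT_comp.
by exists K => t tT; rewrite normrN hK.
Qed.

Lemma within_continuous_bound f : {within `[0, T], continuous f} ->
  exists K : R, forall t : R, t \in `[0, T] -> `|f t| <= K.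
Proof.
move=> cf; have [K hK] := bounded_comp_clamp T0 cf.
by exists K => t tT; rewrite -(clamp_id tT).
Qed.

Lemma continuous_bounded_measurable f : {within `[0, T], continuous f} ->
  bounded_measurable f.
Proof.
move=> cf; split; first exact: subspace_continuous_measurable_fun.
exact: within_continuous_bound.
Qed.

Lemma bounded_measurable_cst (r : R) : bounded_measurable (fun _ => r).
Proof. by split; [exact: measurable_cst|exists `|r|]. Qed.

Lemma bounded_measurable_norm f : bounded_measurable f ->
  bounded_measurable (fun t => `|f t|).
Proof.
move=> [mf [K hK]]; split; first exact: measurableT_comp.
by exists K => t tT; rewrite normr_id hK.
Qed.

Lemma bounded_measurable_integrable f s t : bounded_measurable f -> 0 <= s -> t <= T ->
  mu.-integrable `[s, t] (EFin \o f).
Proof.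
move=> [mf [K hK]] s0 tT.
have sub : [set` `[s, t]] `<=` [set` `[0, T]].
  by move=> r /=; rewrite !in_itv /= => /andP[h1 h2]; rewrite (le_trans s0) //= (le_trans h2).
apply: measurable_bounded_integrable => //.
- by rewrite /= lebesgue_measure_itv; case: ifP => _; rewrite ltry.
- exact: measurable_funS mf.
exists K; split; first exact: num_real.
by move=> r Kr u us /=; rewrite (le_trans (hK u _)) ?ltW //; exact: sub.
Qed.

Lemma integral_equation_sub (F F' G : R -> R) (A A' B B' t : R) :
  bounded_measurable F -> bounded_measurable F' -> 0 <= t ->
  A = B + \int[mu]_(r in `[t, T]) F r -> A' = B' + \int[mu]_(r in `[t, T]) F' r ->
  (forall r, r \in `[t, T] -> F r - F' r = G r) ->
  A - A' = (B - B') + \int[mu]_(r in `[t, T]) G r.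
Proof.
move=> bF bF' t0 -> -> FG.
have <- : \int[mu]_(r in `[t, T]) (F r - F' r) = \int[mu]_(r in `[t, T]) G r.
  by apply: eq_Rintegral => r; rewrite inE => /FG.
rewrite (@RintegralB _ _ _ mu) //; first by ring.
- exact: (bounded_measurable_integrable bF).
- exact: (bounded_measurable_integrable bF').
Qed.

Lemma linear_backward_eq0 al c k p q (s : R) : 0 <= s -> s <= T ->
  bounded_measurable al -> bounded_measurable c -> bounded_measurable k ->
  bounded_measurable p -> bounded_measurable q ->
  (forall t : R, t \in `[s, T] -> p t = - \int[mu]_(r in `[t, T]) (al r * p r - c r * q r)) ->
  (forall t : R, t \in `[s, T] ->
    q t = - \int[mu]_(r in `[t, T]) (- (al r * q r) - k r * p r)) ->
  forall t : R, t \in `[s, T] -> p t = 0 /\ q t = 0.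
Proof.
move=> s0 sT bal bc bk bp bq ep eq.
have [_ [K1 h1]] := bal; have [_ [K2 h2]] := bc; have [_ [K3 h3]] := bk.
pose K := K1 + K2 + K3; pose F t := `|p t| + `|q t|.
have TT : T \in `[0, T] by rewrite in_itv /= T0 lexx.
have K10 := le_trans (normr_ge0 _) (h1 T TT); have K20 := le_trans (normr_ge0 _) (h2 T TT).
have K30 := le_trans (normr_ge0 _) (h3 T TT).
have bF : bounded_measurable F.
  by apply: bounded_measurableD; exact: bounded_measurable_norm.
have [mF [B hB]] := bF.
have sub t : t \in `[s, T] -> [set` `[t, T]] `<=` [set` `[0, T]].
  rewrite in_itv /= => /andP[st _] r /=; rewrite !in_itv /= => /andP[tr ->].
  by rewrite (le_trans s0 (le_trans st tr)).
have half (h : R -> R) t : t \in `[s, T] -> bounded_measurable h ->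
    (forall r, r \in `[0, T] -> `|h r| <= K * F r) ->
    `|- \int[mu]_(r in `[t, T]) h r| <= K * \int[mu]_(r in `[t, T]) F r.
  move=> ts bh hF; have t0 : 0 <= t by apply: le_trans s0 _; move: ts; rewrite in_itv => /andP[].
  have ih := bounded_measurable_integrable bh t0 (lexx T).
  have iF := bounded_measurable_integrable bF t0 (lexx T).
  rewrite normrN (le_trans (le_normr_Rintegral _ ih)) // -RintegralZl //.
  apply: le_Rintegral => //; first exact: integrable_norm.
    exact: integrable_EFinZl.
  by move=> r /(sub t ts); exact: hF.
have F0 : forall t, t \in `[s, T] -> F t = 0.
  apply: (@gronwall_backward _ F (2 * K) B) => //.
  - by rewrite mulr_ge0 // !addr_ge0.
  - apply: measurable_funS mF => //; apply: sub; by rewrite in_itv /= lexx.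
  - move=> t ts; have tT : t \in `[0, T] by apply: (sub s) => //; rewrite in_itv /= lexx.
    by rewrite addr_ge0 //= (le_trans (ler_norm _)) // hB.
  move=> t ts; rewrite -mulrA mulr_natl mulr2n {1}/F ep // eq //.
  have lin (x y X Y : R) : `|x| <= K -> `|y| <= K -> `|x * X - y * Y| <= K * (`|X| + `|Y|).
    by move=> xK yK; rewrite (le_trans (ler_normB _ _)) // mulrDr !normrM lerD // ler_wpM2r.
  apply: lerD; apply: half => //.
  - by apply: bounded_measurableD; [|apply: bounded_measurableN]; exact: bounded_measurableM.
  - by move=> r rT; apply: lin; rewrite /K; have := h1 r rT; have := h2 r rT; lra.
  - by apply: bounded_measurableD; apply: bounded_measurableN; exact: bounded_measurableM.
  move=> r rT; rewrite -mulNr /F [`|p r| + _]addrC; apply: lin; rewrite /K ?normrN.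
    by have := h1 r rT; lra.
  by have := h3 r rT; lra.
move=> t ts; have /eqP := F0 t ts.
by rewrite paddr_eq0 // !normr_eq0 => /andP[/eqP -> /eqP ->].
Qed.

Lemma clamped_bounds3 f1 f2 f3 : {within `[0, T], continuous f1} ->
  {within `[0, T], continuous f2} -> {within `[0, T], continuous f3} ->
  exists K : R, forall t : R, [/\ `|f1 (clamp T t)| <= K, `|f2 (clamp T t)| <= K &
    `|f3 (clamp T t)| <= K].
Proof.
move=> c1 c2 c3; have [K1 h1] := bounded_comp_clamp T0 c1.
have [K2 h2] := bounded_comp_clamp T0 c2; have [K3 h3] := bounded_comp_clamp T0 c3.
have K10 : 0 <= K1 := le_trans (normr_ge0 _) (h1 0).
have K20 : 0 <= K2 := le_trans (normr_ge0 _) (h2 0).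
have K30 : 0 <= K3 := le_trans (normr_ge0 _) (h3 0).
by exists (K1 + K2 + K3) => t; have := h1 t; have := h2 t; have := h3 t; split; lra.
Qed.

Lemma hamiltonian_flow al c k (Q : R) : 0 <= Q ->
  {within `[0, T], continuous al} -> {within `[0, T], continuous c} ->
  {within `[0, T], continuous k} ->
  (forall t : R, t \in `[0, T] -> 0 <= c t) -> (forall t : R, t \in `[0, T] -> 0 <= k t) ->
  exists u v : R -> R, [/\ u T = 1 /\ v T = Q,
    forall t : R, is_derive t 1 u (al (clamp T t) * u t - c (clamp T t) * v t),
    forall t : R, is_derive t 1 v (- (al (clamp T t) * v t) - k (clamp T t) * u t) &
    forall t, t <= T -> u t != 0].
Proof.
move=> Q0 cal cc ck c0 k0; have [K hK] := clamped_bounds3 cal cc ck.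
apply: (@riccati_system_exists _ (al \o clamp T) (c \o clamp T) (k \o clamp T) K) => //.
- exact: continuous_comp_clamp.
- exact: continuous_comp_clamp.
- exact: continuous_comp_clamp.
- by move=> t; apply: c0; exact: clamp_itv.
- by move=> t; apply: k0; exact: clamp_itv.
Qed.

(** Subtracting [p T] times (u, v) leaves a solution of the homogeneous equations with null terminal
    values: in the first component since [u T = 1], in the second by [q T = v T * p T]. Gronwall's
    lemma run backwards from T annihilates it. *)
Lemma hamiltonian_backward_unique al c k u v p q (s : R) : 0 <= s -> s <= T ->
  {within `[0, T], continuous al} -> {within `[0, T], continuous c} ->
  {within `[0, T], continuous k} ->
  (forall t : R, is_derive t 1 u (al (clamp T t) * u t - c (clamp T t) * v t)) ->
  (forall t : R, is_derive t 1 v (- (al (clamp T t) * v t) - k (clamp T t) * u t)) ->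
  u T = 1 -> bounded_measurable p -> bounded_measurable q ->
  (forall t : R, t \in `[s, T] -> p T =
    p t + \int[mu]_(r in `[t, T]) (al r * p r - c r * q r)) ->
  (forall t : R, t \in `[s, T] -> q T =
    q t + \int[mu]_(r in `[t, T]) (- (al r * q r) - k r * p r)) ->
  q T = v T * p T ->
  forall t : R, t \in `[s, T] -> p t = p T * u t /\ q t = p T * v t.
Proof.
move=> s0 sT cal cc ck du dv uT bp bq ep eq qT t ts.
have cu := is_derive_continuous du; have cv := is_derive_continuous dv.
have bc (f : R -> R) : {within `[0, T], continuous f} -> bounded_measurable f.
  exact: continuous_bounded_measurable.
have bu : bounded_measurable u by apply: bc; exact: continuous_subspaceT.
have bv : bounded_measurable v by apply: bc; exact: continuous_subspaceT.
have bal := bc _ cal; have bcc := bc _ cc; have bk := bc _ ck.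
pose e := p T.
have ge0s r : r \in `[s, T] -> 0 <= r /\ r <= T.
  by rewrite in_itv /= => /andP[sr ->]; rewrite (le_trans s0 sr).
have scaled (f F G : R -> R) r : r \in `[s, T] -> continuous F ->
    (forall x : R, is_derive x 1 f (F x)) -> (forall x, x \in `[0, T] -> F x = G x) ->
    e * f T = e * f r + \int[mu]_(x in `[r, T]) (e * G x).
  move=> /ge0s[r0 rT] cF dF FG.
  have -> : \int[mu]_(x in `[r, T]) (e * G x) = \int[mu]_(x in `[r, T]) (e * F x).
    apply: eq_Rintegral => x; rewrite inE /= in_itv /= => /andP[rx xT].
    by rewrite FG // in_itv /= xT (le_trans r0).
  rewrite RintegralZl //; last exact: continuous_integrable_itv.
  by rewrite (Rintegral_is_derive cF dF rT); ring.
have ccl (f : R -> R) : {within `[0, T], continuous f} -> continuous (fun t => f (clamp T t)).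
  exact: continuous_comp_clamp.
have cdu : continuous (fun t => al (clamp T t) * u t - c (clamp T t) * v t).
  by move=> x; apply: cvgB; apply: cvgM; [exact: ccl|exact: cu|exact: ccl|exact: cv].
have cdv : continuous (fun t => - (al (clamp T t) * v t) - k (clamp T t) * u t).
  by move=> x; apply: cvgB; [apply: cvgN|]; apply: cvgM; [exact: ccl|exact: cv|exact: ccl|exact: cu].
have bl (f g h j : R -> R) : bounded_measurable f -> bounded_measurable g ->
    bounded_measurable h -> bounded_measurable j ->
    bounded_measurable (fun t => f t * g t - h t * j t).
  by move=> *; apply: bounded_measurableD; [|apply: bounded_measurableN]; exact: bounded_measurableM.
have bl' (f g h j : R -> R) : bounded_measurable f -> bounded_measurable g ->
    bounded_measurable h -> bounded_measurable j ->
    bounded_measurable (fun t => - (f t * g t) - h t * j t).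
  by move=> *; apply: bounded_measurableD; apply: bounded_measurableN; exact: bounded_measurableM.
have be (f : R -> R) : bounded_measurable f -> bounded_measurable (fun t => e * f t).
  by move=> bf; apply: bounded_measurableM => //; exact: bounded_measurable_cst.
have [||||/eqP e1 /eqP e2] := @linear_backward_eq0 al c k (fun t => p t - e * u t) (fun t => q t - e * v t) s
    s0 sT bal bcc bk _ _ _ _ t ts.
- by apply: bounded_measurableD => //; apply: bounded_measurableN; exact: be.
- by apply: bounded_measurableD => //; apply: bounded_measurableN; exact: be.
- move=> r rs; have [r0 rT] := ge0s r rs.
  have [] := ge0s r rs => _ _.
  have h := scaled u _ (fun t => al t * u t - c t * v t) r rs cdu du.
  have {}h := h (fun x xT => ltac:(by rewrite clamp_id)).
  have := integral_equation_sub (bl _ _ _ _ bal bp bcc bq) (be _ (bl _ _ _ _ bal bu bcc bv)) r0 (ep r rs) h.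
  move=> /(_ (fun x => al x * (p x - e * u x) - c x * (q x - e * v x))) h2.
  have := h2 (fun x _ => ltac:(by ring)); rewrite uT /e => h3.
  by apply/eqP; rewrite -addr_eq0 -h3 mulr1 subrr.
- move=> r rs; have [r0 rT] := ge0s r rs.
  have h := scaled v _ (fun t => - (al t * v t) - k t * u t) r rs cdv dv.
  have {}h := h (fun x xT => ltac:(by rewrite clamp_id)).
  have := integral_equation_sub (bl' _ _ _ _ bal bq bk bp) (be _ (bl' _ _ _ _ bal bv bk bu)) r0 (eq r rs) h.
  move=> /(_ (fun x => - (al x * (q x - e * v x)) - k x * (p x - e * u x))) h2.
  have := h2 (fun x _ => ltac:(by ring)); rewrite qT /e => h3.
  by apply/eqP; rewrite -addr_eq0 -h3 mulrC subrr.
by move: e1 e2; rewrite !subr_eq0 => /eqP -> /eqP ->.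
Qed.

End bounded_coefficients.

(** * Stochastic differentials tested against random variables *)

Section stochastic_differential_test.
Context d (Omega : measurableType d) (R : realType).
Context (P : probability Omega R) (T : R) (W : R -> Omega -> R).
Hypothesis hW : wiener_process P T W.
Hypothesis T0 : 0 <= T.
Notation mu := (@lebesgue_measure R).
Implicit Types (X drift phi : R -> Omega -> R).

(** The bound [|zeta X| <= zeta^2 + X^2] has an expectation bounded uniformly in time through [C],
    which is the integrability that Fubini's theorem asks for on the bounded interval [s, t]. *)
Lemma product_fubini X (zeta : Omega -> R) (C s t : R) :
  jointly_measurable T X ->
  (forall r, r \in `[0, T] -> (mean_sqr P (X r) <= C%:E)%E) ->
  square_integrable P zeta -> 0 <= s -> t <= T ->
  [/\ mu.-integrable `[s, t] (EFin \o (fun r => \int[P]_w (zeta w * X r w))),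
    P.-integrable setT (EFin \o (fun w => \int[mu]_(r in `[s, t]) (zeta w * X r w))) &
    \int[P]_w \int[mu]_(r in `[s, t]) (zeta w * X r w) =
    \int[mu]_(r in `[s, t]) \int[P]_w (zeta w * X r w)].
Proof.
move=> mX XC zi s0 tT; have [mz iz] := zi.
have st_sub : [set` `[s, t]] `<=` [set` `[0, T]].
  by move=> r /=; rewrite !in_itv /= => /andP[h1 h2]; rewrite (le_trans s0) //= (le_trans h2).
have mD : measurable (`[s, t]%classic : set R) by [].
have mXst : measurable_fun (`[s, t] `*` setT) (fun p : R * Omega => X p.1 p.2).
  apply: measurable_funS mX; first exact: measurableX.
  by move=> p [p1 _]; split=> //; exact: st_sub.
have mzz : measurable_fun setT (fun p : R * Omega => zeta p.2).
  exact: (measurableT_comp mz measurable_snd).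
have mf : measurable_fun (`[s, t] `*` setT) (fun p : R * Omega => zeta p.2 * X p.1 p.2).
  by apply: measurable_funM => //; exact: measurable_funTS.
have XI r : `[s, t]%classic r -> square_integrable P (X r).
  move=> rst; apply: square_integrable_mean_sqr.
    apply: (measurable_slice2 _ _ mX) => //; exact: st_sub.
  by rewrite (le_lt_trans (XC r _)) ?ltry //; exact: st_sub.
have bnd r : `[s, t]%classic r ->
    (\int[P]_w `|zeta w * X r w|%:E <= (\int[P]_w (zeta w ^+ 2) + C)%:E)%E.
  move=> rst; have [mXr iXr] := XI r rst.
  have iD := integrable_EFinD measurableT iz iXr.
  have := XC r (st_sub r rst); rewrite -(EFin_mean_sqr (XI r rst)) lee_fin => hC.
  apply: (@le_trans _ _ (\int[P]_w (zeta w ^+ 2 + X r w ^+ 2)%:E)%E).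
    apply: ge0_le_integral_nonmeasurable => w _; rewrite lee_fin // normrM.
    have -> : zeta w ^+ 2 = `|zeta w| ^+ 2 by rewrite real_normK ?num_real.
    have -> : X r w ^+ 2 = `|X r w| ^+ 2 by rewrite real_normK ?num_real.
    have := sqr_ge0 (`|zeta w| - `|X r w|).
    have := normr_ge0 (zeta w); have := normr_ge0 (X r w); nra.
  by rewrite -EFin_Rintegral // RintegralD // lee_fin lerD2l.
have fin : (\int[P]_w \int[mu]_(r in `[s, t]) `|zeta w * X r w|%:E < +oo)%E.
  rewrite (@tonelli_on _ _ _ _ R mu P _ mD (fun p => `|zeta p.2 * X p.1 p.2|%:E)) //=; last first.
    by apply/measurable_EFinP; exact: measurableT_comp.
  apply: (@le_lt_trans _ _ (\int[mu]_(r in `[s, t]) (\int[P]_w (zeta w ^+ 2) + C)%:E)%E).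
    apply: ge0_le_integral_nonmeasurable => r; last exact: bnd.
    by move=> _; apply: integral_ge0 => w _; rewrite lee_fin.
  rewrite integral_cst //= lebesgue_measure_itv /=.
  by case: ifP => _; rewrite ?mule0 ?ltry // -EFinB -EFinM ltry.
split.
- exact: (@fubini_integrable_r _ _ _ _ R mu P _ mD (fun r w => zeta w * X r w) mf fin).
- exact: (@fubini_integrable_l _ _ _ _ R mu P _ mD (fun r w => zeta w * X r w) mf fin).
- exact: (@fubini_on _ _ _ _ R mu P _ mD (fun r w => zeta w * X r w) mf fin).
Qed.

(** In the mean of [zeta] times the pathwise equation between s and t, the increment of the Ito
    integral drops out by orthogonality, and with it [phi]. *)
Lemma stochastic_differential_test X drift phi (zeta : Omega -> R) (C s t : R) :
  stochastic_differential P T W X drift phi ->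
  jointly_measurable T drift ->
  (forall r, r \in `[0, T] -> (mean_sqr P (drift r) <= C%:E)%E) ->
  (forall r, r \in `[0, T] -> square_integrable P (X r)) ->
  0 <= s -> s <= t -> t <= T ->
  measurable_at P W s zeta -> square_integrable P zeta ->
  \int[P]_w (zeta w * X t w) = \int[P]_w (zeta w * X s w) +
  \int[mu]_(r in `[s, t]) \int[P]_w (zeta w * drift r w).
Proof.
move=> [I hI hX] mdrift bdrift XI s0 st tT mz zi.
have sT : s \in `[0, T] by rewrite in_itv /= s0 (le_trans st).
have tT' : t \in `[0, T] by rewrite in_itv /= tT (le_trans s0).
have [_ i1 <-] := product_fubini mdrift bdrift zi s0 tT.
have i2 := square_integrableM zi (XI s sT).
have iI r : r \in `[0, T] -> square_integrable P (I r).
  by move=> hr; exact: (ito_square_integrable hW hI hr).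
have i3 := square_integrableM zi (square_integrableB (iI t tT') (iI s sT)).
have e3 := ito_increment_orthogonal hW hI s0 st tT mz zi.
transitivity (\int[P]_w (zeta w * X s w +
    \int[mu]_(r in `[s, t]) (zeta w * drift r w) + zeta w * (I t w - I s w))); last first.
  by rewrite RintegralD ?RintegralD // ?e3 ?addr0 //; exact: integrable_EFinD.
congr fine; apply: ae_eq_integral => //.
- exact: (measurable_int P (square_integrableM zi (XI t tT'))).
- apply: (measurable_int P).
  by apply: integrable_EFinD => //; exact: integrable_EFinD.
apply: filterS hX => w [iw hw] _; congr (_%:E).
rewrite (hw t tT') (hw s sT).
rewrite (@Rintegral_itv_split _ _ 0 s t) //; last first.
  by apply: integrableS iw => //; apply: subset_itvl; rewrite bnd_simp.
rewrite (@RintegralZl _ _ _ mu) //; first by ring.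
apply: integrableS iw => //.
by move=> r /=; rewrite !in_itv /= => /andP[h1 h2]; rewrite (le_trans s0) //= (le_trans h2).
Qed.

End stochastic_differential_test.

Section linear_drift.
Context d (Omega : measurableType d) (R : realType).
Context (P : probability Omega R) (T : R) (W : R -> Omega -> R).
Hypothesis hW : wiener_process P T W.
Hypothesis T0 : 0 <= T.
Notation mu := (@lebesgue_measure R).
Implicit Types (X x y phi : R -> Omega -> R) (f g : R -> R).

Let bm := bounded_measurable T.

Lemma time_joint f : measurable_fun `[0, T] f ->
  jointly_measurable (Omega := Omega) T (fun t _ => f t).
Proof.
move=> mf; have mD : measurable (`[0, T]%classic : set R) by [].
have mfst : measurable_fun ((`[0, T]%classic : set R) `*` [set: Omega]) (fst : R * Omega -> R).
  by apply: measurable_funTS; exact: measurable_fst.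
apply: (measurable_comp mD _ mf mfst).
by move=> _ [[t w] [tT _] <-].
Qed.

Definition bounded_process x := jointly_measurable T x /\
  exists C : R, forall t, t \in `[0, T] -> (mean_sqr P (x t) <= C%:E)%E.

Lemma bounded_process_square_integrable x t : bounded_process x -> t \in `[0, T] ->
  square_integrable P (x t).
Proof.
move=> [mx [C xC]] tT; apply: square_integrable_mean_sqr.
  by apply: (measurable_slice2 _ _ mx).
by rewrite (le_lt_trans (xC t tT)) ?ltry.
Qed.

Lemma bounded_process_linear x y f1 f2 f3 : bounded_process x -> bounded_process y ->
  bm f1 -> bm f2 -> bm f3 ->
  bounded_process (fun t w => f1 t * x t w + f2 t * y t w + f3 t).
Proof.
move=> bx by_ [mf1 [K1 h1]] [mf2 [K2 h2]] [mf3 [K3 h3]].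
have [mx [C xC]] := bx; have [my [D yD]] := by_; split.
  apply: measurable_funD; last exact: time_joint.
  by apply: measurable_funD; apply: measurable_funM => //; exact: time_joint.
exists (3 * (K1 ^+ 2 * C + K2 ^+ 2 * D + K3 ^+ 2)) => t tT.
have xi := bounded_process_square_integrable bx tT.
have yi := bounded_process_square_integrable by_ tT.
have hx := xC t tT; rewrite -(EFin_mean_sqr xi) lee_fin in hx.
have hy := yD t tT; rewrite -(EFin_mean_sqr yi) lee_fin in hy.
have i1 := integrable_EFinZl measurableT (3 * K1 ^+ 2) xi.2.
have i2 := integrable_EFinZl measurableT (3 * K2 ^+ 2) yi.2.
have i12 := integrable_EFinD measurableT i1 i2.
have i3 : P.-integrable setT (EFin \o (fun _ => 3 * K3 ^+ 2)).
  exact: (finite_measure_integrable_cst P _ measurableT).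
have ii := integrable_EFinD measurableT i12 i3.
apply: (@le_trans _ _ (\int[P]_w (3 * K1 ^+ 2 * x t w ^+ 2 +
    3 * K2 ^+ 2 * y t w ^+ 2 + 3 * K3 ^+ 2)%:E)%E).
  apply: ge0_le_integral_nonmeasurable => w _; rewrite lee_fin ?sqr_ge0 //.
  have sq (K r : R) : `|r| <= K -> r ^+ 2 <= K ^+ 2.
    move=> rK; rewrite -(real_normK (num_real r)) lerXn2r ?nnegrE //.
    exact: le_trans (normr_ge0 _) rK.
  have a1 : (f1 t * x t w) ^+ 2 <= K1 ^+ 2 * x t w ^+ 2.
    by rewrite exprMn ler_wpM2r ?sqr_ge0 // sq // h1.
  have a2 : (f2 t * y t w) ^+ 2 <= K2 ^+ 2 * y t w ^+ 2.
    by rewrite exprMn ler_wpM2r ?sqr_ge0 // sq // h2.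
  have a3 : f3 t ^+ 2 <= K3 ^+ 2 by rewrite sq // h3.
  set p := f1 t * x t w in a1 *; set q := f2 t * y t w in a2 *; set r := f3 t in a3 *.
  apply: (@le_trans _ _ (3 * (p ^+ 2 + q ^+ 2 + r ^+ 2))); last by lra.
  have := sqr_ge0 (p - q); have := sqr_ge0 (q - r); have := sqr_ge0 (p - r); nra.
rewrite -EFin_Rintegral // lee_fin (RintegralD measurableT i12 i3).
rewrite (RintegralD measurableT i1 i2) (RintegralZl _ measurableT xi.2).
rewrite (RintegralZl _ measurableT yi.2).
have -> : \int[P]_(_ in setT) (3 * K3 ^+ 2) = 3 * K3 ^+ 2.
  by rewrite Rintegral_cst // [X in fine X]probability_setT mulr1.
have := ler_wpM2l (mulr_ge0 (ler0n R 3) (sqr_ge0 K1)) hx.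
have := ler_wpM2l (mulr_ge0 (ler0n R 3) (sqr_ge0 K2)) hy.
by lra.
Qed.

Lemma bounded_process_mean x zeta : bounded_process x -> square_integrable P zeta ->
  bm (fun t => \int[P]_w (zeta w * x t w)).
Proof.
move=> bx zi; have [mx [C xC]] := bx; split.
  have [h _ _] := product_fubini mx xC zi (lexx 0) (lexx T).
  by apply/measurable_EFinP; exact: (measurable_int mu).
exists (\int[P]_w (zeta w ^+ 2) + C) => t tT.
have xi := bounded_process_square_integrable bx tT.
rewrite (le_trans (Rintegral_mul_bound ltr01 zi xi)) // mul1r invr1 mul1r lerD2l.
by rewrite -lee_fin (EFin_mean_sqr xi) xC.
Qed.

Lemma linear_drift_test X x y f1 f2 f3 phi zeta s t :
  stochastic_differential P T W X
    (fun t w => f1 t * x t w + f2 t * y t w + f3 t) phi ->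
  bounded_process X -> bounded_process x -> bounded_process y ->
  bm f1 -> bm f2 -> bm f3 -> 0 <= s -> s <= t -> t <= T ->
  measurable_at P W s zeta -> square_integrable P zeta ->
  \int[P]_w (zeta w * X t w) = \int[P]_w (zeta w * X s w) +
  \int[mu]_(r in `[s, t]) (f1 r * \int[P]_w (zeta w * x r w) +
    f2 r * \int[P]_w (zeta w * y r w) + f3 r * \int[P]_w zeta w).
Proof.
move=> hX bX bx by_ bf1 bf2 bf3 s0 st tT mz zi.
have [mL [C LC]] := bounded_process_linear bx by_ bf1 bf2 bf3.
rewrite (stochastic_differential_test hW hX mL LC _ s0 st tT mz zi); last first.
  by move=> r rT; exact: bounded_process_square_integrable.
congr (_ + _); apply: eq_Rintegral => r; rewrite inE /= in_itv /= => /andP[sr rt].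
have rT : r \in `[0, T] by rewrite in_itv /= (le_trans s0) //= (le_trans rt).
have xi := bounded_process_square_integrable bx rT.
have yi := bounded_process_square_integrable by_ rT.
have zx := square_integrableM zi xi; have zy := square_integrableM zi yi.
have z1 := square_integrable1 zi.
rewrite -!RintegralZl // -RintegralD //; [|exact: integrable_EFinZl..].
rewrite -RintegralD //; [|by apply: integrable_EFinD => //; exact: integrable_EFinZl
  |exact: integrable_EFinZl].
by apply: eq_Rintegral => w _; ring.
Qed.

End linear_drift.

(** * Uniqueness *)

(** The null sets are collected over the rational times clamped to [0, T]. A difference of
    continuous paths that is nonzero at some time is nonzero on an open set of times, hence at a
    rational one. *)
Lemma ae_eq_continuous d (Omega : measurableType d) (R : realType)
    (P : probability Omega R) (T : R) (f g : R -> Omega -> R) : 0 <= T ->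
  {ae P, forall w, {within `[0, T], continuous (f ^~ w)}} ->
  {ae P, forall w, {within `[0, T], continuous (g ^~ w)}} ->
  (forall t : R, t \in `[0, T] -> {ae P, forall w, f t w = g t w}) ->
  {ae P, forall w, forall t : R, t \in `[0, T] -> f t w = g t w}.
Proof.
move=> T0 cf cg fg.
have : {ae P, forall w, forall n : nat,
    let t := clamp T (ratr (odflt 0 (unpickle n : option rat))) in f t w = g t w}.
  by apply: ae_foralln => n; exact/fg/clamp_itv.
move: cf cg; apply: filterS3 => w cf cg fgw t tT.
apply/eqP; rewrite -subr_eq0; apply: contraT => h0.
pose h x := f (clamp T x) w - g (clamp T x) w.
have ch : continuous h.
  move=> x; apply: continuousB.
    exact: (continuous_comp_clamp T0 cf).
  exact: (continuous_comp_clamp T0 cg).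
have oh : open [set x | h x != 0].
  apply: (@open_comp _ _ h [set x : R | x != 0]) => [x _|]; first exact: ch.
  exact: open_neq.
have [z [/= hr [r _ rE]]] : [set x | h x != 0] `&` range (ratr : rat -> R) !=set0.
  by apply: dense_rat => //; exists t; rewrite /= /h clamp_id.
have := fgw (pickle r); rewrite pickleK /= rE => e.
by move: hr; rewrite /h e subrr eqxx.
Qed.

Lemma mean_Rintegral d (Omega : measurableType d) (R : realType)
    (P : probability Omega R) (X : Omega -> R) : fine 'E_P[X] = \int[P]_w X w.
Proof. by rewrite unlock. Qed.

Section solution_differences.
Context d (Omega : measurableType d) (R : realType).
Context (P : probability Omega R) (T : R) (W : R -> Omega -> R).
Hypothesis hW : wiener_process P T W.
Hypothesis T0 : 0 < T.
Context (sigma : R) (a abar b beta m mbar n : R -> R) (q qbar x0 : R).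
Hypotheses (ca : {within `[0, T], continuous a})
  (cabar : {within `[0, T], continuous abar})
  (cb : {within `[0, T], continuous b}) (cbeta : {within `[0, T], continuous beta})
  (cm : {within `[0, T], continuous m}) (cmbar : {within `[0, T], continuous mbar})
  (cn : {within `[0, T], continuous n})
  (n_gt0 : forall t : R, t \in `[0, T] -> 0 < n t).
Notation mu := (@lebesgue_measure R).
Notation sol := (mkv_fbsde_solution P T W sigma a abar b beta m mbar n q qbar x0).
Notation bm := (bounded_measurable T).

Let c (t : R) : R := b t ^+ 2 / n t.
Let T0' : 0 <= T := ltW T0.
Let itv0 : (0 : R) \in `[0, T].
Proof. by rewrite in_itv /= lexx. Qed.
Let itvT : T \in `[0, T].
Proof. by rewrite in_itv /= lexx andbT. Qed.

Lemma within_continuousM (f g : R -> R) : {within `[0, T], continuous f} ->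
  {within `[0, T], continuous g} -> {within `[0, T], continuous (fun t => f t * g t)}.
Proof. by move=> cf cg t; apply: continuousM; [exact: cf|exact: cg]. Qed.

Lemma within_continuous_feedback : {within `[0, T], continuous c}.
Proof.
apply: within_continuousM; first by apply: within_continuousM.
apply/subspace_continuousP => t tT; apply: cvgV.
  by rewrite gt_eqF // n_gt0.
by move/subspace_continuousP : cn; exact.
Qed.

Let cc := within_continuous_feedback.

Lemma feedback_ge0 t : t \in `[0, T] -> 0 <= c t.
Proof. by move=> tT; rewrite divr_ge0 ?sqr_ge0 // ltW // n_gt0. Qed.

(** At each time the squares are below the integrand of [sol_integrable]. That integrand contains
    suprema over uncountably many times, whence the comparison by
    [ge0_le_integral_nonmeasurable]. *)
Lemma solution_bounded x y z : sol x y z -> bounded_process P T x /\ bounded_process P T y.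
Proof.
move=> hs; have := sol_integrable hs.
set F := fun w => (_ + _ + _)%E => Ffin.
have F0 w (t : R) : t \in `[0, T] -> ((x t w ^+ 2)%:E <= F w)%E /\ ((y t w ^+ 2)%:E <= F w)%E.
  move=> tT; pose A (X : R -> Omega -> R) :=
    ereal_sup [set (`|X r w| ^+ 2)%:E | r in [set` `[0, T]]].
  have h (X : R -> Omega -> R) r : r \in `[0, T] -> ((X r w ^+ 2)%:E <= A X)%E.
    move=> rT; apply: ereal_sup_ubound; exists r => //.
    by rewrite real_normK // num_real.
  have A0 X : (0 <= A X)%E by apply: le_trans (h X t tT); rewrite lee_fin sqr_ge0.
  have I0 : (0 <= \int[mu]_(t in `[0%R, T]) (`|z t w| ^+ 2)%:E)%E.
    by apply: integral_ge0 => r _; rewrite lee_fin sqr_ge0.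
  split; rewrite /F -/(A x) -/(A y).
    by rewrite -addeA (le_trans (h x t tT)) // leeDl // adde_ge0.
  by rewrite addeAC (le_trans (h y t tT)) // leeDr // adde_ge0.
have F00 w : (0 <= F w)%E.
  by have [h _] := F0 w 0 itv0; apply: le_trans h; rewrite lee_fin sqr_ge0.
have Ff : (\int[P]_w F w \is a fin_num)%E.
  by rewrite ge0_fin_numE //; exact: integral_ge0.
split; split.
- apply: (progressively_measurable_joint hW T0'); exact: sol_x_progressive hs.
- exists (fine (\int[P]_w F w)) => t tT; rewrite fineK //.
  apply: ge0_le_integral_nonmeasurable => w _; first by rewrite lee_fin sqr_ge0.
  by have [] := F0 w t tT.
- apply: (progressively_measurable_joint hW T0'); exact: sol_y_progressive hs.
exists (fine (\int[P]_w F w)) => t tT; rewrite fineK //.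
apply: ge0_le_integral_nonmeasurable => w _; first by rewrite lee_fin sqr_ge0.
by have [] := F0 w t tT.
Qed.

Lemma bounded_process_expectation x : bounded_process P T x ->
  bm (fun t => \int[P]_w x t w).
Proof.
move=> bx; have := bounded_process_mean bx (square_integrable_cst P 1).
congr (bounded_measurable T); apply/funext => t.
by apply: eq_Rintegral => w _; rewrite /= mul1r.
Qed.

(** The mean terms of the drifts are split off as sources proportional to [Z]. The coefficient
    [mbar (2 m + mbar)] gathers [m mbar] and [mbar (m + mbar)]; added to [m^2], it gives
    [(m + mbar)^2]. The terminal condition is treated likewise. *)
Lemma solution_linear_test x y z (s : R) zeta (t : R) : sol x y z -> 0 <= s ->
  measurable_at P W s zeta -> square_integrable P zeta -> t \in `[s, T] ->
  let phi (r : R) := \int[P]_w (zeta w * x r w) in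
  let psi (r : R) := \int[P]_w (zeta w * y r w) in
  let mx (r : R) := \int[P]_w x r w in let my (r : R) := \int[P]_w y r w in
  let Z := \int[P]_w zeta w in
  phi T = phi t + \int[mu]_(r in `[t, T])
    (a r * phi r - c r * psi r + (abar r * mx r + beta r) * Z) /\
  psi T = psi t + \int[mu]_(r in `[t, T])
    (- (a r * psi r) - m r ^+ 2 * phi r -
     (mbar r * (2 * m r + mbar r) * mx r + abar r * my r) * Z).
Proof.
move=> hs s0 mz zi tsT phi psi mx my Z.
have [st tT] : s <= t /\ t <= T by move: tsT; rewrite in_itv /= => /andP.
have [bx by_] := solution_bounded hs.
have bmx := bounded_process_expectation bx; have bmy := bounded_process_expectation by_.
have t0 := le_trans s0 st.
have cbm f : {within `[0, T], continuous f} -> bm f by exact: continuous_bounded_measurable.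
have mzt := measurable_at_le st mz.
have TT : T <= T by [].
split.
- have hf := sol_forward hs.
  have := @linear_drift_test _ _ _ _ _ _ hW x x y a (fun r => - c r)
    (fun r => abar r * mx r + beta r) (fun _ _ => sigma) zeta t T.
  move=> /(_ _ bx bx by_ (cbm _ ca) (bounded_measurableN (cbm _ cc)) _ t0 tT TT mzt zi).
  rewrite -/(phi T) -/(phi t) => ->.
  + congr (_ + _); apply: eq_Rintegral => r _; rewrite /phi /psi /mx /my /Z; ring.
  + move: hf; congr (stochastic_differential P T W x _ _).
    by apply/funext => r; apply/funext => w; rewrite mean_Rintegral /mx /c; ring.
  + by apply: bounded_measurableD; [apply: bounded_measurableM; [exact: cbm|]|exact: cbm].
- have hf := sol_backward hs.
  have := @linear_drift_test _ _ _ _ _ _ hW y x y (fun r => - (m r * m r)) (fun r => - a r)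
    (fun r => - (mbar r * (m r + m r + mbar r) * mx r + abar r * my r)) z zeta t T.
  move=> /(_ _ by_ bx by_ _ _ _ t0 tT TT mzt zi).
  rewrite -/(psi T) -/(psi t) => ->.
  + congr (_ + _); apply: eq_Rintegral => r _; rewrite /phi /psi /mx /my /Z; ring.
  + move: hf; congr (stochastic_differential P T W y _ _).
    apply/funext => r; apply/funext => w; rewrite !mean_Rintegral /mx /my; ring.
  + by apply: bounded_measurableN; apply: bounded_measurableM; exact: cbm.
  + by apply: bounded_measurableN; exact: cbm.
  + apply: bounded_measurableN; apply: bounded_measurableD; last first.
      by apply: bounded_measurableM => //; exact: cbm.
    apply: bounded_measurableM => //; apply: bounded_measurableM; first exact: cbm.
    by apply: bounded_measurableD; [apply: bounded_measurableD|]; exact: cbm.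
Qed.

Lemma solution_terminal_test x y z zeta : sol x y z -> square_integrable P zeta ->
  \int[P]_w (zeta w * y T w) = q ^+ 2 * \int[P]_w (zeta w * x T w) +
    qbar * (2 * q + qbar) * \int[P]_w x T w * \int[P]_w zeta w.
Proof.
move=> hs zi; have [bx by_] := solution_bounded hs.
pose mxT := \int[P]_w x T w; rewrite -/mxT.
have xi := bounded_process_square_integrable bx itvT.
have yi := bounded_process_square_integrable by_ itvT.
have i1 := integrable_EFinZl measurableT (q ^+ 2) (square_integrableM zi xi).
have i2 := integrable_EFinZl measurableT (qbar * (2 * q + qbar) * mxT) (square_integrable1 zi).
have -> : \int[P]_w (zeta w * y T w) = \int[P]_w (q ^+ 2 * (zeta w * x T w) +
    qbar * (2 * q + qbar) * mxT * zeta w).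
  congr fine; apply: ae_eq_integral => //.
  * exact: (measurable_int P (square_integrableM zi yi)).
  * exact: (measurable_int P (integrable_EFinD measurableT i1 i2)).
  apply: filterS (sol_terminal hs) => w e _; congr (_%:E).
  by rewrite e mean_Rintegral /mxT; ring.
rewrite RintegralD // RintegralZl //; last exact: square_integrableM.
by rewrite RintegralZl //; exact: square_integrable1.
Qed.

Let cbm (f : R -> R) : {within `[0, T], continuous f} -> bm f.
Proof. exact: continuous_bounded_measurable. Qed.

Let ba := cbm ca. Let babar := cbm cabar. Let bc := cbm cc. Let bbeta := cbm cbeta.
Let bm1 := cbm cm. Let bmbar := cbm cmbar.

Ltac solve_bounded_measurable := repeat (first [assumption | apply: bounded_measurableD |
  apply: bounded_measurableN | apply: bounded_measurableM | exact: bounded_measurable_cst]).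

Section two_solutions.
Variables x y z x' y' z' : R -> Omega -> R.
Hypotheses (hs : sol x y z) (hs' : sol x' y' z').

Lemma solution_difference_test (s : R) zeta : 0 <= s ->
  measurable_at P W s zeta -> square_integrable P zeta ->
  let phi (r : R) := \int[P]_w (zeta w * x r w) - \int[P]_w (zeta w * x' r w) in
  let psi (r : R) := \int[P]_w (zeta w * y r w) - \int[P]_w (zeta w * y' r w) in
  let mx (r : R) := \int[P]_w x r w - \int[P]_w x' r w in
  let my (r : R) := \int[P]_w y r w - \int[P]_w y' r w in
  let Z := \int[P]_w zeta w in
  [/\ bm phi, bm psi,
    forall t : R, t \in `[s, T] -> phi T = phi t + \int[mu]_(r in `[t, T])
      (a r * phi r - c r * psi r + abar r * mx r * Z),
    forall t : R, t \in `[s, T] -> psi T = psi t + \int[mu]_(r in `[t, T])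
      (- (a r * psi r) - m r ^+ 2 * phi r -
       (mbar r * (2 * m r + mbar r) * mx r + abar r * my r) * Z) &
    psi T = q ^+ 2 * phi T + qbar * (2 * q + qbar) * mx T * Z].
Proof.
move=> s0 mz zi phi psi mx my Z.
have [bx by_] := solution_bounded hs; have [bx' by'] := solution_bounded hs'.
have b1 := bounded_process_mean bx zi; have b2 := bounded_process_mean by_ zi.
have b1' := bounded_process_mean bx' zi; have b2' := bounded_process_mean by' zi.
have b3 := bounded_process_expectation bx; have b4 := bounded_process_expectation by_.
have b3' := bounded_process_expectation bx'; have b4' := bounded_process_expectation by'.
have t0 t : t \in `[s, T] -> 0 <= t by rewrite in_itv => /andP[/(le_trans s0)].
split; [rewrite /phi; solve_bounded_measurable|rewrite /psi; solve_bounded_measurable| | |].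
- move=> t ts; have [h _] := solution_linear_test hs s0 mz zi ts.
  have [h' _] := solution_linear_test hs' s0 mz zi ts.
  apply: (integral_equation_sub _ _ (t0 t ts) h h') => [||r _]; [by solve_bounded_measurable..|].
  by rewrite /phi /psi /mx /Z; ring.
- move=> t ts; have [_ h] := solution_linear_test hs s0 mz zi ts.
  have [_ h'] := solution_linear_test hs' s0 mz zi ts.
  apply: (integral_equation_sub _ _ (t0 t ts) h h') => [||r _]; [by solve_bounded_measurable..|].
  by rewrite /phi /psi /mx /my /Z; ring.
have := solution_terminal_test hs zi; have := solution_terminal_test hs' zi.
by rewrite /psi /phi /mx /Z => -> ->; ring.
Qed.

(** For [zeta = 1] the sources merge with the homogeneous terms, which puts the difference of the
    means on the flow (u, v) of [a + abar], [(m + mbar)^2] and [(q + qbar)^2]. Both solutions start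
    at [x0], so [phi T * u 0 = 0], and [u 0 != 0] gives [phi T = 0]. *)
Lemma solution_means_unique (t : R) : t \in `[0, T] ->
  \int[P]_w x t w = \int[P]_w x' t w /\ \int[P]_w y t w = \int[P]_w y' t w.
Proof.
move=> tT; have m1 : measurable_at P W 0 (cst 1) by exact: measurable_cst.
have e1 (X : R -> Omega -> R) r : \int[P]_w (cst 1 w * X r w) = \int[P]_w X r w.
  by apply: eq_Rintegral => w _; rewrite mul1r.
have Z1 : \int[P]_w (cst 1 w) = 1 :> R.
  by rewrite Rintegral_cst // [X in fine X]probability_setT mulr1.
have [] := solution_difference_test (lexx 0) m1 (square_integrable_cst P 1).
pose phi r := \int[P]_w x r w - \int[P]_w x' r w.
pose psi r := \int[P]_w y r w - \int[P]_w y' r w.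
have -> : (fun r => \int[P]_w (cst 1 w * x r w) - \int[P]_w (cst 1 w * x' r w)) = phi.
  by apply/funext => r; rewrite !e1.
have -> : (fun r => \int[P]_w (cst 1 w * y r w) - \int[P]_w (cst 1 w * y' r w)) = psi.
  by apply/funext => r; rewrite !e1.
rewrite !e1 Z1 -/(phi T) -/(psi T) => bphi bpsi ephi epsi eT.
pose al r := a r + abar r; pose k r := (m r + mbar r) * (m r + mbar r).
have cal : {within `[0, T], continuous al} by exact: within_continuousD.
have cmm : {within `[0, T], continuous (fun r => m r + mbar r)} by exact: within_continuousD.
have ck : {within `[0, T], continuous k} by exact: within_continuousM.
have k0 r : r \in `[0, T] -> 0 <= k r by move=> _; rewrite /k -expr2 sqr_ge0.
have [u [v [[uT vT] du dv u0]]] := hamiltonian_flow T0' (sqr_ge0 (q + qbar)) cal cc ck feedback_ge0 k0.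
have H (r : R) : r \in `[0, T] -> phi r = phi T * u r /\ psi r = phi T * v r.
  apply: (hamiltonian_backward_unique T0' (lexx 0) T0' cal cc ck du dv uT bphi bpsi).
  - move=> p pT; have := ephi p pT; rewrite !e1 -/(phi T) -/(phi p) => ->.
    congr (_ + _); apply: eq_Rintegral => o _.
    by rewrite /al /phi /psi !e1; ring.
  - move=> p pT; have := epsi p pT; rewrite !e1 -/(psi T) -/(psi p) => ->.
    congr (_ + _); apply: eq_Rintegral => o _.
    by rewrite /al /k /phi /psi !e1; ring.
  - by rewrite eT vT; ring.
have X0 X Y Z : sol X Y Z -> \int[P]_w X 0 w = x0.
  move=> hS; transitivity (\int[P]_w (cst x0 w)).
    congr fine; apply: ae_eq_integral => //.
    - apply: (measurable_int P); have [bX _] := solution_bounded hS.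
      exact: (square_integrable1 (bounded_process_square_integrable bX itv0)).
    - by apply/measurable_EFinP; exact: measurable_cst.
    by apply: filterS (sol_initial hS) => w -> _.
  by rewrite Rintegral_cst // [X in fine X]probability_setT mulr1.
have phiT : phi T = 0.
  have [/eqP] := H 0 itv0.
  rewrite {1}/phi (X0 _ _ _ hs) (X0 _ _ _ hs') subrr eq_sym mulf_eq0.
  by rewrite (negbTE (u0 0 T0')) orbF => /eqP.
have [/eqP + /eqP] := H t tT; rewrite phiT !mul0r !subr_eq0.
by move=> /eqP -> /eqP ->.
Qed.

Lemma solution_difference_feedback : exists2 eta : R -> R,
  {within `[0, T], continuous eta} &
  {ae P, forall w, forall t, t \in `[0, T] ->
    y t w - y' t w = eta t * (x t w - x' t w)}.
Proof.
have [bx by_] := solution_bounded hs; have [bx' by'] := solution_bounded hs'.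
pose k r := m r * m r.
have ck : {within `[0, T], continuous k} by exact: within_continuousM.
have k0 t : t \in `[0, T] -> 0 <= k t by move=> _; rewrite /k -expr2 sqr_ge0.
have [u [v [[uT vT] du dv u0]]] := hamiltonian_flow T0' (sqr_ge0 q) ca cc ck feedback_ge0 k0.
have u0' t : t \in `[0, T] -> u t != 0 by rewrite in_itv => /andP[_ /u0].
have ceta : {within `[0, T], continuous (fun t => v t / u t)}.
  apply/subspace_continuousP => t tT; apply: cvgM.
    by apply: cvg_within_filter; exact: (is_derive_continuous dv).
  apply: cvgV; first exact: u0'.
  by apply: cvg_within_filter; exact: (is_derive_continuous du).
exists (fun t => v t / u t) => //.
have fixed s : s \in `[0, T] -> {ae P, forall w,
    y s w - y' s w = v s / u s * (x s w - x' s w)}.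
  move=> sT; have [s0 sT'] : 0 <= s /\ s <= T by move: sT; rewrite in_itv => /andP.
  have sub t r : t \in `[s, T] -> r \in `[t, T] -> r \in `[0, T].
    by rewrite !in_itv /= => /andP[st _] /andP[tr ->]; rewrite (le_trans s0 (le_trans st tr)).
  have xi := bounded_process_square_integrable bx sT.
  have xi' := bounded_process_square_integrable bx' sT.
  have yi := bounded_process_square_integrable by_ sT.
  have yi' := bounded_process_square_integrable by' sT.
  (* The test variable is the quantity to be shown null. *)
  pose zeta w := u s * (y s w - y' s w) - v s * (x s w - x' s w).
  have zi : square_integrable P zeta.
    by apply: square_integrableB; apply: square_integrableZ; exact: square_integrableB.
  have mz : measurable_at P W s zeta.
    have mx := progressively_measurable_at sT (sol_x_progressive hs).
    have my := progressively_measurable_at sT (sol_y_progressive hs).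
    have mx' := progressively_measurable_at sT (sol_x_progressive hs').
    have my' := progressively_measurable_at sT (sol_y_progressive hs').
    by apply: measurable_funB; apply: measurable_funM => //; exact: measurable_funB.
  have [] := solution_difference_test s0 mz zi.
  set phi := (fun r : R => \int[P]_w (zeta w * x r w) - _).
  set psi := (fun r : R => \int[P]_w (zeta w * y r w) - _).
  move=> bphi bpsi ephi epsi eT.
  have ssT : s \in `[s, T] by rewrite in_itv /= sT' lexx.
  have [phis psis] : phi s = phi T * u s /\ psi s = phi T * v s.
    apply: (hamiltonian_backward_unique T0' s0 sT' ca cc ck du dv uT bphi bpsi _ _ _ ssT).
    - move=> t ts; have := ephi t ts; rewrite -/(phi T) -/(phi t) => ->.
      congr (_ + _); apply: eq_Rintegral => r.
      by rewrite inE => /(sub t r ts) /solution_means_unique [-> _]; rewrite /phi /psi; ring.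
    - move=> t ts; have := epsi t ts; rewrite -/(psi T) -/(psi t) => ->.
      congr (_ + _); apply: eq_Rintegral => r.
      by rewrite inE => /(sub t r ts) /solution_means_unique [-> ->]; rewrite /k /phi /psi; ring.
    - by have [e _] := solution_means_unique itvT; rewrite /phi /psi eT vT e; ring.
  have i1 := square_integrableM zi xi; have i2 := square_integrableM zi xi'.
  have i3 := square_integrableM zi yi; have i4 := square_integrableM zi yi'.
  (* By the choice of [zeta], this is [u_s psi_s - v_s phi_s], that is,
     [phi T (u_s v_s - v_s u_s)]. *)
  have z0 : \int[P]_w (zeta w ^+ 2) = 0.
    have j1 := integrable_EFinB measurableT i1 i2.
    have j2 := integrable_EFinB measurableT i3 i4.
    transitivity (\int[P]_w (u s * (zeta w * y s w - zeta w * y' s w) -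
        v s * (zeta w * x s w - zeta w * x' s w))).
      by apply: eq_Rintegral => w _; rewrite /zeta; ring.
    rewrite RintegralB //; [|exact: integrable_EFinZl..].
    rewrite !RintegralZl // !RintegralB // -/(phi s) -/(psi s) phis psis; ring.
  have mzeta : measurable_fun setT zeta by case: zi.
  have : mean_sqr P zeta = 0%E by rewrite -EFin_mean_sqr // z0.
  move=> /(mean_sqr_eq0 mzeta); apply: filterS => w /eqP; rewrite subr_eq0 => /eqP e.
  by apply: (mulfI (u0' s sT)); rewrite e; field; exact: u0'.
have cY w : {within `[0, T], continuous (fun t => y t w - y' t w)}.
  by move=> t; apply: cvgB; [exact: (sol_y_continuous hs)|exact: (sol_y_continuous hs')].
have cX w : {within `[0, T], continuous (fun t => x t w - x' t w)}.
  by move=> t; apply: cvgB; [exact: (sol_x_continuous hs)|exact: (sol_x_continuous hs')].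
apply: (@ae_eq_continuous _ _ _ P T (fun t w => y t w - y' t w)
  (fun t w => v t / u t * (x t w - x' t w)) T0') => //; apply: aeW => w //.
exact: within_continuousM.
Qed.

End two_solutions.

Lemma linear_volterra_eq0 (g f : R -> R) : {within `[0, T], continuous g} ->
  {within `[0, T], continuous f} ->
  (forall t, t \in `[0, T] -> f t = \int[mu]_(r in `[0, t]) (g r * f r)) ->
  forall t, t \in `[0, T] -> f t = 0.
Proof.
move=> cg cf ef; have [K hK] := within_continuous_bound T0' cg.
have [M hM] := within_continuous_bound T0' cf.
have cnf : {within `[0, T], continuous (fun r => `|f r|)}.
  by move=> t; apply: cvg_norm; exact: cf.
have cgf : {within `[0, T], continuous (fun r => `|g r * f r|)}.
  by move=> t; apply: cvg_norm; exact: (within_continuousM cg cf).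
have K0 : 0 <= K := le_trans (normr_ge0 _) (hK 0 itv0).
suff H t : t \in `[0, T] -> `|f t| = 0 by move=> t /H /normr0_eq0.
move=> tT; apply: (@gronwall_forward _ (fun r => `|f r|) K M 0 T) tT => //.
- by have [] := cbm cnf.
- by move=> r rT; rewrite normr_ge0 hM.
move=> r rT; have rT' : r <= T by move: rT; rewrite in_itv => /andP[].
have i1 := bounded_measurable_integrable (bounded_measurableM (cbm cg) (cbm cf)) (lexx 0) rT'.
have i2 := bounded_measurable_integrable (cbm cnf) (lexx 0) rT'.
rewrite {1}(ef r rT) (le_trans (le_normr_Rintegral _ i1)) //.
rewrite -RintegralZl //; apply: le_Rintegral => //.
- exact: (bounded_measurable_integrable (cbm cgf) (lexx 0) rT').
- exact: integrable_EFinZl.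
- move=> p /= pr; rewrite normrM ler_wpM2r // hK //.
  by move: pr; rewrite !in_itv /= => /andP[-> /le_trans ->].
Qed.

Lemma solution_unique x y z x' y' z' : sol x y z -> sol x' y' z' ->
  same_solution P T x y z x' y' z'.
Proof.
move=> hs hs'; have means := solution_means_unique hs hs'.
have [eta ceta hY] := solution_difference_feedback hs hs'.
have [I hI hx] := sol_forward hs; have [I' hI' hx'] := sol_forward hs'.
have [J hJ hy] := sol_backward hs; have [J' hJ' hy'] := sol_backward hs'.
(* Both are continuous versions of the integral of the constant [sigma], hence equal at all times
   off a single null set; the noise then cancels in the difference of the forward equations. *)
have II' := ae_eq_continuous T0' (ito_continuous hI) (ito_continuous hI')
  (ito_integral_unique hW T0' hI hI').
have cg : {within `[0, T], continuous (fun r => a r - c r * eta r)}.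
  by move=> t; apply: cvgB; [exact: ca|exact: (within_continuousM cc ceta)].
have sub t : t \in `[0, T] -> [set` `[0, t]] `<=` [set` `[0, T]].
  by rewrite in_itv /= => /andP[_ tT]; apply: subset_itvl; rewrite bnd_simp.
have xx' : {ae P, forall w, forall t, t \in `[0, T] -> x t w = x' t w}.
  have h0 : {ae P, forall w, x 0 w = x' 0 w}.
    by move: (sol_initial hs) (sol_initial hs'); apply: filterS2 => w -> ->.
  have h1 : {ae P, forall w, x 0 w = x' 0 w /\ forall t, t \in `[0, T] -> I t w = I' t w}.
    by move: h0 II'; apply: filterS2.
  have h2 : {ae P, forall w, (x 0 w = x' 0 w /\ forall t, t \in `[0, T] -> I t w = I' t w) /\
      forall t, t \in `[0, T] -> y t w - y' t w = eta t * (x t w - x' t w)}.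
    by move: h1 hY; apply: filterS2.
  move: h2 hx hx'; apply: filterS3 => w [[e0 eI] eY] [i1 ex] [i2 ex'].
  suff H t : t \in `[0, T] -> x t w - x' t w = 0.
    by move=> t /H /eqP; rewrite subr_eq0 => /eqP.
  move=> tT; apply: (@linear_volterra_eq0 _ (fun t => x t w - x' t w) cg) tT.
    by move=> r; apply: cvgB; [exact: (sol_x_continuous hs)|exact: (sol_x_continuous hs')].
  move=> {}t tT; rewrite (ex t tT) (ex' t tT) e0 (eI t tT).
  transitivity (\int[mu]_(s in `[0, t])
      (a s * x s w + abar s * fine 'E_P[(x s)] - b s ^+ 2 / n s * y s w + beta s) -
    \int[mu]_(s in `[0, t])
      (a s * x' s w + abar s * fine 'E_P[(x' s)] - b s ^+ 2 / n s * y' s w + beta s)).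
    by ring.
  rewrite -(@RintegralB _ _ _ mu) //; [|by apply: integrableS i1 => //; exact: sub
    |by apply: integrableS i2 => //; exact: sub].
  apply: eq_Rintegral => r; rewrite inE => /(sub _ tT) rT.
  have [mx _] := means r rT; rewrite !mean_Rintegral mx.
  transitivity (a r * (x r w - x' r w) - c r * (y r w - y' r w)); first by rewrite /c; ring.
  by rewrite (eY r rT); ring.
have yy' : {ae P, forall w, forall t, t \in `[0, T] -> y t w = y' t w}.
  move: xx' hY; apply: filterS2 => w ex ey t tT.
  by apply/eqP; rewrite -subr_eq0 ey // ex // subrr mulr0.
split=> //; apply: (ito_integrand_unique hW T0' hJ hJ').
(* Once x, y and the means are identified, the two backward equations have the same drift, which
   leaves [J T = J' T]. *)
have xy : {ae P, forall w, forall t, t \in `[0, T] -> x t w = x' t w /\ y t w = y' t w}.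
  by move: xx' yy'; apply: filterS2 => w h1 h2 t tT; rewrite h1 // h2.
move: xy hy hy'; apply: filterS3 => w exy [_ ey] [_ ey'].
have := ey T itvT; have [_ ->] := exy T itvT; have [_ ->] := exy 0 itv0.
rewrite (ey' T itvT).
have -> : \int[mu]_(s in `[0, T])
     (- (a s * y s w + m s * (m s * x s w + mbar s * fine 'E_P[(x s)])) -
      (abar s * fine 'E_P[(y s)] + mbar s * (m s + mbar s) * fine 'E_P[(x s)])) =
  \int[mu]_(s in `[0, T])
     (- (a s * y' s w + m s * (m s * x' s w + mbar s * fine 'E_P[(x' s)])) -
      (abar s * fine 'E_P[(y' s)] + mbar s * (m s + mbar s) * fine 'E_P[(x' s)])).
  apply: eq_Rintegral => r; rewrite inE => rT.
  by rewrite !mean_Rintegral; have [-> ->] := means r rT; have [-> ->] := exy r rT.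
by move=> /addrI.
Qed.

End solution_differences.

(** * Doob's inequality and a continuous version of the Wiener process *)

Lemma uniformly_continuous_itv (R : realType) (f : R -> R) (A B : R) : continuous f ->
  forall e : R, 0 < e -> exists2 r : R, 0 < r &
    forall s t : R, s \in `[A, B] -> `|s - t| < r -> `|f s - f t| < e.
Proof.
move=> cf e e0.
have /compact_near_coveringP := @segment_compact R A B.
move=> /(_ _ (0^'+ : set_system R) (fun (r s : R) => forall t : R, `|s - t| < r -> `|f s - f t| < e)).
have e2 : 0 < e / 2 by rewrite divr_gt0.
case=> [s _|d /= d0 hd].
  have /cvgrPdist_lt /(_ _ e2) [r /= r0 hr] := cf s.
  have r2 : 0 < r / 2 by rewrite divr_gt0.
  exists (ball s (r / 2), [set x : R | x < r / 2]) => /=.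
    by split; [exact: nbhsx_ballx|exact: nbhs_right_lt].
  move=> [x y] /= [sx yr] t xt.
  have {}sx : `|s - x| < r / 2 by [].
  have fx : `|f s - f x| < e / 2 by apply: hr => /=; lra.
  have ft : `|f s - f t| < e / 2.
    by apply: hr => /=; have := ler_distD x s t; lra.
  by have := ler_distD (f s) (f x) (f t); rewrite (distrC (f x) (f s)); lra.
exists (d / 2); first by rewrite divr_gt0.
move=> s t sAB st; apply: (hd (d / 2)) => //=; last by rewrite divr_gt0.
by rewrite sub0r normrN gtr0_norm ?divr_gt0 // ltr_pdivrMr // mulr_natr mulr2n ltrDl.
Qed.

Lemma grid_cvg (R : realType) (h : nat -> R) (t : R) : 0 <= t ->
  (forall k, 0 < h k) -> (fun k => (h k)^-1) @ \oo --> (0 : R) ->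
  (fun k => (Num.truncn (t * h k))%:R / h k) @ \oo --> t.
Proof.
move=> t0 h0 hV; pose u k := t - (h k)^-1.
have ut : u @ \oo --> t by rewrite -[X in _ --> X]subr0; apply: cvgB => //; exact: cvg_cst.
apply: (squeeze_cvgr _ ut (cvg_cst t)); apply: nearW => k.
have /andP[h1 h2] := truncn_itv (mulr_ge0 t0 (ltW (h0 k))).
rewrite ler_pdivrMr // h1 andbT /u ler_pdivlMr // mulrBl mulVf ?gt_eqF //.
by rewrite lerBlDr natr1 ltW.
Qed.

Section running_maximum.
Context {R : realType}.
Implicit Types s : nat -> R.

(** Starting from [max 0 (s 0)] keeps it nonnegative. Applied to a sequence and to its opposite, it
    controls the supremum of the squares. *)
Fixpoint running_max s n : R :=
  if n is k.+1 then Num.max (running_max s k) (s k.+1) else Num.max 0 (s 0%N).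

Lemma running_max_ge0 s n : 0 <= running_max s n.
Proof. by elim: n => [|n IHn] /=; rewrite le_max ?lexx ?IHn. Qed.

Lemma running_max_ge s n i : (i <= n)%N -> s i <= running_max s n.
Proof.
elim: n => [|n IHn] /=; first by rewrite leqn0 => /eqP ->; rewrite le_max lexx orbT.
by rewrite leq_eqVlt => /predU1P[->|/IHn h]; rewrite le_max ?lexx ?orbT // h.
Qed.

Lemma running_max_le s n (B : R) : 0 <= B -> (forall i, (i <= n)%N -> s i <= B) ->
  running_max s n <= B.
Proof.
move=> B0; elim: n => [|n IHn] sB /=; first by rewrite ge_max B0 sB.
by rewrite ge_max sB // IHn // => i ni; rewrite sB // ltnW.
Qed.

(* A discrete Doob inequality holding for every sequence: its last term is a
   martingale transform when [s] is a martingale. *)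
Lemma doob_pathwise s n : running_max s n ^+ 2 <=
  4 * s n ^+ 2 - 4 * \sum_(i < n) running_max s i * (s i.+1 - s i).
Proof.
(* This stronger form is the one that passes through the induction. Doubled, and combined with
   [(M - 2 s)^2 >= 0] for the last terms M and s, it gives the bound. *)
suff : running_max s n ^+ 2 + 2 * \sum_(i < n) running_max s i * (s i.+1 - s i) <=
    2 * (running_max s n * s n).
  have := sqr_ge0 (running_max s n - 2 * s n); nra.
elim: n => [|n IHn] /=.
  rewrite big_ord0 mulr0 addr0.
  by case: (leP 0 (s 0%N)) => h; nra.
rewrite big_ord_recr /=.
set m := running_max s n in IHn *; set S := \sum_(i < n) _ in IHn *.
case: (leP m (s n.+1)) => h.
  have := sqr_ge0 (s n.+1 - m); nra.
nra.
Qed.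

End running_maximum.

Section wiener_maximum.
Context d (Omega : measurableType d) (R : realType).
Context (P : probability Omega R) (T : R) (W : R -> Omega -> R).
Hypothesis hW : wiener_process P T W.
Notation mu := (@lebesgue_measure R).

Lemma wiener_square_integrable (t : R) : t \in `[0, T] -> square_integrable P (W t).
Proof.
move=> tT; have [t0 tT'] : 0 <= t /\ t <= T by move: tT; rewrite in_itv => /andP.
have [mD iD] := increment_square_integrable hW (lexx 0) t0 tT'.
have mW := wiener_measurable hW tT.
apply: square_integrable_mean_sqr => //.
have := integrable_lty measurableT iD; congr (_ < +oo)%E.
apply: ae_eq_integral => //.
- by apply/measurable_EFinP; exact: measurable_funX.
- by apply/measurable_EFinP; exact: measurable_funX.
by apply: filterS (wiener_start hW) => w W0 _ /=; rewrite W0 subr0.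
Qed.

Lemma wiener_variance (t : R) : t \in `[0, T] -> \int[P]_w (W t w ^+ 2) = t.
Proof.
move=> tT; have [t0 tT'] : 0 <= t /\ t <= T by move: tT; rewrite in_itv => /andP.
have [mD iD] := increment_square_integrable hW (lexx 0) t0 tT'.
have [mW iW] := wiener_square_integrable tT.
transitivity (\int[P]_w ((W t w - W 0 w) ^+ 2)).
  congr fine; apply: ae_eq_integral => //.
  - exact: (measurable_int P iW).
  - exact: (measurable_int P iD).
  by apply: filterS (wiener_start hW) => w W0 _ /=; rewrite W0 subr0.
by rewrite (increment_variance hW) // subr0.
Qed.

Section grid.
Context (t : nat -> R) (n : nat) (eps : R).
Hypothesis t_itv : forall i, (i <= n)%N -> t i \in `[0, T].
Hypothesis t_le : forall i, (i < n)%N -> t i <= t i.+1.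

Let s w i := eps * W (t i) w.

Lemma running_max_square_integrable i : (i <= n)%N ->
  square_integrable P (fun w => running_max (s w) i).
Proof.
have hs j : (j <= n)%N -> square_integrable P (fun w => s w j).
  by move=> nj; apply: square_integrableZ; exact: (wiener_square_integrable (t_itv nj)).
have habs f : square_integrable P f -> square_integrable P (fun w => `|f w|).
  move=> [mf fi]; split; first exact: measurableT_comp.
  by move: fi; apply: eq_integrable => // w _ /=; rewrite real_normK // num_real.
have maxle (x y : R) : `|Num.max x y| <= `|x| + `|y|.
  by have := normr_ge0 x; have := normr_ge0 y; case: (leP x y) => _; lra.
elim: i => [|i IHi] ni.
  have [mf _] := hs 0%N ni; apply: square_integrable_le (habs _ (hs 0%N ni)).
    by apply: measurable_maxr => //; exact: measurable_cst.
  by move=> w /=; rewrite (le_trans (maxle _ _)) // normr0 add0r.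
have [mf _] := hs _ ni; have fi := IHi (ltnW ni); have [mm _] := fi.
apply: square_integrable_le (square_integrableD (habs _ fi) (habs _ (hs _ ni))).
  exact: measurable_maxr.
by move=> w /=; exact: maxle.
Qed.

Lemma running_max_adapted i : (i <= n)%N ->
  measurable_at P W (t i) (fun w => running_max (s w) i).
Proof.
elim: i => [|i IHi] ni.
  apply: measurable_maxr; first exact: measurable_cst.
  apply: measurable_funM; first exact: measurable_cst.
  by apply: measurable_at_wiener; have := t_itv ni; rewrite !in_itv /= lexx => /andP[->].
apply: measurable_maxr; first by apply: (measurable_at_le (t_le ni)); exact: (IHi (ltnW ni)).
apply: measurable_funM; first exact: measurable_cst.
by apply: measurable_at_wiener; have := t_itv ni; rewrite !in_itv /= lexx => /andP[->].
Qed.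

(** In the mean of [doob_pathwise] the sum vanishes, since the running maximum up to [t i] is known
    at time [t i]. The factor [eps] will be 1 or -1, to reach both signs of [W]. *)
Lemma doob_inequality : \int[P]_w (running_max (s w) n ^+ 2) <= 4 * eps ^+ 2 * t n.
Proof.
have tn := t_itv (leqnn n).
have tT i : (i <= n)%N -> 0 <= t i /\ t i <= T.
  by move=> /t_itv; rewrite in_itv => /andP.
have [_ iM] := running_max_square_integrable (leqnn n).
have [_ iW] := wiener_square_integrable tn.
have Di (i : 'I_n) : P.-integrable setT (EFin \o (fun w => running_max (s w) i * (s w i.+1 - s w i))) /\
    \int[P]_w (running_max (s w) i * (s w i.+1 - s w i)) = 0.
  have ni := ltn_ord i.
  have [t0 _] := tT i (ltnW ni); have [_ t1] := tT _ ni.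
  have mz : measurable_at P W (t i) (fun w => eps * running_max (s w) i).
    by apply: measurable_funM; [exact: measurable_cst|exact: (running_max_adapted (ltnW ni))].
  have iz : P.-integrable setT (EFin \o (fun w => eps * running_max (s w) i)).
    apply: integrable_EFinZl => //; apply: square_integrable1.
    exact: (running_max_square_integrable (ltnW ni)).
  have [] := integral_mul_increment hW t0 (t_le ni) t1 mz iz.
  have -> : (fun w => eps * running_max (s w) i * (W (t i.+1) w - W (t i) w)) =
      (fun w => running_max (s w) i * (s w i.+1 - s w i)).
    by apply/funext => w; rewrite /s; ring.
  by [].
have i1 := integrable_EFinZl measurableT (4 * eps ^+ 2) iW.
have i2 := integrable_EFin_sum measurableT (index_enum _) (fun i : 'I_n => (Di i).1).
have i3 := integrable_EFinZl measurableT 4 i2.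
apply: (@le_trans _ _ (\int[P]_w (4 * eps ^+ 2 * W (t n) w ^+ 2 -
    4 * \sum_(i < n) running_max (s w) i * (s w i.+1 - s w i)))).
  apply: le_Rintegral => //; first exact: integrable_EFinB.
  move=> w _; apply: le_trans (doob_pathwise _ _) _.
  by rewrite /s exprMn mulrA.
rewrite RintegralB // RintegralZl // wiener_variance // RintegralZl // Rintegral_sum //.
  by rewrite big1 ?mulr0 ?subr0 // => i _; rewrite (Di i).2.
by move=> i; exact: (Di i).1.
Qed.

End grid.

(* [V] has all its paths continuous and [g] dominates the square of its
   supremum. *)
Record wiener_version (V : R -> Omega -> R) (g : Omega -> R) : Prop := WienerVersion {
  version_continuous : forall w, continuous (V^~ w);
  version_start : forall w, V 0 w = 0;
  version_ae : {ae P, forall w, forall t : R, t \in `[0, T] -> V t w = W t w};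
  version_adapted : forall t : R, t \in `[0, T] -> measurable_at P W t (V t);
  version_bound : forall (t : R) w, t \in `[0, T] -> V t w ^+ 2 <= g w;
  version_bound_integrable : P.-integrable setT (EFin \o g)
}.

(** The paths are set to 0 on a null event containing the irregular ones and frozen outside [0, T];
    adaptedness survives because every [F_t] contains the null events. The function [g] is the limit
    of the squared maxima over dyadic grids, integrable by Doob's inequality and monotone
    convergence, and it dominates at all times by continuity. *)
Lemma wiener_version_exists : 0 < T -> exists V g, wiener_version V g.
Proof.
move=> T0; have T0' := ltW T0.
have [N [mN N0 hN]] : {ae P, forall w, W 0 w = 0 /\ {within `[0, T], continuous (W^~ w)}}.
  by move: (wiener_start hW) (wiener_continuous hW); apply: filterS2.
have {}hN w : ~ N w -> W 0 w = 0 /\ {within `[0, T], continuous (W^~ w)}.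
  by move=> Nw; apply: contrapT => /hN.
pose V t w := \1_(~` N) w * W (clamp T t) w.
have VN w t : N w -> V t w = 0 by move=> Nw; rewrite /V indicE memNset ?mul0r //= => /(_ Nw).
have VW w t : ~ N w -> V t w = W (clamp T t) w.
  by move=> Nw; rewrite /V indicE mem_set ?mul1r.
have cV w : continuous (V^~ w).
  have [Nw|Nw] := pselect (N w).
    have -> : V^~ w = fun _ => 0 by apply/funext => t; rewrite VN.
    by move=> t; exact: cvg_cst.
  have -> : V^~ w = (W^~ w) \o clamp T by apply/funext => t; rewrite VW.
  by have [_ cw] := hN w Nw; exact: continuous_comp_clamp.
have aeV : {ae P, forall w, forall t : R, t \in `[0, T] -> V t w = W t w}.
  exists N; split=> // w /= h; apply: contrapT => Nw; apply: h => t tT.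
  by rewrite VW // clamp_id.
have adV t : t \in `[0, T] -> measurable_at P W t (V t).
  move=> tT; have tT' : t <= T by move: tT; rewrite in_itv => /andP[].
  refine (@measurable_at_ae_eq _ _ _ P T W t (W t) (V t) tT' _ _ _).
  - apply: measurable_funM; first by apply: measurable_indic; exact: measurableC.
    by rewrite clamp_id //; exact: (wiener_measurable hW tT).
  - by apply: measurable_at_wiener; move: tT; rewrite !in_itv /= lexx andbT => /andP[].
  by apply: filterS aeV => w ->.
(* The dyadic point [i T / 2^n], written in the form of [grid_cvg]. *)
pose tt n i : R := i%:R / (2 ^+ n / T).
have p2 n : 0 < 2 ^+ n / T :> R by rewrite divr_gt0 // exprn_gt0.
have tt_itv n i : (i <= 2 ^ n)%N -> tt n i \in `[0, T].
  move=> ni; rewrite in_itv /= /tt divr_ge0 ?(ltW (p2 n)) //= ler_pdivrMr //.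
  by rewrite mulrCA mulfV ?gt_eqF // mulr1 -natrX ler_nat.
have tt_le n i : tt n i <= tt n i.+1 by rewrite /tt ler_pM2r ?invr_gt0 // ler_nat.
pose rm eps n w := running_max (fun i => eps * W (tt n i) w) (2 ^ n).
pose mn n w := rm 1 n w ^+ 2 + rm (-1) n w ^+ 2.
pose G w := ereal_sup (range (fun n => (mn n w)%:E)).
have mn0 n w : 0 <= mn n w by rewrite addr_ge0 // sqr_ge0.
have rm_le eps n w : rm eps n w <= rm eps n.+1 w.
  apply: running_max_le => [|i ni]; first exact: running_max_ge0.
  have -> : tt n i = tt n.+1 (2 * i)%N.
    by rewrite /tt natrM exprS; field; rewrite !gt_eqF // exprn_gt0.
  apply: (@running_max_ge _ (fun i => eps * W (tt n.+1 i) w)).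
  by rewrite expnS leq_mul2l ni.
have mn_le w : {homo (fun n => (mn n w)%:E) : n k / (n <= k)%N >-> (n <= k)%E}.
  apply/nondecreasing_seqP => n; rewrite lee_fin lerD // lerXn2r ?nnegrE ?rm_le //;
    exact: running_max_ge0.
have mnG w : (fun n => (mn n w)%:E) @ \oo --> G w by exact: ereal_nondecreasing_cvgn.
have rmi eps n : square_integrable P (rm eps n).
  exact: (running_max_square_integrable eps (fun i => @tt_itv n i) (leqnn _)).
have imn n : P.-integrable setT (EFin \o mn n).
  by apply: integrable_EFinD => //; [exact: (rmi 1 n).2|exact: (rmi (-1) n).2].
have mnT n : \int[P]_w mn n w <= 8 * T.
  have := doob_inequality 1 (fun i => @tt_itv n i) (fun i _ => tt_le n i).
  have := doob_inequality (-1) (fun i => @tt_itv n i) (fun i _ => tt_le n i).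
  have -> : tt n (2 ^ n)%N = T.
    by rewrite /tt natrX; field; rewrite !gt_eqF // exprn_gt0.
  rewrite RintegralD //; [|exact: (rmi 1 n).2|exact: (rmi (-1) n).2].
  rewrite sqrrN expr1n /rm; lra.
have mG : measurable_fun setT G.
  apply: (emeasurable_fun_cvg (fun n w => (mn n w)%:E)) => [n|w _]; last exact: mnG.
  exact: (measurable_int P (imn n)).
have G0 w : (0 <= G w)%E.
  by apply: le_trans (ereal_sup_ubound _); last (by exists 0%N); rewrite lee_fin.
have iG : P.-integrable setT G.
  apply/integrableP; split => //.
  under eq_integral do rewrite gee0_abs //.
  have -> : (\int[P]_w G w = \int[P]_w limn (fun n => (mn n w)%:E))%E.
    by apply: eq_integral => w _; apply/esym/cvg_lim => //; exact: mnG.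
  have cv := @cvg_monotone_convergence _ _ _ P setT measurableT (fun n w => (mn n w)%:E)
    (fun n => measurable_int P (imn n)) (fun n w _ => mn0 n w) (fun w _ => mn_le w).
  rewrite -(cvg_lim _ cv) //; apply: (@le_lt_trans _ _ (8 * T)%:E); last by rewrite ltry.
  apply: lime_le; first by apply/cvg_ex; eexists; exact: cv.
  by apply: nearW => n; rewrite -EFin_Rintegral // lee_fin.
exists V, (fine \o G); split=> //.
- move=> w; have [Nw|Nw] := pselect (N w); first by rewrite VN.
  by rewrite VW // clamp_id ?in_itv /= ?lexx //; case: (hN w Nw).
- move=> t w tT; have [Nw|Nw] := pselect (N w); first by rewrite VN // expr0n /= fine_ge0.
  have [_ cW] := hN w Nw; have [K hK] := within_continuous_bound T0' cW.
  have K0 : 0 <= K := le_trans (normr_ge0 _) (hK t tT).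
  (* Off [N] the path is bounded, so that [G w] is finite and [fine] does not replace it by the
     default value 0. *)
  have Gfin : G w \is a fin_num.
    rewrite ge0_fin_numE //; apply: (@le_lt_trans _ _ (K ^+ 2 + K ^+ 2)%:E); last by rewrite ltry.
    apply: ge_ereal_sup => _ [n _ <-]; rewrite lee_fin lerD // lerXn2r ?nnegrE ?running_max_ge0 //.
      apply: running_max_le => // i ni; rewrite mul1r (le_trans (ler_norm _)) // hK //.
      exact: tt_itv.
    apply: running_max_le => // i ni; rewrite mulN1r (le_trans (ler_norm _)) // normrN hK //.
    exact: tt_itv.
  have Vgrid n i : (i <= 2 ^ n)%N -> V (tt n i) w ^+ 2 <= fine (G w).
    move=> ni; rewrite VW // clamp_id; last exact: tt_itv.
    apply: (@le_trans _ _ (mn n w)).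
      have h1 : W (tt n i) w <= rm 1 n w.
        by rewrite -[leLHS]mul1r; exact: (@running_max_ge _ (fun i => 1 * W (tt n i) w)).
      have h2 : - W (tt n i) w <= rm (-1) n w.
        by rewrite -[leLHS]mulN1r; exact: (@running_max_ge _ (fun i => -1 * W (tt n i) w)).
      have h3 := @running_max_ge0 _ (fun i => 1 * W (tt n i) w) (2 ^ n).
      have h4 := @running_max_ge0 _ (fun i => -1 * W (tt n i) w) (2 ^ n).
      rewrite -/(rm 1 n w) in h3; rewrite -/(rm (-1) n w) in h4.
      by rewrite /mn; case: (leP 0 (W (tt n i) w)) => ?; nra.
    by rewrite -lee_fin fineK //; apply: ereal_sup_ubound; exists n.
  have t0 : 0 <= t by move: tT; rewrite in_itv => /andP[].
  have cvt : (fun n => tt n (Num.truncn (t * (2 ^+ n / T)))) @ \oo --> t.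
    apply: grid_cvg => //.
    have -> : (fun k => (2 ^+ k / T)^-1) = (fun k => T * 2^-1 ^+ k).
      by apply/funext => k; rewrite invf_div exprVn.
    rewrite -[X in _ --> X](mulr0 T); apply: cvgM; first exact: cvg_cst.
    by apply: cvg_expr; rewrite ger0_norm ?invr_ge0 // invf_lt1 // ltr1n.
  have cv2 : (fun n => V (tt n (Num.truncn (t * (2 ^+ n / T)))) w ^+ 2) @ \oo --> V t w ^+ 2.
    have cv1 : (fun n => V (tt n (Num.truncn (t * (2 ^+ n / T)))) w) @ \oo --> V t w.
      exact: (cvg_comp _ _ cvt (cV w t)).
    by apply: cvgM; exact: cv1.
  have tT' : t <= T by move: tT; rewrite in_itv => /andP[].
  rewrite -(cvg_lim _ cv2) //; apply: limr_le; first by apply/cvg_ex; eexists; exact: cv2.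
  apply: nearW => n; apply: Vgrid; rewrite -(ler_nat R).
  have /andP[h1 _] := truncn_itv (mulr_ge0 t0 (ltW (p2 n))).
  apply: le_trans h1 _; rewrite natrX mulrA ler_pdivrMr //.
  by rewrite mulrC ler_pM2l // exprn_gt0.
- exact: integrable_fine.
Qed.

End wiener_maximum.

(** * Ito integrals of deterministic functions *)

Lemma ge0_cvg0_le (R : realType) (u : nat -> \bar R) : (forall k, (0 <= u k)%E) ->
  (forall e : R, 0 < e -> exists N, forall k, (N <= k)%N -> (u k <= e%:E)%E) ->
  u @ \oo --> 0%E.
Proof.
move=> u0 hu; apply/fine_cvgP; split.
  have [N hN] := hu 1 ltr01; exists N => // k /= /hN uk.
  by rewrite ge0_fin_numE // (le_lt_trans uk) ?ltry.
apply/cvgrPdist_le => e e0; have [N hN] := hu e e0; exists N => // k /= /hN uk.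
rewrite sub0r normrN /= ger0_norm ?fine_ge0 // -lee_fin fineK //.
by rewrite ge0_fin_numE // (le_lt_trans uk) ?ltry.
Qed.

Lemma primitive_itv (R : realType) (f : R -> R) (t : R) : 0 <= t ->
  primitive 0 f t = \int[lebesgue_measure]_(s in `[0, t]) f s.
Proof.
rewrite /primitive le_eqVlt => /predU1P[<-|t0].
  by rewrite set_itv1 Rintegral_set1 subr0.
have -> : `[t, 0]%classic = set0 :> set R by rewrite set_itv_ge // bnd_simp -ltNge.
by rewrite Rintegral_set0 subr0.
Qed.

Section pathwise.
Context {R : realType}.
Notation mu := (@lebesgue_measure R).

(** The indicator of ]tau i, tau i.+1] at t is the increment of [h], and the sum telescopes. The
    cells are open on the left, which excludes [t = tau 0]. *)
Lemma sum_indic_itv (tau : nat -> R) (n : nat) (t : R) :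
  (forall i, (i < n)%N -> tau i <= tau i.+1) -> tau 0%N < t -> t <= tau n ->
  \sum_(i < n) \1_(`]tau i, tau i.+1]%classic) t = 1 :> R.
Proof.
move=> tau_le t0 tn.
pose h i : R := if tau i < t then -1 else 0.
transitivity (\sum_(0 <= i < n) (h i.+1 - h i)).
  rewrite big_mkord; apply: eq_bigr => i _.
  rewrite indicE mem_setE in_itv /= /h; have := tau_le i (ltn_ord i).
  case: (ltP (tau i) t) => h1; case: (leP t (tau i.+1)) => h2 h3 /=; try lra.
by rewrite telescope_sumr // /h t0 ltNge tn /= opprK add0r.
Qed.

(* Integration by parts on each cell [p, r] of the partition:
   h p (f r - f p) - [h f + \int kappa f]_p^r = \int_p^r kappa (f r - f). *)
Lemma stieltjes_sum_error (h kappa f : R -> R) (tau : nat -> R) (n : nat) (t K w T : R) :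
  continuous kappa -> continuous f -> f 0 = 0 ->
  (forall r s, 0 <= r -> r <= s -> s <= T ->
    h s - h r = - \int[mu]_(x in `[r, s]) kappa x) ->
  (forall s, s \in `[0, T] -> `|kappa s| <= K) ->
  0 <= t -> t <= T -> tau 0%N = 0 -> tau n = T ->
  (forall i, (i < n)%N -> tau i <= tau i.+1) ->
  (forall i s, (i < n)%N -> s \in `[tau i, tau i.+1] -> s <= t ->
    `|f (Num.min (tau i.+1) t) - f s| <= w) ->
  `|\sum_(i < n) h (tau i) * (f (Num.min (tau i.+1) t) - f (Num.min (tau i) t)) -
    (h t * f t + primitive 0 (fun s => kappa s * f s) t)| <= K * w * t.
Proof.
move=> ck cf f0 hh kK t0 tT tau0 tauT tau_le fw.
have ckf : continuous (fun s => kappa s * f s).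
  by move=> s; apply: continuousM; [exact: ck|exact: cf].
pose F s := h s * f s + primitive 0 (fun s => kappa s * f s) s.
pose rho i := Num.min (tau i) t.
have tau_mono i j : (i <= j)%N -> (j <= n)%N -> tau i <= tau j.
  move=> ij; elim: j ij => [|j IHj]; first by rewrite leqn0 => /eqP ->.
  rewrite leq_eqVlt => /predU1P[->//|ij jn].
  exact: le_trans (IHj ij (ltnW jn)) (tau_le j jn).
have tau_ge0 i : (i <= n)%N -> 0 <= tau i by move=> ni; rewrite -tau0 tau_mono.
have tau_leT i : (i <= n)%N -> tau i <= T by move=> ni; rewrite -tauT tau_mono.
have rho0 : rho 0%N = 0 by rewrite /rho tau0 min_l.
have rhon : rho n = t by rewrite /rho tauT min_r.
have -> : h t * f t + primitive 0 (fun s => kappa s * f s) t =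
    \sum_(i < n) (F (rho i.+1) - F (rho i)).
  rewrite -(big_mkord xpredT (fun i => F (rho i.+1) - F (rho i))) telescope_sumr //.
  by rewrite rhon rho0 /F f0 mulr0 primitive0 addr0 subr0.
have -> : K * w * t = \sum_(i < n) (K * w * (rho i.+1 - rho i)).
  rewrite -mulr_sumr -(big_mkord xpredT (fun i => rho i.+1 - rho i)) telescope_sumr //.
  by rewrite rhon rho0 subr0.
rewrite -sumrB; apply: le_trans (ler_norm_sum _ _ _) _; apply: ler_sum => i _.
have ni := ltn_ord i; have tle := tau_le i ni.
rewrite -/(rho i) -/(rho i.+1).
have [ti|ti] := leP t (tau i).
  have -> : rho i = t by rewrite /rho min_r.
  have -> : rho i.+1 = t by rewrite /rho min_r // (le_trans ti).
  by rewrite !subrr !mulr0 subrr normr0.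
have rhoi : rho i = tau i by rewrite /rho min_l // ltW.
have ri0 : 0 <= rho i by rewrite rhoi tau_ge0 // ltnW.
have rle : rho i <= rho i.+1 by rewrite rhoi /rho le_min tle ltW.
have riT : rho i.+1 <= T by rewrite /rho ge_min tT orbT.
have rit : rho i.+1 <= t by rewrite /rho ge_min lexx orbT.
set p := rho i in rhoi ri0 rle *; set r := rho i.+1 in rle riT rit *.
have Fpr : F r - F p = h r * f r - h p * f p + \int[mu]_(x in `[p, r]) (kappa x * f x).
  rewrite /F (Rintegral_is_derive ckf (is_derive_primitive 0 ckf) rle); ring.
have ik : mu.-integrable `[p, r] (EFin \o kappa) by exact: continuous_integrable_itv.
have ikf : mu.-integrable `[p, r] (EFin \o (fun x => kappa x * f x)) by exact: continuous_integrable_itv.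
have mpr : measurable (`[p, r]%classic : set (measurableTypeR R)) by exact: measurable_itv.
have ikr := integrable_EFinZl mpr (f r) ik.
have -> : h (tau i) * (f r - f p) - (F r - F p) =
    \int[mu]_(x in `[p, r]) (f r * kappa x - kappa x * f x).
  rewrite RintegralB // RintegralZl // Fpr -rhoi.
  have := hh p r ri0 rle riT; set I1 := \int[mu]_(x in `[p, r]) kappa x => hpr.
  have -> : h r = h p - I1 by rewrite -hpr; ring.
  ring.
have iD := integrable_EFinB mpr ikr ikf.
apply: le_trans (le_normr_Rintegral _ iD) _ => //.
have -> : K * w * (r - p) = \int[mu]_(x in `[p, r]) (K * w).
  rewrite Rintegral_cst //= lebesgue_measure_itv /= lte_fin.
  move: rle; rewrite le_eqVlt => /predU1P[->|->]; last by rewrite -EFinB.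
  by rewrite ltxx subrr.
apply: le_Rintegral => //.
- apply: continuous_integrable_itv => x; apply: cvg_norm.
  by apply: cvgB; apply: cvgM; [exact: cvg_cst|exact: ck|exact: ck|exact: cf].
- by apply: continuous_integrable_itv => x; exact: cvg_cst.
move=> x /= /[!in_itv] /= /andP[px xr].
have -> : f r * kappa x - kappa x * f x = kappa x * (f r - f x) by ring.
rewrite normrM; apply: ler_pM => //.
  by apply: kK; rewrite in_itv /= (le_trans ri0) //= (le_trans xr).
apply: fw => //; last exact: le_trans rit.
rewrite in_itv /= -rhoi px /= (le_trans xr) // /r /rho ge_min lexx //.
Qed.

End pathwise.

(** * Progressive measurability of continuous adapted processes *)

Section adapted.
Context d (Omega : measurableType d) (R : realType).
Context (P : probability Omega R) (T : R) (W : R -> Omega -> R).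
Notation mu := (@lebesgue_measure R).
Implicit Types X : R -> Omega -> R.

(** Freezing [X] at the last grid point [j / (k + 1)] before s gives approximations that converge by
    continuity. Grid points to the left of s keep them adapted, so that their preimages are
    countable unions of measurable rectangles. *)
Lemma continuous_adapted_progressive X : (forall w, continuous (X^~ w)) ->
  (forall t, t \in `[0, T] -> measurable_at P W t (X t)) ->
  progressively_measurable P W T X.
Proof.
move=> cX aX t tT; have [t0 tT'] : 0 <= t /\ t <= T by move: tT; rewrite in_itv => /andP.
pose G := g_sigma_algebraType (completed_events P W t).
pose h k (p : R * G) := X ((Num.truncn (p.1 * k.+1%:R))%:R / k.+1%:R) p.2.
apply: (measurable_fun_cvg (h := h)) => [k|[s w] [/= sT _]]; last first.
  have s0 : 0 <= s by move: sT; rewrite in_itv => /andP[].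
  have cs : (fun k => (Num.truncn (s * k.+1%:R))%:R / k.+1%:R) @ \oo --> (s : R).
    by apply: (@grid_cvg R (fun k => k.+1%:R)) => //; exact: cvg_harmonic.
  exact: (cvg_comp _ _ cs (cX w s)).
move=> _ B mB; pose A j := `[0, t]%classic `&` `[j%:R / k.+1%:R, j.+1%:R / k.+1%:R[%classic : set R.
pose C j : set G := X (j%:R / k.+1%:R) @^-1` B.
have k0 : 0 < k.+1%:R :> R by [].
have -> : (`[0, t] `*` setT) `&` h k @^-1` B = \bigcup_j (A j `*` C j).
  apply/seteqP; split=> [[s w] /= [[st _] hB]|[s w] [j _ [/= [st sj] hC]]].
    have s0 : 0 <= s by move: st; rewrite in_itv => /andP[].
    exists (Num.truncn (s * k.+1%:R)) => //; split => //=; split=> //.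
    have /andP[h1 h2] := truncn_itv (mulr_ge0 s0 (ltW k0)).
    by apply/andP; rewrite /= !bnd_simp ler_pdivrMr // ltr_pdivlMr // h1 h2.
  split=> //; rewrite /h /=; suff -> : Num.truncn (s * k.+1%:R) = j by [].
  have /andP[/= h1 h2] := sj; apply: truncn_def.
  by move: h1 h2; rewrite !bnd_simp ler_pdivrMr // ltr_pdivlMr // => -> ->.
apply: bigcup_measurable => j _.
have [jt|tj] := leP (j%:R / k.+1%:R) t.
  apply: measurableX; first exact: measurableI.
  have jT : j%:R / k.+1%:R \in `[0, T] by rewrite in_itv /= divr_ge0 //= (le_trans jt).
  have := measurable_at_le jt (aX _ jT).
  by move=> /(_ measurableT B mB); rewrite setTI.
(* When the grid point lies beyond t, the value of [X] there need not be [F_t]-measurable, but its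
   cell does not meet [0, t]. *)
have -> : A j = set0.
  apply/seteqP; split=> // s [/andP[_ st] /andP[js _]].
  rewrite /= !bnd_simp in st js.
  by move: (le_lt_trans (le_trans js st) tj); rewrite ltxx.
by rewrite set0X.
Qed.

(** Progressive measurability is joint measurability for the sigma-algebra [F_t] on Omega, so the
    measurability part of Tonelli's theorem over this sigma-algebra applies to the positive and
    negative parts. *)
Lemma adapted_integral X t : t \in `[0, T] -> progressively_measurable P W T X ->
  measurable_at P W t (fun w => \int[mu]_(s in `[0, t]) X s w).
Proof.
move=> tT /(_ t tT) mX.
pose G := g_sigma_algebraType (completed_events P W t).
have mD : measurable (`[0, t]%classic : set R) by [].
have mX' : measurable_fun (`[0, t] `*` setT) (fun p : R * G => (X p.1 p.2)%:E).
  exact/measurable_EFinP.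
have mp := measurable_funepos mX'; have mn := measurable_funeneg mX'.
have m1 := @tonelli_measurable _ _ _ G R mu _ mD _ mp (funepos_ge0 _).
have m2 := @tonelli_measurable _ _ _ G R mu _ mD _ mn (funeneg_ge0 _).
have := measurableT_comp (fine_measurable measurableT) (emeasurable_funB m1 m2).
apply: eq_measurable_fun => w _; rewrite /Rintegral [in RHS]integralE /=.
congr (fine (_ - _)%E); apply: eq_integral => s _; [by rewrite !funeposE|by rewrite !funenegE].
Qed.

End adapted.

Section deterministic_integrand.
Context d (Omega : measurableType d) (R : realType).
Context (P : probability Omega R) (T : R) (W : R -> Omega -> R).
Hypothesis hW : wiener_process P T W.
Hypothesis T0 : 0 < T.
Context (V : R -> Omega -> R) (g : Omega -> R).
Hypothesis hV : wiener_version P T W V g.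
Notation mu := (@lebesgue_measure R).

Section uniform_partition.
Variables (h : R -> R) (k : nat).

Definition uniform_time (i : nat) : R := i%:R * (T / k.+1%:R).

Let step0 : 0 < T / k.+1%:R. Proof. by rewrite divr_gt0. Qed.

Lemma uniform_time0 : uniform_time 0 = 0. Proof. exact: mul0r. Qed.

Lemma uniform_timeT : uniform_time k.+1 = T.
Proof. by rewrite /uniform_time mulrC divfK // pnatr_eq0. Qed.

Lemma uniform_time_lt i : (i < k.+1)%N -> uniform_time i < uniform_time i.+1.
Proof. by move=> _; rewrite /uniform_time ltr_pM2r // ltr_nat. Qed.

Lemma uniform_timeS i : uniform_time i.+1 = uniform_time i + T / k.+1%:R.
Proof. by rewrite /uniform_time -natr1 mulrDl mul1r. Qed.

Lemma uniform_time_itv i : (i <= k.+1)%N -> uniform_time i \in `[0, T].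
Proof.
move=> ik; rewrite in_itv /=; apply/andP; split; first by rewrite mulr_ge0 // (ltW step0).
by rewrite -[leRHS]uniform_timeT ler_pM2r // ler_nat.
Qed.

Definition uniform_simple_process : simple_process P T W.
Proof.
refine (@SimpleProcess _ _ _ P T W k.+1 uniform_time (fun i _ => h (uniform_time i))
  uniform_time0 uniform_timeT uniform_time_lt _ _).
- by move=> i _; exact: measurable_cst.
- by move=> i _; exists `|h (uniform_time i)|.
Defined.

End uniform_partition.

Variables h kappa : R -> R.
Hypothesis ch : continuous h.
Hypothesis ckappa : continuous kappa.
Hypothesis h_kappa : forall r s, 0 <= r -> r <= s -> s <= T ->
  h s - h r = - \int[mu]_(x in `[r, s]) kappa x.

(* \int_0^t h dW integrated by parts, with h' = - kappa. *)
Definition deterministic_ito (t : R) (w : Omega) : R :=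
  h t * V t w + primitive 0 (fun s => kappa s * V s w) t.

Let T0' : 0 <= T := ltW T0.

Let ckV w : continuous (fun s => kappa s * V s w).
Proof. by move=> s; apply: continuousM; [exact: ckappa|exact: (version_continuous hV)]. Qed.

Lemma deterministic_ito_continuous w : continuous (deterministic_ito^~ w).
Proof.
move=> t; apply: cvgD; last exact: (is_derive_continuous (is_derive_primitive 0 (@ckV w))).
by apply: cvgM; [exact: ch|exact: (version_continuous hV)].
Qed.

Lemma primitive_adapted (f : R -> R) (t : R) : continuous f -> t \in `[0, T] ->
  measurable_at P W t (fun w => primitive 0 (fun s => f s * V s w) t).
Proof.
move=> cf tT; have t0 : 0 <= t by move: tT; rewrite in_itv => /andP[].
have -> : (fun w => primitive 0 (fun s => f s * V s w) t) =
    (fun w => \int[mu]_(s in `[0, t]) (f s * V s w)).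
  by apply/funext => w; rewrite primitive_itv.
apply: (adapted_integral tT); apply: continuous_adapted_progressive => [w|s sT].
  by move=> s; apply: continuousM; [exact: cf|exact: (version_continuous hV)].
by apply: measurable_funM; [exact: measurable_cst|exact: (version_adapted hV)].
Qed.

Lemma deterministic_ito_adapted (t : R) : t \in `[0, T] ->
  measurable_at P W t (deterministic_ito t).
Proof.
move=> tT; apply: measurable_funD; last exact: primitive_adapted.
by apply: measurable_funM; [exact: measurable_cst|exact: (version_adapted hV)].
Qed.

Let mesh_lt (r : R) : 0 < r -> exists N, forall k, (N <= k)%N -> T / k.+1%:R < r.
Proof.
move=> r0; exists (Num.truncn (T / r)) => k Nk; rewrite ltr_pdivrMr // mulrC -ltr_pdivrMr //.
have /andP[_ h2] := truncn_itv (divr_ge0 T0' (ltW r0)).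
by apply: lt_le_trans h2 _; rewrite ler_nat.
Qed.

Let cell_close (k i : nat) (s r : R) : T / k.+1%:R < r ->
  s \in `[uniform_time k i, uniform_time k i.+1] ->
  `|uniform_time k i - s| < r /\ `|uniform_time k i.+1 - s| < r.
Proof.
move=> kr; rewrite in_itv /= => /andP[]; rewrite uniform_timeS => h1 h2.
move: kr h1 h2; move: (uniform_time k i) (T / k.+1%:R) => x D kr h1 h2.
by split; rewrite ltr_norml; apply/andP; split; lra.
Qed.

Lemma uniform_value_cvg :
  (fun k => \int[P]_w \int[mu]_(t in `[0%R, T])
    ((sp_value (uniform_simple_process h k) t w - h t) ^+ 2)%:E)%E @ \oo --> 0%E.
Proof.
apply: ge0_cvg0_le => [k|e e0].
  by apply: integral_ge0 => w _; apply: integral_ge0 => t _; rewrite lee_fin sqr_ge0.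
(* A uniform error [eps] on [0, T] has squared integral [eps^2 T = e]. *)
pose eps := Num.sqrt (e / T).
have eps0 : 0 < eps by rewrite sqrtr_gt0 divr_gt0.
have [r r0 hr] := uniformly_continuous_itv 0 T ch eps0.
have [N hN] := mesh_lt r0; exists N => k /hN kr.
(* At time 0 the simple process vanishes, its cells being open on the left; that point is removed
   from the integral below. *)
have close (t : R) w : t \in `]0, T] ->
    `|sp_value (uniform_simple_process h k) t w - h t| <= eps.
  rewrite in_itv /= => /andP[t0 tT].
  have one : \sum_(i < k.+1) \1_(`]uniform_time k i, uniform_time k i.+1]%classic) t = 1 :> R.
    apply: sum_indic_itv => [i ik||]; first exact: ltW (uniform_time_lt _).
      by rewrite uniform_time0.
    by rewrite uniform_timeT.
  rewrite /sp_value /= -[h t]mulr1 -[eps]mulr1 -one !mulr_sumr -sumrB.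
  apply: le_trans (ler_norm_sum _ _ _) _; apply: ler_sum => i _.
  rewrite indicE mem_setE.
  case: (boolP (t \in `]uniform_time k i, uniform_time k i.+1])) => [ti|_]; last first.
    by rewrite !mulr0 subrr normr0.
  rewrite !mulr1 ltW //; apply: hr; first by rewrite uniform_time_itv // ltnW.
  have [|//] := @cell_close k i t r kr.
  by move: ti; rewrite !in_itv /= => /andP[/ltW -> ->].
have int_le w : (\int[mu]_(t in `[0%R, T])
    ((sp_value (uniform_simple_process h k) t w - h t) ^+ 2)%:E <= e%:E)%E.
  have mF : measurable_fun `[0, T]
      (fun t => ((sp_value (uniform_simple_process h k) t w - h t) ^+ 2)%:E).
    apply/measurable_EFinP; apply: measurable_funX; apply: measurable_funB.
      exact: (measurable_slice1 _ _ (sp_value_joint hW _)).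
    by apply: measurable_funTS; exact: continuous_measurable_fun.
  rewrite -integral_itv_obnd_cbnd; last first.
    by apply: measurable_funS mF => //; apply: subset_itvr; rewrite bnd_simp.
  apply: (@le_trans _ _ (\int[mu]_(t in `]0%R, T]) (eps ^+ 2)%:E)%E).
    apply: ge0_le_integral_nonmeasurable => t tT; first by rewrite lee_fin sqr_ge0.
    rewrite lee_fin -real_normK ?num_real // lerXn2r ?nnegrE ?(ltW eps0) //.
    exact: close.
  rewrite integral_cst //= lebesgue_measure_itv /= lte_fin T0 -EFinB -EFinM lee_fin subr0.
  by rewrite /eps sqr_sqrtr ?divr_ge0 ?(ltW e0) // divfK // gt_eqF.
apply: (@le_trans _ _ (\int[P]_w (cst e%:E w))%E).
  apply: ge0_le_integral_nonmeasurable => w _ //.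
  by apply: integral_ge0 => t _; rewrite lee_fin sqr_ge0.
by rewrite integral_cst // [X in (_ * X)%E]probability_setT mule1.
Qed.

(** [stieltjes_sum_error] is used twice: with the modulus of continuity of a path it gives almost
    sure convergence, and with the crude oscillation bound [2 sqrt g] it gives the domination. *)
Lemma uniform_integral_cvg (t : R) : t \in `[0, T] ->
  (fun k => \int[P]_w ((sp_integral (uniform_simple_process h k) t w -
    deterministic_ito t w) ^+ 2)%:E)%E @ \oo --> 0%E.
Proof.
move=> tT; have [t0 tT'] : 0 <= t /\ t <= T by move: tT; rewrite in_itv => /andP.
have [K hK] := within_continuous_bound T0' (continuous_subspaceT ckappa).
have K0 : 0 <= K.
  by apply: le_trans (normr_ge0 _) (hK 0 _); rewrite in_itv /= lexx.
pose D k w := sp_integral (uniform_simple_process h k) t w - deterministic_ito t w.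
have error w k (om : R) : (forall s : R, s \in `[0, T] -> V s w = W s w) -> 0 <= om ->
    (forall i (s : R), (i < k.+1)%N -> s \in `[uniform_time k i, uniform_time k i.+1] ->
      s <= t -> `|V (Num.min (uniform_time k i.+1) t) w - V s w| <= om) ->
    `|D k w| <= K * om * T.
  move=> VW om0 hom.
  have tT0 i : (i <= k.+1)%N -> Num.min (uniform_time k i) t \in `[0, T].
    by move=> ik; case: (leP (uniform_time k i) t) => _ //; exact: uniform_time_itv.
  have -> : D k w = \sum_(i < k.+1) h (uniform_time k i) *
      (V (Num.min (uniform_time k i.+1) t) w - V (Num.min (uniform_time k i) t) w) -
      deterministic_ito t w.
    congr (_ - _); apply: eq_bigr => i _ /=.
    by rewrite !VW // tT0 // ltnW.
  apply: (@le_trans _ _ (K * om * t)); last by rewrite ler_wpM2l // mulr_ge0.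
  apply: (@stieltjes_sum_error _ h kappa (V^~ w) (uniform_time k) k.+1 t K om T) => //.
  - exact: (version_continuous hV).
  - exact: (version_start hV).
  - exact: uniform_time0.
  - exact: uniform_timeT.
  - by move=> i ik; rewrite ltW // uniform_time_lt.
have mD k : measurable_fun setT (D k).
  apply: measurable_funB; first by case: (sp_integral_square_integrable hW (uniform_simple_process h k) tT).
  exact: (measurable_at_measurable hW tT' (deterministic_ito_adapted tT)).
have gi := version_bound_integrable hV.
have aeD : {ae P, forall w, D ^~ w @ \oo --> (0 : R)}.
  apply: filterS (version_ae hV) => w VW; apply/cvgrPdist_le => e e0.
  have KT : 0 < K * T + 1 by rewrite ltr_wpDl // mulr_ge0.
  have e1 : 0 < e / (K * T + 1) by rewrite divr_gt0.
  have [r r0 hr] := uniformly_continuous_itv 0 T (version_continuous hV (w := w)) e1.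
  have [N hN] := mesh_lt r0; exists N => // k /= /hN kr.
  rewrite sub0r normrN; apply: (@le_trans _ _ (K * (e / (K * T + 1)) * T)).
    apply: error => //; first exact: ltW.
    move=> i s ik si st; rewrite ltW // distrC; apply: hr.
      have := uniform_time_itv (ltnW ik); move: si; rewrite !in_itv /= => /andP[h1 _] /andP[h2 _].
      by rewrite (le_trans h2 h1) (le_trans st).
    have [_ h2] := cell_close kr si; rewrite distrC; case: (leP (uniform_time k i.+1) t) => // ts.
    apply: le_lt_trans h2; rewrite !ger0_norm; lra.
  have -> : K * (e / (K * T + 1)) * T = (K * T) * e / (K * T + 1) by ring.
  by rewrite ler_pdivrMr // mulrC ler_pM2l // lerDl.
have [] := @dominated_convergence _ _ _ P setT measurableT (fun k w => (D k w ^+ 2)%:E)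
  (cst 0%E) (fun w => ((2 * K * T) ^+ 2 * g w)%:E).
- by move=> k; apply/measurable_EFinP/measurable_funX; exact: mD.
- exact: measurable_cst.
- apply: filterS aeD => w h0 _; apply: cvg_EFin; first exact: nearW.
  have h2 : (fun k => D k w * D k w) @ \oo --> (0 * 0 : R) by exact: cvgM.
  by rewrite mulr0 in h2; exact: h2.
- exact: (integrable_EFinZl measurableT _ gi).
- apply: filterS (version_ae hV) => w VW k _.
  rewrite gee0_abs ?lee_fin ?sqr_ge0 //.
  have g0 : 0 <= g w by apply: le_trans (version_bound hV w tT); rewrite sqr_ge0.
  have -> : (2 * K * T) ^+ 2 * g w = (K * (2 * Num.sqrt (g w)) * T) ^+ 2.
    by rewrite -{1}(sqr_sqrtr g0); ring.
  rewrite -real_normK ?num_real // lerXn2r ?nnegrE //.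
    by rewrite !mulr_ge0 // sqrtr_ge0.
  apply: error => //.
  have Vb (s : R) : s \in `[0, T] -> `|V s w| <= Num.sqrt (g w).
    move=> sT; rewrite -(ler_sqr (x := `|V s w|)) ?nnegrE ?sqrtr_ge0 //.
    by rewrite real_normK ?num_real // sqr_sqrtr // (version_bound hV).
  move=> i s ik si st; apply: le_trans (ler_normB _ _) _.
  rewrite mulr_natl mulr2n lerD // Vb //.
    by case: (leP (uniform_time k i.+1) t) => _ //; exact: uniform_time_itv.
  have := uniform_time_itv (ltnW ik); move: si; rewrite !in_itv /= => /andP[h1 _] /andP[h2 _].
  by rewrite (le_trans h2 h1) (le_trans st).
by move=> _ _; rewrite integral0.
Qed.

Lemma deterministic_ito_integral :
  ito_integral P T W (fun t _ => h t) deterministic_ito.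
Proof.
split.
- apply: continuous_adapted_progressive => [w|t tT]; first exact: ch.
  exact: measurable_cst.
- have ih : mu.-integrable `[0, T] (EFin \o (fun t => h t ^+ 2)).
    by apply: continuous_integrable_itv => t; apply: cvgM; exact: ch.
  rewrite integral_cst // [X in (_ * X)%E]probability_setT mule1.
  exact: integrable_lty ih.
- exact: deterministic_ito_adapted.
- by apply: aeW => w; apply: continuous_subspaceT; exact: deterministic_ito_continuous.
exists (uniform_simple_process h); split; first exact: uniform_value_cvg.
exact: uniform_integral_cvg.
Qed.

End deterministic_integrand.

(** * Existence *)

Section existence.
Context d (Omega : measurableType d) (R : realType).
Context (P : probability Omega R) (T : R) (W : R -> Omega -> R).
Hypothesis hW : wiener_process P T W.
Hypothesis T0 : 0 < T.
Notation mu := (@lebesgue_measure R).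

Let T0' : 0 <= T := ltW T0.

Let cM (f g : R -> R) : continuous f -> continuous g -> continuous (fun t => f t * g t).
Proof. by move=> cf cg t; apply: continuousM; [exact: cf|exact: cg]. Qed.
Let cD (f g : R -> R) : continuous f -> continuous g -> continuous (fun t => f t + g t).
Proof. by move=> cf cg t; apply: continuousD; [exact: cf|exact: cg]. Qed.
Let cN (f : R -> R) : continuous f -> continuous (fun t => - f t).
Proof. by move=> cf t; apply: continuousN; exact: cf. Qed.
Let cC (r : R) : continuous (fun _ : R => r).
Proof. by move=> t; exact: cvg_cst. Qed.

Let dD (f g f' g' : R -> R) : (forall t : R, is_derive t 1 f (f' t)) ->
  (forall t : R, is_derive t 1 g (g' t)) ->
  forall t : R, is_derive t 1 (fun t => f t + g t) (f' t + g' t).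
Proof. by move=> df dg t; exact: is_deriveD. Qed.
Let dM (f g f' g' : R -> R) : (forall t : R, is_derive t 1 f (f' t)) ->
  (forall t : R, is_derive t 1 g (g' t)) ->
  forall t : R, is_derive t 1 (fun t => f t * g t) (f' t * g t + f t * g' t).
Proof.
move=> df dg t; have := is_deriveM (df t) (dg t).
by have -> : f t *: g' t + g t *: f' t = f' t * g t + f t * g' t by rewrite /GRing.scale /=; ring.
Qed.
Let dC (r : R) : forall t : R, is_derive t 1 (fun _ : R => r) 0.
Proof. by move=> t; exact: is_derive_cst. Qed.

Section noise.
Context (V : R -> Omega -> R) (g : Omega -> R).
Hypothesis hV : wiener_version P T W V g.

(** [sqrt g] dominates [|V|] and the 1 absorbs the deterministic terms; the square is at most
    [2 (1 + g)], hence integrable. *)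
Let G w : R := 1 + Num.sqrt (g w).

Let g0 w : 0 <= g w.
Proof.
have zT : (0 : R) \in `[0, T] by rewrite in_itv /= lexx.
by apply: le_trans (version_bound hV w zT); rewrite sqr_ge0.
Qed.

Let G1 w : 1 <= G w. Proof. by rewrite /G lerDl sqrtr_ge0. Qed.

Definition dominated (X : R -> Omega -> R) := exists C : R, forall (t : R) w, t \in `[0, T] ->
  `|X t w| <= C * G w.

Lemma dominated_cst (f : R -> R) : continuous f -> dominated (fun t _ => f t).
Proof.
move=> cf; have [K hK] := within_continuous_bound T0' (continuous_subspaceT cf).
exists K => t w tT; have K0 := le_trans (normr_ge0 _) (hK t tT).
by apply: le_trans (hK t tT) _; rewrite ler_peMr.
Qed.

Lemma dominatedD X Y : dominated X -> dominated Y -> dominated (fun t w => X t w + Y t w).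
Proof.
move=> [C hC] [D hD]; exists (C + D) => t w tT.
by rewrite (le_trans (ler_normD _ _)) // mulrDl lerD ?hC ?hD.
Qed.

Lemma dominatedZ (f : R -> R) X : continuous f -> dominated X ->
  dominated (fun t w => f t * X t w).
Proof.
move=> cf [C hC]; have [K hK] := within_continuous_bound T0' (continuous_subspaceT cf).
by exists (K * C) => t w tT; rewrite normrM -mulrA ler_pM ?hK ?hC.
Qed.

Lemma dominated_version : dominated V.
Proof.
exists 1 => t w tT; rewrite mul1r /G (@le_trans _ _ (Num.sqrt (g w))) ?lerDr //.
rewrite -(ler_sqr (x := `|V t w|)) ?nnegrE ?sqrtr_ge0 //.
by rewrite real_normK ?num_real // sqr_sqrtr // (version_bound hV).
Qed.

Lemma dominated_primitive (X : R -> Omega -> R) : (forall w, continuous (X^~ w)) ->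
  dominated X -> dominated (fun t w => primitive 0 (X^~ w) t).
Proof.
move=> cX [C hC]; exists (C * T) => t w; rewrite in_itv /= => /andP[t0 tT].
rewrite primitive_itv //.
have iX : mu.-integrable `[0, t] (EFin \o X^~ w) by exact: continuous_integrable_itv.
apply: le_trans (le_normr_Rintegral _ iX) _ => //.
have TT : T \in `[0, T] by rewrite in_itv /= T0' lexx.
have CG : 0 <= C * G w by apply: le_trans (normr_ge0 _) (hC T w TT).
apply: (@le_trans _ _ (\int[mu]_(s in `[0, t]) (C * G w))).
  apply: le_Rintegral => //.
  - apply: continuous_integrable_itv => x; apply: cvg_norm; exact: cX.
  - exact: continuous_integrable_itv.
  by move=> s; rewrite /= in_itv /= => /andP[s0 st]; apply: hC; rewrite in_itv /= s0 (le_trans st).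
rewrite Rintegral_cst //= lebesgue_measure_itv /= lte_fin.
have -> : C * T * G w = C * G w * T by ring.
by case: ifP => _ /=; [rewrite subr0 ler_wpM2l|rewrite mulr0 mulr_ge0].
Qed.

Lemma dominated_sqr X : dominated X -> exists C : R, forall (t : R) w, t \in `[0, T] ->
  X t w ^+ 2 <= C * (1 + g w).
Proof.
move=> [C hC]; exists (2 * C ^+ 2) => t w tT.
have CG := le_trans (normr_ge0 _) (hC t w tT).
apply: (@le_trans _ _ ((C * G w) ^+ 2)).
  by rewrite -(real_normK (num_real (X t w))) lerXn2r ?nnegrE // hC.
have -> : g w = Num.sqrt (g w) ^+ 2 by rewrite sqr_sqrtr.
have := sqr_ge0 (1 - Num.sqrt (g w)); have := sqr_ge0 C; rewrite /G; nra.
Qed.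

Lemma integrable_dominant : P.-integrable setT (EFin \o (fun w => 1 + g w)).
Proof.
apply: integrable_EFinD => //; last exact: (version_bound_integrable hV).
exact: (finite_measure_integrable_cst P 1 measurableT).
Qed.

Lemma dominated_bounded_process X : (forall w, continuous (X^~ w)) ->
  (forall t, t \in `[0, T] -> measurable_at P W t (X t)) -> dominated X ->
  bounded_process P T X.
Proof.
move=> cX aX dX; split.
  by apply: (progressively_measurable_joint hW T0'); exact: continuous_adapted_progressive.
have [C hC] := dominated_sqr dX; exists (C * \int[P]_w (1 + g w)) => t tT.
have ig := integrable_dominant; have iCg := integrable_EFinZl measurableT C ig.
rewrite -RintegralZl // EFin_Rintegral //.
apply: ge0_le_integral_nonmeasurable => w _; first by rewrite lee_fin sqr_ge0.
by rewrite lee_fin hC.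
Qed.

Lemma version_mean (t : R) : t \in `[0, T] -> \int[P]_w V t w = 0.
Proof.
move=> tT; have [t0 tT'] : 0 <= t /\ t <= T by move: tT; rewrite in_itv => /andP.
rewrite -(increment_mean hW (lexx 0) t0 tT'); congr fine; apply: ae_eq_integral => //.
- by apply/measurable_EFinP; exact: (measurable_at_measurable hW tT' (version_adapted hV tT)).
- by apply/measurable_EFinP; exact: (measurable_increment hW (lexx 0) t0 tT').
have zT : (0 : R) \in `[0, T] by rewrite in_itv /= lexx.
by apply: filterS (version_ae hV) => w VW _; rewrite -!VW // (version_start hV) subr0.
Qed.

Lemma weighted_version_continuous (f : R -> R) w : continuous f ->
  continuous (fun s => f s * V s w).
Proof. by move=> cf; apply: cM => //; exact: (version_continuous hV). Qed.

Lemma weighted_version_mean (f : R -> R) (t : R) : continuous f -> t \in `[0, T] ->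
  \int[P]_w primitive 0 (fun s => f s * V s w) t = 0.
Proof.
move=> cf tT; have [t0 tT'] : 0 <= t /\ t <= T by move: tT; rewrite in_itv => /andP.
pose X s w := f s * V s w.
have [mX [C XC]] : bounded_process P T X.
  apply: dominated_bounded_process => [w|s sT|]; first exact: weighted_version_continuous.
    by apply: measurable_funM; [exact: measurable_cst|exact: (version_adapted hV)].
  by apply: dominatedZ => //; exact: dominated_version.
have [_ _ e] := product_fubini mX XC (square_integrable_cst P 1) (lexx 0) tT'.
transitivity (\int[P]_w \int[mu]_(r in `[0, t]) (cst 1 w * X r w)).
  by apply: eq_Rintegral => w _; rewrite primitive_itv //; apply: eq_Rintegral => s _; rewrite mul1r.
rewrite e; transitivity (\int[mu]_(r in `[0, t]) (cst 0 r : R)); last first.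
  by rewrite Rintegral_cst // mul0r.
apply: eq_Rintegral => r; rewrite inE /= in_itv /= => /andP[r0 rt].
have rT : r \in `[0, T] by rewrite in_itv /= r0 (le_trans rt).
have bV : bounded_process P T V.
  apply: dominated_bounded_process; [exact: (version_continuous hV)|exact: (version_adapted hV)|].
  exact: dominated_version.
transitivity (f r * \int[P]_w V r w); last by rewrite version_mean // mulr0.
rewrite -RintegralZl //; last exact: (square_integrable1 (bounded_process_square_integrable bV rT)).
by apply: eq_Rintegral => w _; rewrite mul1r.
Qed.

End noise.

Context (sigma : R) (a abar b beta m mbar n : R -> R) (q qbar x0 : R).
Hypotheses (ca : {within `[0, T], continuous a})
  (cabar : {within `[0, T], continuous abar})
  (cb : {within `[0, T], continuous b}) (cbeta : {within `[0, T], continuous beta})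
  (cm : {within `[0, T], continuous m}) (cmbar : {within `[0, T], continuous mbar})
  (cn : {within `[0, T], continuous n})
  (n_gt0 : forall t : R, t \in `[0, T] -> 0 < n t).

Let c (t : R) : R := b t ^+ 2 / n t.
Let k (t : R) : R := m t * m t.
Let al (t : R) : R := a t + abar t.
Let kb (t : R) : R := (m t + mbar t) * (m t + mbar t).
Let cc : {within `[0, T], continuous c} := within_continuous_feedback cb cn n_gt0.
Let ck : {within `[0, T], continuous k} := within_continuousM cm cm.
Let cal : {within `[0, T], continuous al} := within_continuousD ca cabar.
Let ckb : {within `[0, T], continuous kb} :=
  within_continuousM (within_continuousD cm cmbar) (within_continuousD cm cmbar).
Let c0 (t : R) : t \in `[0, T] -> 0 <= c t.
Proof. exact: feedback_ge0. Qed.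
Let k0 (t : R) : t \in `[0, T] -> 0 <= k t.
Proof. by move=> _; rewrite /k -expr2 sqr_ge0. Qed.
Let kb0 (t : R) : t \in `[0, T] -> 0 <= kb t.
Proof. by move=> _; rewrite /kb -expr2 sqr_ge0. Qed.
Let ccl (f : R -> R) : {within `[0, T], continuous f} -> continuous (fun t => f (clamp T t)).
Proof. exact: continuous_comp_clamp. Qed.

(** Shooting from T: (p, r) is the solution with source [beta] and null terminal values, and a
    multiple of the flow (u, v) is added to it. Every multiple respects the terminal relation, and
    [u 0 != 0] allows the initial value [x0] to be reached. *)
Lemma mean_system : exists xb yb : R -> R, [/\ xb 0 = x0, yb T = (q + qbar) ^+ 2 * xb T,
  forall t : R, is_derive t 1 xb
    (al (clamp T t) * xb t - c (clamp T t) * yb t + beta (clamp T t)) &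
  forall t : R, is_derive t 1 yb (- (al (clamp T t) * yb t) - kb (clamp T t) * xb t)].
Proof.
have [u [v [[uT vT] du dv u0]]] :=
  hamiltonian_flow T0' (sqr_ge0 (q + qbar)) cal cc ckb c0 kb0.
have [K1 h1] := clamped_bounds3 T0' cal cc ckb.
have [K2 h2] := bounded_comp_clamp T0' cbeta.
have K10 : 0 <= K1 by have [/(le_trans (normr_ge0 _))] := h1 0.
have K20 : 0 <= K2 := le_trans (normr_ge0 _) (h2 0).
have [||p [r [pT rT dp dr]]] := @linear_system2_exists _ (fun t : R => al (clamp T t))
  (fun t : R => - c (clamp T t)) (fun t : R => - kb (clamp T t)) (fun t : R => - al (clamp T t))
  (fun t : R => beta (clamp T t)) (fun _ : R => 0) (K1 + K2) T 0 0 (ccl cal) (cN (ccl cc))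
  (cN (ccl ckb)) (cN (ccl cal)) (ccl cbeta) (@cC 0).
- by move=> t; rewrite !normrN; have [] := h1 t; split; lra.
- by move=> t; rewrite normr0; have := h2 t; split; lra.
pose e := (x0 - p 0) / u 0.
exists (fun t => p t + e * u t), (fun t => r t + e * v t); split.
- by rewrite /e; field; exact: u0.
- by rewrite pT rT uT vT; ring.
- move=> t; have := dD dp (dM (@dC e) du) t; congr (is_derive t 1 _ _); ring.
- move=> t; have := dD dr (dM (@dC e) dv) t; congr (is_derive t 1 _ _); ring.
Qed.

(** The Riccati equation [eta' = c eta^2 - 2 a eta - m^2], from the quotient rule. It is integrated
    because [eta], frozen outside [0, T] to be continuous on the line, may fail to be differentiable
    at 0 and T. *)
Lemma riccati_quotient (u v : R -> R) (s t : R) :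
  (forall t : R, is_derive t 1 u (a (clamp T t) * u t - c (clamp T t) * v t)) ->
  (forall t : R, is_derive t 1 v (- (a (clamp T t) * v t) - k (clamp T t) * u t)) ->
  (forall t : R, t <= T -> u t != 0) -> 0 <= s -> s <= t -> t <= T ->
  let eta r := v (clamp T r) / u (clamp T r) in
  eta t - eta s = - \int[mu]_(r in `[s, t])
    (eta r * (a (clamp T r) - c (clamp T r) * eta r) + a (clamp T r) * eta r + k (clamp T r)).
Proof.
move=> du dv u0 s0 st tT eta.
have u0' r : u (clamp T r) != 0.
  by apply: u0; have := clamp_itv r T0'; rewrite in_itv => /andP[].
have cu := is_derive_continuous du; have cv := is_derive_continuous dv.
have cw (f : R -> R) : continuous f -> {within `[0, T], continuous f} by exact: continuous_subspaceT.
have ceta : continuous eta.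
  move=> r; apply: cvgM; first exact: (ccl (cw _ cv)).
  by apply: cvgV; [exact: u0'|exact: (ccl (cw _ cu))].
pose f r := eta r * (a (clamp T r) - c (clamp T r) * eta r) + a (clamp T r) * eta r + k (clamp T r).
have cf : continuous f.
  apply: cD; last exact: ccl.
  apply: cD; apply: cM => //; [|exact: ccl].
  by apply: cD; [exact: ccl|apply: cN; apply: cM => //; exact: ccl].
move: st; rewrite le_eqVlt => /predU1P[->|st].
  by rewrite set_itv1 Rintegral_set1 oppr0 subrr.
have dq r : r <= T -> 0 <= r -> is_derive r 1 (fun r => v r / u r) (- f r).
  move=> rT r0; have ur := u0 r rT.
  have /= := @is_deriveM _ _ v (fun r => (u r)^-1) r 1 _ _ (dv r) (is_deriveV ur (du r)).
  congr (is_derive r 1 _ _); rewrite /f /eta clamp_id ?in_itv /= ?r0 ?rT //.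
  by rewrite /GRing.scale /=; field.
have sclamp r : 0 <= r -> r <= T -> eta r = v r / u r.
  by move=> r0 rT; rewrite /eta clamp_id // in_itv /= r0.
have t0 : 0 <= t := le_trans s0 (ltW st).
have sT : s <= T := le_trans (ltW st) tT.
have cq r : r <= T -> {for r, continuous (fun r => v r / u r)}.
  by move=> rT; apply: cvgM; [exact: cv|apply: cvgV; [exact: u0|exact: cu]].
rewrite sclamp // sclamp //.
have if_ : mu.-integrable `[s, t] (EFin \o f) by exact: continuous_integrable_itv.
have -> : \int[mu]_(r in `[s, t]) f r = - (\int[mu]_(r in `[s, t]) (- f r)).
  have mst : measurable (`[s, t]%classic : set (measurableTypeR R)) by exact: measurable_itv.
  have e := RintegralZl (-1) mst if_.
  have -> : \int[mu]_(r in `[s, t]) (- f r) = -1 * \int[mu]_(r in `[s, t]) f r.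
    by rewrite -e; apply: eq_Rintegral => r _; rewrite mulN1r.
  by rewrite mulN1r opprK.
rewrite opprK /Rintegral (@continuous_FTC2 _ (fun r => - f r) (fun r => v r / u r)) //.
- by apply: continuous_subspaceT; exact: cN.
- split=> [r||].
  + rewrite in_itv /= => /andP[sr rt]; apply: ex_derive.
    by apply: dq; [exact: (le_trans (ltW rt))|exact: (le_trans s0 (ltW sr))].
  + by apply: cvg_at_right_filter; exact: cq.
  + by apply: cvg_at_left_filter; exact: cq.
move=> r; rewrite in_itv /= => /andP[sr rt].
have dr : is_derive r 1 (fun r => v r / u r) (- f r).
  by apply: dq; [exact: (le_trans (ltW rt))|exact: (le_trans s0 (ltW sr))].
by rewrite derive1E derive_val.
Qed.

Lemma solution_exists : exists x y z,
  mkv_fbsde_solution P T W sigma a abar b beta m mbar n q qbar x0 x y z.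
Proof.
have [V [g hV]] := wiener_version_exists hW T0.
have [u [v [[uT vT] du dv u0]]] := hamiltonian_flow T0' (sqr_ge0 q) ca cc ck c0 k0.
have [xb [yb [xb0 ybT dxb dyb]]] := mean_system.
have zT : (0 : R) \in `[0, T] by rewrite in_itv /= lexx.
have TT : T \in `[0, T] by rewrite in_itv /= T0' lexx.
have itvE (t : R) : t \in `[0, T] -> 0 <= t /\ t <= T by rewrite in_itv => /andP.
have cu := is_derive_continuous du; have cv := is_derive_continuous dv.
have cxb := is_derive_continuous dxb; have cyb := is_derive_continuous dyb.
have cV w : continuous (V^~ w) by exact: (version_continuous hV).
have u0' r : u (clamp T r) != 0 by apply: u0; have [] := itvE _ (clamp_itv r T0').
have cw (f : R -> R) : continuous f -> {within `[0, T], continuous f} by exact: continuous_subspaceT.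
pose eta r := v (clamp T r) / u (clamp T r).
have cui : continuous (fun r => (u (clamp T r))^-1).
  by move=> r; apply: cvgV; [exact: u0'|exact: (ccl (cw _ cu))].
have ceta : continuous eta by apply: cM => //; exact: (ccl (cw _ cv)).
pose l r := a (clamp T r) - c (clamp T r) * eta r.
have cl : continuous l by apply: cD; [exact: ccl|apply: cN; apply: cM => //; exact: ccl].
pose f r := l r / u (clamp T r).
have cf : continuous f by exact: cM.
(* By [riccati_quotient], the opposite of the derivative of [sigma eta] inside [0, T], as required
   for the integration by parts of its Ito integral. *)
pose kap r := sigma * (eta r * l r + a (clamp T r) * eta r + k (clamp T r)).
have ckap0 : continuous (fun r => eta r * l r + a (clamp T r) * eta r + k (clamp T r)).
  by apply: cD; [apply: cD; apply: cM => //|]; exact: ccl.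
have ckap : continuous kap by exact: cM (@cC sigma) ckap0.
have cfV w : continuous (fun s => f s * V s w) by exact: (weighted_version_continuous hV).
have ckV w : continuous (fun s => kap s * V s w) by exact: (weighted_version_continuous hV).
pose p w := primitive 0 (fun s => f s * V s w).
have dp w (t : R) : is_derive t 1 (p w) (f t * V t w) by exact: is_derive_primitive.
have cp w : continuous (p w) := is_derive_continuous (dp w).
pose r w := primitive 0 (fun s => kap s * V s w).
have dr w (t : R) : is_derive t 1 (r w) (kap t * V t w) by exact: is_derive_primitive.
have cr w : continuous (r w) := is_derive_continuous (dr w).
(* Variation of constants. On [0, T], [u' = a u - c v = l u], so the part [sigma u p] is
   differentiable in time with derivative [sigma (l u p + u f V) = l xi], and
   [d xi = l xi dt + sigma dV]. *)
pose xi t w := sigma * (V t w + u t * p w t).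
pose x t w := xb t + xi t w.
pose y t w := yb t + eta t * xi t w.
have cxi w : continuous (xi^~ w) by apply: cM => //; apply: cD => //; exact: cM.
have cx w : continuous (x^~ w) by exact: cD.
have cy w : continuous (y^~ w) by apply: cD => //; exact: cM.
have aC (t e : R) : measurable_at P W t (fun _ => e) by exact: measurable_cst.
have ap (t : R) : t \in `[0, T] -> measurable_at P W t (p^~ t).
  by move=> tT; exact: (primitive_adapted hV).
have axi (t : R) : t \in `[0, T] -> measurable_at P W t (xi t).
  move=> tT; apply: measurable_funM; first exact: aC.
  apply: measurable_funD; first exact: (version_adapted hV).
  by apply: measurable_funM; [exact: aC|exact: ap].
have ax (t : R) : t \in `[0, T] -> measurable_at P W t (x t).
  by move=> tT; apply: measurable_funD; [exact: aC|exact: axi].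
have ay (t : R) : t \in `[0, T] -> measurable_at P W t (y t).
  by move=> tT; apply: measurable_funD; [exact: aC|apply: measurable_funM; [exact: aC|exact: axi]].
have dV : dominated g V by exact: dominated_version.
have dP : dominated g (fun t w => p w t).
  by apply: (@dominated_primitive g (fun s w => f s * V s w)) => //; exact: dominatedZ.
have dxi : dominated g xi.
  apply: (dominatedZ (@cC sigma)); apply: (dominatedD dV).
  exact: dominatedZ.
have dx : dominated g x by apply: dominatedD => //; exact: dominated_cst.
have dy : dominated g y.
  by apply: dominatedD; [exact: dominated_cst|exact: dominatedZ].
have bV : bounded_process P T V.
  by apply: (dominated_bounded_process hV) => //; exact: (version_adapted hV).
have bp : bounded_process P T (fun t w => p w t) by exact: (dominated_bounded_process hV).
have bxi : bounded_process P T xi by exact: (dominated_bounded_process hV).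
have E0 (t : R) : t \in `[0, T] -> \int[P]_w xi t w = 0.
  move=> tT.
  have i1 := square_integrable1 (bounded_process_square_integrable bV tT).
  have i2 := square_integrable1 (bounded_process_square_integrable bp tT).
  have i3 := integrable_EFinZl measurableT (u t) i2.
  rewrite /xi RintegralZl //; last exact: integrable_EFinD.
  rewrite RintegralD // RintegralZl // (version_mean hV) // (weighted_version_mean hV) //.
  by rewrite mulr0 addr0 mulr0.
have mean_affine (e1 e2 t : R) : t \in `[0, T] -> fine 'E_P[fun w => e1 + e2 * xi t w] = e1.
  move=> tT; have i1 := square_integrable1 (bounded_process_square_integrable bxi tT).
  rewrite mean_Rintegral RintegralD //; last exact: integrable_EFinZl.
    by rewrite RintegralZl // E0 // mulr0 addr0 Rintegral_cst // [X in fine X]probability_setT mulr1.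
  exact: (finite_measure_integrable_cst P e1 measurableT).
have Ex (t : R) : t \in `[0, T] -> fine 'E_P[x t] = xb t.
  move=> tT; rewrite -[RHS](mean_affine _ 1 t tT); congr (fine 'E_P[_]).
  by apply/funext => w; rewrite mul1r.
have Ey (t : R) : t \in `[0, T] -> fine 'E_P[y t] = yb t by move=> tT; exact: mean_affine.
have V0 w : V 0 w = 0 by exact: (version_start hV).
have p0 w : p w 0 = 0 by exact: primitive0.
have r0 w : r w 0 = 0 by exact: primitive0.
have xi0 w : xi 0 w = 0 by rewrite /xi V0 p0 mulr0 addr0 mulr0.
have etaE (t : R) : t \in `[0, T] -> eta t = v t / u t by move=> tT; rewrite /eta clamp_id.
have sub (t : R) : t \in `[0, T] -> [set` `[0, t]] `<=` [set` `[0, T]].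
  by rewrite in_itv /= => /andP[_ tT]; apply: subset_itvl; rewrite bnd_simp.
have cp0 w : continuous (fun t => u t * p w t) by exact: cM.
(* [F] is a drift as written in the system; it agrees on [0, T] with [dX], which is continuous on
   the whole line thanks to [clamp]. *)
have FTC (X dX : R -> Omega -> R) (F : R -> Omega -> R) w : continuous (dX^~ w) ->
    (forall t : R, is_derive t 1 (X^~ w) (dX t w)) ->
    (forall t, t \in `[0, T] -> F t w = dX t w) ->
    mu.-integrable `[0, T] (fun s => (F s w)%:E) /\
    forall t, t \in `[0, T] -> \int[mu]_(s in `[0, t]) F s w = X t w - X 0 w.
  move=> cdX ddX FdX; split.
    have := continuous_integrable_itv 0 T cdX.
    by apply: eq_integrable => // s; rewrite inE /= => sT; rewrite FdX.
  move=> t tT; have [t0 _] := itvE t tT; rewrite -(Rintegral_is_derive cdX ddX t0).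
  by apply: eq_Rintegral => s; rewrite inE => /(sub _ tT) sT; rewrite FdX.
exists x, y, (fun t _ => sigma * eta t); split.
- exact: continuous_adapted_progressive.
- exact: continuous_adapted_progressive.
- by apply: continuous_adapted_progressive => [w|t tT]; [exact: cM|exact: aC].
- by move=> w; exact: cw.
- by move=> w; exact: cw.
- have [Cx hx] := dominated_sqr hV dx; have [Cy hy] := dominated_sqr hV dy.
  have iz : mu.-integrable `[0, T] (EFin \o (fun t => `|sigma * eta t| ^+ 2)).
    have cz : continuous (fun t => sigma * eta t) by exact: cM.
    apply: continuous_integrable_itv; apply: cM => t; apply: cvg_norm; exact: cz.
  pose Z := \int[mu]_(t in `[0, T]) (`|sigma * eta t| ^+ 2).
  have ib : P.-integrable setT (EFin \o (fun w => (Cx + Cy) * (1 + g w) + Z)).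
    apply: integrable_EFinD => //.
      by apply: integrable_EFinZl => //; exact: (integrable_dominant hV).
    exact: (finite_measure_integrable_cst P Z measurableT).
  apply: le_lt_trans (integrable_lty measurableT ib).
  have supE (X : R -> Omega -> R) (C : R) : (forall (t : R) w, t \in `[0, T] -> X t w ^+ 2 <= C * (1 + g w)) ->
      forall w, (0 <= ereal_sup [set (`|X t w| ^+ 2)%:E | t in [set` `[0%R, T]]])%E /\
      (ereal_sup [set (`|X t w| ^+ 2)%:E | t in [set` `[0%R, T]]] <= (C * (1 + g w))%R%:E)%E.
    move=> hX w; split.
      by apply: le_trans (ereal_sup_ubound _); last (by exists 0); rewrite lee_fin.
    apply: ge_ereal_sup => _ [t tT <-].
    by rewrite lee_fin real_normK ?num_real // hX.
  have ZE : (\int[mu]_(t in `[0%R, T]) (`|sigma * eta t| ^+ 2)%:E = Z%:E)%E.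
    by rewrite EFin_Rintegral.
  have Z0 : 0 <= Z by apply: Rintegral_ge0 => t _.
  apply: ge0_le_integral_nonmeasurable => w _.
    have [h1 _] := supE x Cx hx w; have [h2 _] := supE y Cy hy w.
    by rewrite ZE; apply: adde_ge0; [exact: adde_ge0|rewrite lee_fin].
  have [_ h1] := supE x Cx hx w; have [_ h2] := supE y Cy hy w.
  by rewrite ZE /= mulrDl !EFinD leeD2r // leeD.
(* For a constant integrand [deterministic_ito] reduces to [sigma V], and what remains of x is the
   differentiable path [xb + sigma u p]. *)
- exists (deterministic_ito V (fun _ => sigma) (fun _ => 0)).
    apply: (deterministic_ito_integral hW T0 hV (@cC sigma) (@cC 0)) => r1 r2 _ _ _.
    by rewrite Rintegral_cst // mul0r oppr0 subrr.
  apply: aeW => w.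
  pose dR t w := al (clamp T t) * xb t - c (clamp T t) * yb t + beta (clamp T t) +
    (0 * (u t * p w t) + sigma * ((a (clamp T t) * u t - c (clamp T t) * v t) * p w t +
      u t * (f t * V t w))).
  have cdR : continuous (dR^~ w).
    apply: cD.
      by apply: cD; [apply: cD; [apply: cM => //|apply: cN; apply: cM => //]|]; exact: ccl.
    apply: cD; first by apply: cM => //; exact: cC.
    apply: cM; first exact: cC.
    apply: cD; apply: cM => //.
    by apply: cD; [apply: cM => //|apply: cN; apply: cM => //]; exact: ccl.
  have [|i1 i2] := FTC (fun t w => xb t + sigma * (u t * p w t)) dR (fun t w =>
      a t * x t w + abar t * fine 'E_P[x t] - b t ^+ 2 / n t * y t w + beta t) w cdR
      (dD dxb (dM (@dC sigma) (dM du (dp w)))).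
    move=> t tT; rewrite Ex // /dR /f /l /x /y etaE // clamp_id // -/(c t) /al /xi.
    by field; apply: u0; have [] := itvE t tT.
  split=> // t tT; have [t0 _] := itvE t tT.
  rewrite (i2 t tT) p0 {1 2}/x xi0 /deterministic_ito primitive_itv //.
  have -> : \int[mu]_(s in `[0, t]) (0 * V s w) = 0.
    by under eq_Rintegral do rewrite mul0r; rewrite Rintegral_cst // mul0r.
  by rewrite /xi; ring.
- by apply: aeW => w; rewrite /x xi0 addr0 xb0.
(* On [0, T], [eta u = v], hence [y = yb + sigma (eta V + v p)], while the Ito integral of
   [sigma eta] is [sigma eta V + r]. Their difference [yb + sigma v p - r] is differentiable, and
   its derivative is the drift. *)
- exists (deterministic_ito V (fun t => sigma * eta t) kap).
    apply: (deterministic_ito_integral hW T0 hV _ ckap) => [|r1 r2 h1 h2 h3].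
      exact: cM.
    have := riccati_quotient du dv u0 h1 h2 h3; rewrite -/(eta r1) -/(eta r2) => e.
    have e' : sigma * eta r2 - sigma * eta r1 = sigma * (eta r2 - eta r1) by ring.
    rewrite e' e mulrN -RintegralZl //; last exact: continuous_integrable_itv.
  apply: aeW => w.
  pose dR t w := - (al (clamp T t) * yb t) - kb (clamp T t) * xb t +
    (0 * (v t * p w t) + sigma * ((- (a (clamp T t) * v t) - k (clamp T t) * u t) * p w t +
      v t * (f t * V t w))) + (0 * r w t + -1 * (kap t * V t w)).
  have cdR : continuous (dR^~ w).
    apply: cD; last by apply: cD; apply: cM => //; exact: cC.
    apply: cD.
      by apply: cD; apply: cN; apply: cM => //; exact: ccl.
    apply: cD; first by apply: cM; [exact: cC|exact: cM].
    apply: cM; first exact: cC.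
    apply: cD; apply: cM => //.
    by apply: cD; apply: cN; apply: cM => //; exact: ccl.
  have [|i1 i2] := FTC (fun t w => yb t + sigma * (v t * p w t) + -1 * r w t) dR (fun t w =>
      - (a t * y t w + m t * (m t * x t w + mbar t * fine 'E_P[x t])) -
      (abar t * fine 'E_P[y t] + mbar t * (m t + mbar t) * fine 'E_P[x t])) w cdR
      (dD (dD dyb (dM (@dC sigma) (dM dv (dp w)))) (dM (@dC (-1)) (dr w))).
    move=> t tT; rewrite Ex // Ey // /dR /f /kap /l /x /y etaE // clamp_id // /al /kb /k /xi.
    by field; apply: u0; have [] := itvE t tT.
  split=> // t tT; have [t0 tT'] := itvE t tT.
  rewrite (i2 t tT) p0 r0 /y xi0 /deterministic_ito -/(r w t) etaE // /xi.
  by field; apply: u0.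
- by apply: aeW => w; rewrite !Ex // /x /y etaE // uT vT ybT divr1; ring.
Qed.

End existence.

Theorem proposition4p1
  (d : measure_display) (Omega : measurableType d) (R : realType)
  (P : probability Omega R) (T : R) (hT : 0 < T)
  (W : R -> Omega -> R) (hW : wiener_process P T W)
  (sigma : R) (hsigma : 0 < sigma)
  (a abar b beta m mbar n : R -> R)
  (ha : {within `[0, T], continuous a})
  (habar : {within `[0, T], continuous abar})
  (hb : {within `[0, T], continuous b})
  (hbeta : {within `[0, T], continuous beta})
  (hm : {within `[0, T], continuous m})
  (hmbar : {within `[0, T], continuous mbar})
  (hn : {within `[0, T], continuous n})
  (hn_gt0 : forall t : R, t \in `[0, T] -> 0 < n t)
  (q qbar x0 : R) :
  (exists x y z : R -> Omega -> R,
     mkv_fbsde_solution P T W sigma a abar b beta m mbar n q qbar x0 x y z) /\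
  (forall x y z x' y' z' : R -> Omega -> R,
     mkv_fbsde_solution P T W sigma a abar b beta m mbar n q qbar x0 x y z ->
     mkv_fbsde_solution P T W sigma a abar b beta m mbar n q qbar x0 x' y' z' ->
     same_solution P T x y z x' y' z').
Proof.
split; first exact: (solution_exists hW hT).
move=> x y z x' y' z' hs hs'.
exact: (solution_unique hW hT ha habar hb hbeta hm hmbar hn hn_gt0 hs hs').
Qed.
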